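(* Fix real numbers $0<x_{\min}<x_{\max}$, $a\ge x_{\max}-x_{\min}$, $b\ge 1$ and $\varepsilon\in(0,1/2)$. Then there is a constant $c>0$ depending only on $\varepsilon,x_{\max},x_{\min}$ with the following property. Let $m=m_n\ge1$, $L=L_n\ge1$, $k=k_n\ge1$ be sequences of integers and $\sigma_z=\sigma_{z,n}\ge0$ a sequence of reals, indexed by $n\in\mathbb N$, such that $\log m=\Theta(\log n)$, $\log L=O(\log n)$, $k\le n^{1-2\varepsilon}$ and $$\max(\sigma_z^4,m^2,n^2)\,k\log n\le m^2n^{1-\varepsilon}L .$$ Suppose that $A_1,\dots,A_L$ are independent $m\times n$ random matrices with i.i.d. $N(0,1)$ entries. Then for all sufficiently large $n$, $$\sup_{\mathcal C\in\mathcal F_{a,b,k,n}}R_2(\mathcal C,m,n,\sigma_z)\ \ge\ c\,\frac{\max(\sigma_z^4,m^2,n^2)\,k\log n}{m^2nL}.$$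
   Context: Model: $\boldsymbol x_o\in\mathbb R^n$ is an unknown vector and $X_o=\mathrm{diag}(\boldsymbol x_o)$. One observes $\boldsymbol y_l=A_lX_o\boldsymbol w_l+\boldsymbol z_l\in\mathbb R^m$ for $l=1,\dots,L$, where $\boldsymbol w_1,\dots,\boldsymbol w_L$ are i.i.d. $N(0,I_n)$, $\boldsymbol z_1,\dots,\boldsymbol z_L$ are i.i.d. $N(0,\sigma_z^2I_m)$, and the families $(A_l)$, $(\boldsymbol w_l)$, $(\boldsymbol z_l)$ are mutually independent. The matrices $A_1,\dots,A_L$ are known to the estimator. Minimax risk: $R_2(\mathcal C,m,n,\sigma_z)=\inf_{\hat{\boldsymbol x}}\sup_{\boldsymbol x_o\in\mathcal C}\mathbb E\left[\|\hat{\boldsymbol x}-\boldsymbol x_o\|_2^2/n\right]$, where the infimum is over all measurable estimators $\hat{\boldsymbol x}$ that are functions of $\boldsymbol y_1,\dots,\boldsymbol y_L$ and $A_1,\dots,A_L$, and the expectation is over all the randomness (including the $A_l$). The dependence on $L$ is suppressed in the notation. Signal classes: for $\mathcal C\subset\mathbb R^n$, $N_\eta(\mathcal C)$ denotes the $\eta$-covering number, i.e. the least number of $\ell_2$-balls of radius $\eta$ covering $\mathcal C$. $\mathcal F_{a,b,k,n}$ denotes the collection of all nonempty subsets $\mathcal C\subset[x_{\min},x_{\max}]^n$ such that $N_\eta(\mathcal C)\le (an^b/\eta)^k$ for every $0<\eta\le an^b$. Asymptotic notation: $a_n=O(b_n)$ means there exist $C,M>0$ with $|a_n|\le C|b_n|$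 for all $n>M$; $a_n=\Theta(b_n)$ means $a_n=O(b_n)$ and $b_n=O(a_n)$. *)

(* Defs.v *)
From HB Require Import structures.
From mathcomp Require Import all_boot all_order all_algebra.
From mathcomp Require Import all_classical all_reals all_analysis.
Import Order.TTheory GRing.Theory Num.Theory.
Import numFieldNormedType.Exports.

Set Implicit Arguments.
Unset Strict Implicit.
Unset Printing Implicit Defensive.

Local Open Scope classical_set_scope.
Local Open Scope ring_scope.

(* Matrices carry the sigma-algebra generated by their entries ([mxvec] merely
   enumerates them); over the reals this is the Borel sigma-algebra. *)
Definition measure_mx_display : measure_display -> measure_display.
Proof. exact. Qed.

Section measurable_matrix.
Context {d} {T : sigmaRingType d}.
Variables m n : nat.

Let entries : 'I_(m * n) -> 'M[T]_(m, n) -> T := fun k M => mxvec M 0 k.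

Let mx_set0 : g_sigma_preimage entries set0.
Proof. exact: sigma_algebra0. Qed.

Let mx_setC A : g_sigma_preimage entries A -> g_sigma_preimage entries (~` A).
Proof. exact: sigma_algebraC. Qed.

Let mx_bigcup (F : (set 'M[T]_(m, n))^nat) :
  (forall i, g_sigma_preimage entries (F i)) ->
  g_sigma_preimage entries (\bigcup_i (F i)).
Proof. exact: sigma_algebra_bigcup. Qed.

HB.instance Definition _ := @isMeasurable.Build (measure_mx_display d)
  'M[T]_(m, n) (g_sigma_preimage entries) mx_set0 mx_setC mx_bigcup.

End measurable_matrix.

Section independence.
Context {R : realType} {d} {T : measurableType d} (P : probability T R).

Definition independent_systems (I : finType) (F : I -> set (set T)) :=
  forall (J : {set I}) (E : I -> set T), (forall i, i \in J -> F i (E i)) ->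
  (P (\bigcap_(i in [set` J]) E i) = \prod_(i in J) P (E i))%E.

Definition independent_RVs (I : finType) d' (T' : measurableType d')
    (X : I -> T -> T') :=
  independent_systems (fun i => preimage_set_system setT (X i) measurable).

Definition has_law d' (T' : measurableType d') (X : T -> T')
    (mu : set T' -> \bar R) :=
  forall B, measurable B -> P (X @^-1` B) = mu B.

(* The centered Gaussian law of standard deviation [s].  [normal_prob 0 0] is
   the uniform law on [0, 1], hence the separate degenerate case. *)
Definition gaussian_law (s : R) : set R -> \bar R :=
  if s == 0 then \d_(0 : R) else normal_prob 0 s.

(* The entries of [X] are i.i.d. of law N(0, s^2); for a column vector this is
   the law N(0, s^2 I). *)
Definition iid_gaussian_entries (s : R) p q (X : T -> 'M[R]_(p, q)) :=
  independent_RVs (fun (ij : 'I_p * 'I_q) t => X t ij.1 ij.2) /\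
  forall i j, has_law (fun t => X t i j) (gaussian_law s).

End independence.

Definition l2norm {R : realType} n (x : 'cV[R]_n) : R :=
  Num.sqrt (\sum_i x i 0 ^+ 2).

Section covering.
Context {R : realType} (n : nat).

Definition covered_by (eta : R) (C : set 'cV[R]_n) (N : nat) :=
  exists center : 'I_N -> 'cV[R]_n,
    forall x, C x -> exists i, l2norm (x - center i) <= eta.

(* Closed balls with arbitrary centers; +oo if [C] has no finite cover. *)
Definition covering_number (eta : R) (C : set 'cV[R]_n) : \bar R :=
  ereal_inf [set (N%:R)%:E | N in covered_by eta C].

Definition signal_class (xmin xmax a b : R) (k : nat) : set (set 'cV[R]_n) :=
  [set C : set 'cV[R]_n | [/\ C !=set0,
    (forall x : 'cV[R]_n, C x -> forall i, xmin <= x i 0 <= xmax) &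
    forall eta : R, 0 < eta <= a * n%:R `^ b ->
      (covering_number eta C <= ((a * n%:R `^ b / eta) ^+ k)%:E)%E]].

End covering.

Section model.
Context {R : realType} {d} {T : measurableType d} (P : probability T R).
Variables (m n L : nat).
Variable A : 'I_L -> {RV P >-> 'M[R]_(m, n)}.
Variable w : 'I_L -> {RV P >-> 'cV[R]_n}.
Variable z : 'I_L -> {RV P >-> 'cV[R]_m}.

Record gaussian_model (sigma : R) : Prop := GaussianModel {
  sensing_independent : independent_RVs P (fun l => A l : T -> _);
  sensing_gaussian : forall l, iid_gaussian_entries P 1 (A l);
  speckle_independent : independent_RVs P (fun l => w l : T -> _);
  speckle_gaussian : forall l, iid_gaussian_entries P 1 (w l);
  noise_independent : independent_RVs P (fun l => z l : T -> _);
  noise_gaussian : forall l, iid_gaussian_entries P sigma (z l);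
  families_independent : independent_systems P
    (tnth [tuple g_sigma_preimage (fun l => A l : T -> _);
                 g_sigma_preimage (fun l => w l : T -> _);
                 g_sigma_preimage (fun l => z l : T -> _)]) }.

Definition measurement (x : 'cV[R]_n) (l : 'I_L) (t : T) : 'cV[R]_m :=
  A l t *m diag_mx x^T *m w l t + z l t.

Definition estimator :=
  {mfun (L.-tuple 'cV[R]_m * L.-tuple 'M[R]_(m, n))%type >-> 'cV[R]_n}.

Definition estimate (xhat : estimator) (x : 'cV[R]_n) (t : T) : 'cV[R]_n :=
  xhat ([tuple measurement x l t | l < L], [tuple A l t | l < L]).

Definition mean_square_error (xhat : estimator) (x : 'cV[R]_n) : \bar R :=
  ('E_P[fun t => (l2norm (estimate xhat x t - x) ^+ 2 / n%:R)%R])%E.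

Definition minimax_risk (C : set 'cV[R]_n) : \bar R :=
  ereal_inf [set ereal_sup [set mean_square_error xhat x | x in C] |
    xhat in [set: estimator]].

End model.

(* Main.v *)
From HB Require Import structures.
Require Import Defs.
From mathcomp Require Import all_boot all_order all_algebra.
From mathcomp.real_closed Require complex.
From mathcomp Require Import all_classical all_reals all_analysis.
From mathcomp Require Import measurable_realfun zify ring lra.
Import Order.TTheory GRing.Theory Num.Theory.
Import numFieldNormedType.Exports.

(** The lower bound is a Bayesian testing argument.  Around the constant signal
    [x0], in the middle of the range, cut the coordinates into [k] segments of [M]
    blocks of [2 s] entries, and let the signal [J] differ from [x0] on one block
    per segment, where it raises [s] squared entries by the factor [1 + delta]
    and lowers [s] others by [1 - delta].  Two signals that disagree in a
    segment are at squared distance of order [s delta^2] there, so that at most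
    one block per segment is compatible with a more precise estimate.  Hence an
    estimate can be close, in half of the segments at least, to a fraction
    about [M^(- k / 2)] only of the [M^k] signals ([count_decoded]).

    Given the sensing matrices, the data are a linear image of one standard
    Gaussian vector, made of all speckles and noises.  Passing from [x0] to a
    signal replaces the covariance [B B^T] of the data by [B (1 + D) B^T], with
    [D] diagonal and small.  The chi-square affinity between the two Gaussian laws
    is at most [expR (tr M^2)] for every small symmetric [M] with
    [B (1 + M) B^T = B (1 + D) B^T] ([gauss_perturbation]); by rotation
    invariance this reduces to a change of scale of independent variables.
    Two choices of [M] are used ([channel_perturbation]): [D] itself, for which the
    cost is [L |r|^2], with [r] the diagonal of [D] for one observation;
    and [W D W], with [W] the orthogonal projection onto the row space of [B], for
    which the cost is a sum over the observations of [tr (P D P D)], where [P] is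
    the block of [W] on the signal coordinates ([signal_proj]).

    The size of the second cost comes from the isotropy of the Gaussian sensing
    matrices.  The law of [P] is invariant under conjugation by isometries, so all
    [P i j] with [i != j] have the same second moment and, because the entries of
    [r] sum to 0, the expected cost per observation is at most
    [|r|^2 E (P i i)^2] ([isotropic_balanced]).  The same invariance gives
    [n (n + 2) E (P i i)^2 = E ((tr P)^2 + 2 tr P^2) <= 3 m^2]
    ([isotropic_total]), and for strong noise a direct estimate gives
    [E (P i i)^2] of order [m^2 / sigma^4].  With [D] itself for the case where
    [m^2] dominates, the cost is always of order
    [L |r|^2 m^2 / max (sigma^4, m^2, n^2)] with probability 3/4
    ([good_sensing]).  The energy [|r|^2 = 2 k s delta^2] is chosen so that this is a
    small multiple of [k ln n], which is less than the entropy [k ln M] of the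
    packing, since [M] exceeds a power of [n].  The signals are then confused with
    [x0], hence with each other, and the risk is of order
    [k s delta^2 / n], which is the announced bound ([testing_lower_bound]). *)

Set Implicit Arguments.
Unset Strict Implicit.
Unset Printing Implicit Defensive.

Local Open Scope classical_set_scope.
Local Open Scope ring_scope.

(** * Isometries and diagonalization *)

Lemma dotE (R : realFieldType) n (u v : 'rV[R]_n) :
  (u *m v^T) 0 0 = \sum_i u 0 i * v 0 i.
Proof. by rewrite mxE; apply: eq_bigr => i _; rewrite mxE. Qed.

Lemma dot_scalar (R : realFieldType) n (u v : 'rV[R]_n) :
  u *m v^T = ((u *m v^T) 0 0)%:M.
Proof. by rewrite [LHS]mx11_scalar. Qed.

Lemma dot_ge0 (R : realFieldType) n (v : 'rV[R]_n) : 0 <= (v *m v^T) 0 0.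
Proof. by rewrite dotE sumr_ge0// => i _; rewrite -expr2 sqr_ge0. Qed.

Lemma dot_eq0 (R : realFieldType) n (v : 'rV[R]_n) :
  ((v *m v^T) 0 0 == 0) = (v == 0).
Proof.
apply/idP/eqP => [|->]; last by rewrite mul0mx mxE.
rewrite dotE psumr_eq0 => [/allP v0|i _]; last by rewrite -expr2 sqr_ge0.
apply/rowP => i; rewrite mxE; apply/eqP.
by have /implyP/(_ isT) := v0 i (mem_index_enum i); rewrite -expr2 sqrf_eq0.
Qed.

Lemma orthogonal_tr (R : comUnitRingType) n (O : 'M[R]_n) :
  O *m O^T = 1%:M -> O^T *m O = 1%:M.
Proof. exact: mulmx1C. Qed.

Lemma orthogonal_mul (R : comUnitRingType) n (O Q : 'M[R]_n) :
  O *m O^T = 1%:M -> Q *m Q^T = 1%:M -> (O *m Q) *m (O *m Q)^T = 1%:M.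
Proof. by move=> OO QQ; rewrite trmx_mul mulmxA -(mulmxA O) QQ mulmx1. Qed.

Definition householder (R : realFieldType) n (v : 'rV[R]_n) : 'M[R]_n :=
  1%:M - (2 / (v *m v^T) 0 0) *: (v^T *m v).

Lemma householder_sym (R : realFieldType) n (v : 'rV[R]_n) :
  (householder v)^T = householder v.
Proof. by rewrite /householder raddfB/= linearZ/= trmx_mul trmxK trmx1. Qed.

Lemma householder_orthogonal (R : realFieldType) n (v : 'rV[R]_n) :
  v != 0 -> householder v *m (householder v)^T = 1%:M.
Proof.
move=> v0; rewrite householder_sym /householder; set q : R := (v *m v^T) 0 0.
have q0 : q != 0 by rewrite dot_eq0.
set E := v^T *m v.
have EE : E *m E = q *: E.
  by rewrite /E mulmxA -(mulmxA v^T) (dot_scalar v v) -/q mul_mx_scalar -scalemxAl.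
rewrite mulmxBl mul1mx mulmxBr mulmx1 -scalemxAl -scalemxAr EE !scalerA.
set c := 2 / q; have cq : c * q = 2 by rewrite /c divfK.
rewrite -mulrA [X in (c * X)](_ : _ = 2)// (_ : c * 2 = c + c); last by ring.
by rewrite scalerDl opprB addrK subrK.
Qed.

Lemma householder_fix (R : realFieldType) m n (v : 'rV[R]_n) (B : 'M[R]_(m, n)) :
  B *m v^T = 0 -> B *m householder v = B.
Proof.
by move=> Bv; rewrite mulmxBr mulmx1 -scalemxAr mulmxA Bv mul0mx scaler0 subr0.
Qed.

Lemma householder_swap (R : realFieldType) n (b h : 'rV[R]_n) :
  b != h -> b *m b^T = h *m h^T -> b *m householder (b - h) = h.
Proof.
move=> bh e; set v := b - h.
have v0 : v != 0 by rewrite subr_eq0.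
rewrite /householder; set q : R := (v *m v^T) 0 0.
have q0 : q != 0 by rewrite dot_eq0.
have bhC : h *m b^T = b *m h^T.
  by rewrite (dot_scalar h) (dot_scalar b) !dotE; congr _%:M; apply: eq_bigr => i _; rewrite mulrC.
have qE : q = 2 * (b *m v^T) 0 0.
  rewrite /q /v raddfB/= mulmxBl !mulmxBr bhC -e !mxE; ring.
rewrite mulmxBr mulmx1 -scalemxAr mulmxA (dot_scalar b) mul_scalar_mx scalerA.
have -> : 2 / q * (b *m v^T) 0 0 = 1.
  by rewrite mulrAC -qE divff.
by rewrite scale1r /v opprB addrCA subrr addr0.
Qed.

(** Align the rows one at a time, each by the reflection exchanging the current
    image with its target; the axis of that reflection is orthogonal to the rows
    already aligned, because the Gram matrices agree. *)
Lemma gram_orthogonal (R : realFieldType) m n (B H : 'M[R]_(m, n)) :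
  B *m B^T = H *m H^T -> exists2 O, O *m O^T = 1%:M & B *m O = H.
Proof.
elim: m => [|m IH] in B H *.
  move=> _; exists 1%:M; first by rewrite trmx1 mulmx1.
  by apply/matrixP => -[].
rewrite -[m.+1]/(1 + m)%N in B H *.
rewrite -[B]vsubmxK -[H]vsubmxK; set b := usubmx B; set B1 := dsubmx B.
set h := usubmx H; set H1 := dsubmx H.
rewrite !tr_col_mx !mul_col_row => /eq_block_mx[bb _ Bb BB].
have [ O1 OO1 BO1] := IH _ _ BB.
set b' := b *m O1.
have b'b' : b' *m b'^T = h *m h^T.
  by rewrite trmx_mul mulmxA -(mulmxA b) OO1 mulmx1.
have H1b' : H1 *m b'^T = H1 *m h^T.
  by rewrite -BO1 trmx_mul mulmxA -(mulmxA B1) OO1 mulmx1 Bb BO1.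
have [b'h|b'h] := eqVneq b' h.
  by exists O1 => //; rewrite mul_col_mx BO1 -/b' b'h.
exists (O1 *m householder (b' - h)).
  by apply: orthogonal_mul => //; rewrite householder_orthogonal// subr_eq0.
rewrite mul_col_mx !mulmxA -/b' BO1 householder_swap//.
by rewrite householder_fix// raddfB/= mulmxBr H1b' subrr.
Qed.

Section complex_eigenvector.
Import real_closed.complex.

(** A complex eigenvector x + i y with eigenvalue a + i b gives b (|x|^2 + |y|^2) = 0
    by symmetry, so x and y are real eigenvectors, one of which is not 0. *)
Lemma symmetric_eigenvector (R : rcfType) n (M : 'M[R]_n.+1) : M^T = M ->
  exists (u : 'rV[R]_n.+1) (a : R), u != 0 /\ u *m M = a *: u.
Proof.
move=> MT; have [c /eigenvalueP[v vM v0]] :=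
  @spectral.eigenvalue_closed R[i] _ (map_mx (real_complex R) M) isT.
pose x : 'rV[R]_n.+1 := map_mx (@complex.Re R) v.
pose y : 'rV[R]_n.+1 := map_mx (@complex.Im R) v.
have xE : x *m M = complex.Re c *: x - complex.Im c *: y.
  apply/rowP => j; have := congr1 (fun w : 'rV[R[i]]_n.+1 => complex.Re (w 0 j)) vM.
  rewrite !mxE raddf_sum/= => e.
  transitivity (\sum_i complex.Re (v 0 i * (map_mx (real_complex R) M) i j)).
    by apply: eq_bigr => i _; rewrite !mxE; case: (v 0 i) => ? ? /=; ring.
  by rewrite e; case: (c) => ? ?; case: (v 0 j) => ? ? /=.
have yE : y *m M = complex.Im c *: x + complex.Re c *: y.
  apply/rowP => j; have := congr1 (fun w : 'rV[R[i]]_n.+1 => complex.Im (w 0 j)) vM.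
  rewrite !mxE raddf_sum/= => e.
  transitivity (\sum_i complex.Im (v 0 i * (map_mx (real_complex R) M) i j)).
    by apply: eq_bigr => i _; rewrite !mxE; case: (v 0 i) => ? ? /=; ring.
  by rewrite e; case: (c) => ? ?; case: (v 0 j) => ? ? /=; ring.
have xy : (y *m M *m x^T) 0 0 = (x *m M *m y^T) 0 0.
  have -> : x *m M *m y^T = (y *m M *m x^T)^T.
    by rewrite !trmx_mul trmxK MT mulmxA.
  by rewrite [RHS]mxE.
have yxC : (y *m x^T) 0 0 = (x *m y^T) 0 0.
  by rewrite !dotE; apply: eq_bigr => i _; rewrite mulrC.
have : complex.Im c * ((x *m x^T) 0 0 + (y *m y^T) 0 0) = 0.
  move: xy; rewrite xE yE mulmxDl mulmxBl -!scalemxAl !mxE.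
  rewrite -!/(_ 0 0).
  move: yxC; rewrite !mxE => ->; lra.
have xyneq0 : ~~ ((x == 0) && (y == 0)).
  apply: contra v0 => /andP[/eqP x0 /eqP y0]; apply/eqP/rowP => j.
  have := congr1 (fun w : 'rV[R]_n.+1 => w 0 j) x0.
  have := congr1 (fun w : 'rV[R]_n.+1 => w 0 j) y0.
  by rewrite !mxE; case: (v 0 j) => ? ? /= -> ->.
move/eqP; rewrite mulf_eq0 => /orP[/eqP b0|]; last first.
  by rewrite paddr_eq0 ?dot_ge0// !dot_eq0 (negbTE xyneq0).
move: xE yE; rewrite b0 !scale0r subr0 add0r => xE yE.
have [x0|x0] := eqVneq x 0; last by exists x, (complex.Re c).
by exists y, (complex.Re c); split=> //; move: xyneq0; rewrite x0 eqxx.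
Qed.

End complex_eigenvector.

(** Split off an eigenvector, moved to the first axis by [gram_orthogonal]. *)
Theorem symmetric_spectral (R : rcfType) n (M : 'M[R]_n) : M^T = M ->
  exists O (d : 'rV[R]_n), O *m O^T = 1%:M /\ M = O^T *m diag_mx d *m O.
Proof.
elim: n => [|n IH] in M *.
  by move=> _; exists 1%:M, 0; split; apply/matrixP => -[].
move=> MT; have [u0 [a [u0N0 u0M]]] := symmetric_eigenvector MT.
pose q := Num.sqrt ((u0 *m u0^T) 0 0).
have q0 : q != 0 by rewrite gt_eqF// sqrtr_gt0 lt_def dot_eq0 u0N0 dot_ge0.
pose u := q^-1 *: u0.
have uu : u *m u^T = 1%:M.
  rewrite /u linearZ/= -scalemxAl -scalemxAr scalerA (dot_scalar u0) -expr2 exprVn.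
  by rewrite sqr_sqrtr ?dot_ge0// scale_scalar_mx mulVf// dot_eq0.
have uM : u *m M = a *: u by rewrite -scalemxAl u0M !scalerA mulrC.
pose e : 'rV[R]_(1 + n) := row_mx 1%:M 0.
have [ O1 OO1 eO1] : exists2 O, O *m O^T = 1%:M & e *m O = u.
  apply: gram_orthogonal.
  by rewrite uu /e tr_row_mx mul_row_col trmx1 mulmx1 mul0mx addr0.
pose M' := O1 *m M *m O1^T.
have M'T : M'^T = M' by rewrite /M' !trmx_mul trmxK MT mulmxA.
have eM' : e *m M' = a *: e.
  rewrite /M' !mulmxA eO1 uM -scalemxAl -eO1 -mulmxA OO1 mulmx1//.
have : e *m M' = row_mx (ulsubmx M') (ursubmx M').
  by rewrite -[M' in LHS]submxK /e mul_row_block !mul1mx !mul0mx !addr0.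
rewrite eM' /e scale_row_mx scaler0 => /eq_row_mx[/esym ulE /esym urE].
have dlE : dlsubmx M' = 0.
  by rewrite -[M']M'T -trmx_ursub urE trmx0.
have drT : (drsubmx M')^T = drsubmx M'.
  by rewrite -[in RHS]M'T trmx_drsub.
have [ O2 [d [OO2 dE]]] := IH _ drT.
pose Q : 'M[R]_(1 + n) := block_mx 1%:M 0 0 O2.
have QQ : Q *m Q^T = 1%:M.
  rewrite /Q tr_block_mx !trmx0 trmx1 mulmx_block !mulmx0 !mul0mx !addr0 !add0r.
  by rewrite mulmx1 OO2 -scalar_mx_block.
exists (Q *m O1), (row_mx (a%:M) d); split; first exact: orthogonal_mul.
have M'E : M' = Q^T *m diag_mx (row_mx a%:M d) *m Q.
  rewrite -[LHS]submxK ulE urE dlE dE /Q tr_block_mx !trmx0 trmx1 diag_mx_row.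
  rewrite !mulmx_block !(mulmx0, mul0mx, addr0, add0r, mul1mx, mulmx1).
  by congr (block_mx _ _ _ _); apply/matrixP => i j; rewrite !mxE !ord1 !eqxx !mulr1n mulr1.
have -> : M = O1^T *m M' *m O1.
  rewrite /M' !mulmxA (orthogonal_tr OO1) mul1mx -mulmxA (orthogonal_tr OO1).
  by rewrite mulmx1.
by rewrite M'E trmx_mul !mulmxA.
Qed.

(** * The standard Gaussian law on column vectors *)

Lemma measurable_entry (R : realType) p q (i : 'I_p) (j : 'I_q) :
  measurable_fun [set: 'M[R]_(p, q)] (fun M => M i j).
Proof.
move=> _ Y mY; rewrite setTI; apply: sub_sigma_algebra => /=.
rewrite -bigcup_seq/=; exists (mxvec_index i j) => /=.
  by rewrite mem_index_enum.
by exists Y => //; rewrite setTI; apply/seteqP; split=> M /=; rewrite mxvecE.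
Qed.

Lemma measurable_mxP (R : realType) d (T : measurableType d) p q
    (f : T -> 'M[R]_(p, q)) :
  measurable_fun setT f <-> forall i j, measurable_fun setT (fun t => f t i j).
Proof.
split=> [mf i j|mf].
  by apply: (measurableT_comp (f := fun M : 'M[R]_(p, q) => M i j)) => //; exact: measurable_entry.
apply: (measurability (\big[setU/set0]_(k < p * q)
  preimage_set_system setT (fun M : 'M[R]_(p, q) => mxvec M 0 k) measurable)) => //.
move=> _ [B + <-]; rewrite -bigcup_seq => -[k _ [C mC <-]].
case/mxvec_indexP: k => i j; rewrite setTI.
have := mf i j measurableT _ mC; rewrite !setTI.
by rewrite (_ : f @^-1` _ = (fun t => f t i j) @^-1` C)//; apply/seteqP; split=> t /=; rewrite mxvecE.
Qed.

Definition box (R : realType) p q (S : 'I_p -> 'I_q -> set R) : set 'M[R]_(p, q) :=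
  [set M | forall i j, S i j (M i j)].

Lemma measurable_box (R : realType) p q (S : 'I_p -> 'I_q -> set R) :
  (forall i j, measurable (S i j)) -> measurable (box S).
Proof.
move=> mS; rewrite (_ : box S = \bigcap_(i in [set: 'I_p]) \bigcap_(j in [set: 'I_q])
   ((fun M : 'M[R]_(p, q) => M i j) @^-1` S i j)); last first.
  by apply/seteqP; split=> M /= h => [i _ j _|i j]; exact: h.
apply: fin_bigcap_measurable => // i _; apply: fin_bigcap_measurable => // j _.
by rewrite -[X in measurable X]setTI; apply: measurable_entry.
Qed.

(** Boxes form a pi-system that generates the sigma-algebra of matrices. *)
Lemma mx_measure_unique (R : realType) p q
    (mu nu : {measure set 'M[R]_(p, q) -> \bar R}) :
  (mu setT < +oo)%E ->
  (forall S, (forall i j, measurable (S i j)) -> mu (box S) = nu (box S)) ->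
  forall B, measurable B -> mu B = nu B.
Proof.
move=> fmu munu B mB.
pose G := [set box S | S in [set S : 'I_p -> 'I_q -> set R |
                              forall i j, measurable (S i j)]].
have GT : G setT.
  by exists (fun _ _ => setT) => //; apply/seteqP; split.
apply: (measure_unique G (fun=> setT)) => //.
- apply/seteqP; split; last first.
    apply: smallest_sub; first exact: sigma_algebra_measurable.
    by move=> _ [S mS <-]; exact: measurable_box.
  apply: smallest_sub; first exact: smallest_sigma_algebra.
  move=> C; rewrite -bigcup_seq => -[k _ [D mD <-]].
  case/mxvec_indexP: k => i j; apply: sub_sigma_algebra.
  exists (fun i' j' => if (i', j') == (i, j) then D else setT).
    by move=> i' j'; case: ifP.
  apply/seteqP; split=> M /=.
    by move=> /(_ i j); rewrite eqxx => DM; split => //=; rewrite mxvecE.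
  by move=> [_]; rewrite mxvecE => DM i' j'; case: eqP => // -[-> ->].
- move=> _ _ [S mS <-] [S' mS' <-]; exists (fun i j => S i j `&` S' i j).
    by move=> i j; exact: measurableI.
  apply/seteqP; split=> M /= h; first by split=> i j; case: (h i j).
  by move=> i j; split; [exact: h.1|exact: h.2].
- by rewrite bigcup_const.
- by move=> _ [S mS <-]; exact: munu.
Qed.

Lemma mx_law_unique (R : realType) p q (mu nu : probability 'M[R]_(p, q) R) :
  (forall S, (forall i j, measurable (S i j)) -> mu (box S) = nu (box S)) ->
  forall B, measurable B -> mu B = nu B.
Proof.
have fmu : (mu setT < +oo)%E by rewrite probability_setT ltry.
exact: mx_measure_unique fmu.
Qed.

Definition mx_cons (R : realType) N (xv : (R * 'cV[R]_N)%type) : 'cV[R]_N.+1 :=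
  col_mx (scalar_mx (xv.1)) (xv.2).

Lemma mx_cons0 (R : realType) N (xv : (R * 'cV[R]_N)%type) : mx_cons xv ord0 0 = xv.1.
Proof.
transitivity (mx_cons xv (lshift N (0 : 'I_1)) 0).
  by congr (mx_cons _ _ _); exact: val_inj.
by apply: etrans (col_mxEu _ _ _ _) _; rewrite mxE.
Qed.

Lemma mx_consS (R : realType) N (xv : (R * 'cV[R]_N)%type) i :
  mx_cons xv (lift ord0 i) 0 = xv.2 i 0.
Proof.
transitivity (mx_cons xv (rshift 1 i) 0).
  by congr (mx_cons _ _ _); exact: val_inj.
exact: col_mxEd.
Qed.

Lemma measurable_mx_cons (R : realType) N :
  measurable_fun setT (@mx_cons R N).
Proof.
apply/measurable_mxP => i j; rewrite !ord1; case: (unliftP ord0 i) => [k|] ->.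
  under eq_fun do rewrite mx_consS.
  apply: (measurableT_comp (f := fun M : 'cV[R]_N => M k 0)) => //.
  exact: measurable_entry.
by rewrite (_ : (fun t => _) = fst)//; apply/funext => t; rewrite mx_cons0.
Qed.

HB.instance Definition _ (R : realType) N :=
  isMeasurableFun.Build _ _ _ _ (@mx_cons R N) (@measurable_mx_cons R N).

Lemma measurable_to_Real (R : realType) :
  measurable_fun [set: measurableTypeR R] (idfun : measurableTypeR R -> R).
Proof. by move=> _ B mB; rewrite setTI. Qed.

HB.instance Definition _ (R : realType) :=
  isMeasurableFun.Build _ _ (measurableTypeR R) R
    (idfun : measurableTypeR R -> R) (@measurable_to_Real R).

(** The law N(0, 1) on the sigma-algebra that is used for the entries of matrices,
    described by its values and its integrals. *)
Lemma gauss1_sig (R : realType) :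
  {mu : probability R R | forall A, mu A = normal_prob (0 : R) 1 A &
    forall f : R -> \bar R, measurable_fun [set: R] f ->
      (forall x, (0 <= f x)%E) ->
      (\int[mu]_x f x = \int[normal_prob (0 : R) 1]_x f x)%E}.
Proof.
exists (distribution (normal_prob (0 : R) 1) (idfun : {mfun measurableTypeR R >-> R})) => //.
by move=> f mf f0; rewrite ge0_integral_distribution.
Qed.

Definition gauss1 (R : realType) : probability R R := s2val (gauss1_sig R).

Lemma gauss1E (R : realType) (A : set R) : gauss1 R A = normal_prob 0 1 A.
Proof. exact: (s2valP (gauss1_sig R)). Qed.

(** The law N(0, I) on column vectors. *)
Fixpoint gauss (R : realType) N : probability 'cV[R]_N R :=
  if N is N'.+1
  then distribution (gauss1 R \x gauss R N')%E (@mx_cons R N' : {mfun _ >-> _})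
  else \d_(0 : 'cV[R]_0).

Lemma gauss_integralS (R : realType) N (f : 'cV[R]_N.+1 -> \bar R) :
  measurable_fun [set: 'cV[R]_N.+1] f -> (forall v, (0 <= f v)%E) ->
  (\int[gauss R N.+1]_v f v =
   \int[gauss1 R]_x \int[gauss R N]_v f (mx_cons (x, v)))%E.
Proof.
move=> mf f0; rewrite [LHS]/= ge0_integral_distribution//= fubini_tonelli1//.
by apply: measurableT_comp => //; exact: measurable_mx_cons.
Qed.

Lemma gaussS (R : realType) N (B : set 'cV[R]_N.+1) :
  gauss R N.+1 B = (gauss1 R \x gauss R N)%E (@mx_cons R N @^-1` B).
Proof. by []. Qed.

Lemma gauss0 (R : realType) (B : set 'cV[R]_0) : gauss R 0 B = \d_(0 : 'cV[R]_0) B.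
Proof. by []. Qed.

Lemma mx_cons_box (R : realType) N (S : 'I_N.+1 -> set R) :
  @mx_cons R N @^-1` box (fun i _ => S i) =
  S ord0 `*` box (fun i _ => S (lift ord0 i)).
Proof.
apply/seteqP; split=> [[x v] /= h|[x v] /= [h0 h] i j]; rewrite ?ord1.
  split; first by have := h ord0 0; rewrite mx_cons0.
  by move=> i j; have := h (lift ord0 i) 0; rewrite mx_consS/= ord1.
by case: (unliftP ord0 i) => [k|] ->; rewrite ?mx_consS ?mx_cons0//; exact: h.
Qed.

Lemma gauss_box (R : realType) N (S : 'I_N -> set R) :
  (forall i, measurable (S i)) ->
  (gauss R N (box (fun i _ => S i)) = \prod_i gauss1 R (S i))%E.
Proof.
elim: N => [|N IH] in S *.
  by move=> mS; rewrite big_ord0 gauss0 diracE mem_set// => -[].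
move=> mS; rewrite gaussS mx_cons_box.
have mB : measurable (box (fun i (_ : 'I_1) => S (lift ord0 i))).
  by apply: measurable_box.
rewrite (product_measure1E (gauss1 R) (gauss R N) (mS ord0) mB).
by rewrite big_ord_recl; congr (_ * _)%E; exact: (IH (fun i => S (lift ord0 i))) (fun i => mS _).
Qed.

(** * Densities and the one-dimensional likelihood ratio *)

Lemma ge0_integral_normal_prob (R : realType) (m s : R) (f : R -> \bar R) :
  measurable_fun setT f -> (forall x, (0 <= f x)%E) ->
  (\int[normal_prob m s]_x f x =
   \int[lebesgue_measure]_x (f x * (normal_pdf m s x)%:E))%E.
Proof.
move=> mf f0.
have dom := normal_prob_dominates m s.
have mpdf : measurable_fun setT (fun x => (normal_pdf m s x)%:E).
  by apply/measurable_EFinP; exact: measurable_normal_pdf.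
rewrite -(Radon_Nikodym_SigmaFinite.change_of_variables dom)//.
have mRN : measurable_fun setT
    (Radon_Nikodym_SigmaFinite.f (normal_prob m s) lebesgue_measure).
  exact: measurable_int (Radon_Nikodym_SigmaFinite.f_integrable dom).
apply: ae_eq_integral => //.
- exact: emeasurable_funM.
- exact: emeasurable_funM.
apply: ae_eqe_mul2l; apply: integral_ae_eq => //.
  exact: Radon_Nikodym_SigmaFinite.f_integrable.
by move=> E _ mE; rewrite -Radon_Nikodym_SigmaFinite.f_integral.
Qed.

(** Lebesgue measure, carried over to the same sigma-algebra as [gauss1]. *)
Lemma leb_sig (R : realType) :
  {mu : {sigma_finite_measure set R -> \bar R} |
    forall f : R -> \bar R, measurable_fun [set: R] f ->
      (forall x, (0 <= f x)%E) ->
      (\int[mu]_x f x = \int[lebesgue_measure]_x f x)%E}.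
Proof.
pose mu : {measure set R -> \bar R} :=
  (pushforward (@lebesgue_measure R) (idfun : {mfun measurableTypeR R >-> R})).
pose mu' := pushforward (@lebesgue_measure R) (idfun : {mfun measurableTypeR R >-> R}).
pose isM := isMeasure.Build _ _ _ mu' (measure0 (mu (@measurable_to_Real R)))
   (fun A => measure_ge0 (mu (@measurable_to_Real R)) A) (@measure_semi_sigma_additive _ _ _ (mu (@measurable_to_Real R))).
have sf : sigma_finite setT mu'.
  have /sigma_finiteP[F [FT ndF Foo]] := sigma_finiteT (@lebesgue_measure R).
  by exists F => // i; have [] := Foo i.
have @M : {sigma_finite_measure set R -> \bar R}.
  exact: (HB.pack mu' isM (@Measure_isSigmaFinite.Build _ _ _ _ sf)).
exists M.
move=> f mf f0.
exact: (@ge0_integral_pushforward _ _ _ _ _ _ (@measurable_to_Real R) lebesgue_measure setT f).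
Qed.

Definition leb (R : realType) : {sigma_finite_measure set R -> \bar R} :=
  sval (leb_sig R).

Lemma lebE (R : realType) (f : R -> \bar R) : measurable_fun [set: R] f ->
  (forall x, (0 <= f x)%E) ->
  (\int[leb R]_x f x = \int[lebesgue_measure]_x f x)%E.
Proof. exact: svalP (leb_sig R) f. Qed.

Lemma ge0_integral_gauss1 (R : realType) (f : R -> \bar R) :
  measurable_fun setT f -> (forall x, (0 <= f x)%E) ->
  (\int[gauss1 R]_x f x = \int[leb R]_x (f x * (normal_pdf 0 1 x)%:E))%E.
Proof.
move=> mf f0; rewrite lebE; last 2 first.
- by apply: emeasurable_funM => //; apply/measurable_EFinP; exact: measurable_normal_pdf.
- by move=> x; rewrite mule_ge0// lee_fin normal_pdf_ge0.
rewrite -ge0_integral_normal_prob//; exact: (s2valP' (gauss1_sig R)).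
Qed.

Lemma measurable_affine (R : realType) (c b : R) :
  measurable_fun [set: R] (fun x => c * x + b).
Proof. by apply: measurable_funD => //; exact: measurable_funM. Qed.

Lemma lebesgue_affine (R : realType) (c b : R) (A : set R) : c != 0 ->
  measurable A ->
  (lebesgue_measure A =
   (`|c|)%:E * lebesgue_measure ((fun x : R => (c * x + b : R))%R @^-1` A))%E.
Proof.
move=> c0 mA.
have mphi : measurable_fun [set: measurableTypeR R] (fun x : measurableTypeR R => (c * x + b : measurableTypeR R)).
  exact: measurable_affine.
pose phi : {mfun measurableTypeR R >-> measurableTypeR R} :=
  HB.pack (fun x : measurableTypeR R => (c * x + b : measurableTypeR R))
    (isMeasurableFun.Build _ _ _ _ _ mphi).
have c0' : 0 <= `|c| by [].
pose nu : {measure set (measurableTypeR R) -> \bar R} :=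
  mscale (NngNum c0') (pushforward lebesgue_measure phi).
transitivity (nu mphi A); last by [].
apply: lebesgue_measure_unique => // _ [[u v]] _ <-.
rewrite /nu /= /mscale/= /pushforward.
have [uv|vu] := ltP u v; last first.
  by rewrite set_itv_ge ?bnd_simp -?leNgt// preimage_set0 !measure0 mule0.
rewrite lebesgue_measure_itv/= lte_fin uv.
have [cp|cn|/eqP] := ltgtP 0 c; last by rewrite eq_sym (negbTE c0).
- rewrite (_ : _ @^-1` _ = `](u - b) / c, (v - b) / c]%classic); last first.
    apply/seteqP; split=> x /=; rewrite !in_itv/= ltr_pdivrMr// ler_pdivlMr//;
      by rewrite ltrBlDr lerBrDr [x * c]mulrC.
  rewrite lebesgue_measure_itv/= lte_fin ltr_pM2r ?invr_gt0// ltrD2r uv.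
  rewrite -EFinB -EFinM -mulrBl gtr0_norm//; congr _%:E.
  by field.
- rewrite (_ : _ @^-1` _ = `[(v - b) / c, (u - b) / c[%classic); last first.
    apply/seteqP; split=> x /=; rewrite !in_itv/= ltr_ndivlMr// ler_ndivrMr//;
      by rewrite ltrBlDr lerBrDr [x * c]mulrC andbC.
  rewrite lebesgue_measure_itv/= lte_fin ltr_nM2r ?invr_lt0// ltrD2r uv.
  rewrite -EFinB -EFinM -mulrBl ltr0_norm//; congr _%:E.
  by field.
Qed.

Lemma ge0_integral_affine (R : realType) (c b : R) (f : R -> \bar R) : c != 0 ->
  measurable_fun setT f -> (forall x, (0 <= f x)%E) ->
  (\int[leb R]_x f x = (`|c|)%:E * \int[leb R]_x f (c * x + b)%R)%E.
Proof.
move=> c0 mf f0; rewrite (lebE mf f0) lebE//; last first.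
  by apply: (measurableT_comp mf); exact: measurable_affine.
have mphi : measurable_fun [set: measurableTypeR R] (fun x : measurableTypeR R => (c * x + b : measurableTypeR R)).
  exact: measurable_affine.
pose phi : {mfun measurableTypeR R >-> measurableTypeR R} :=
  HB.pack (fun x : measurableTypeR R => (c * x + b : measurableTypeR R))
    (isMeasurableFun.Build _ _ _ _ _ mphi).
have c0' : 0 <= `|c| by [].
pose nu : {measure set (measurableTypeR R) -> \bar R} :=
  mscale (NngNum c0') (pushforward lebesgue_measure phi).
transitivity (\int[nu mphi]_x f x)%E.
  by apply: eq_measure_integral => A mA _; exact: lebesgue_affine.
by rewrite ge0_integral_mscale//= ge0_integral_pushforward.
Qed.

Lemma ge0_integral_scaled_gauss1 (R : realType) (r : R) (f : R -> \bar R) :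
  r != 0 -> measurable_fun setT f -> (forall x, (0 <= f x)%E) ->
  (\int[gauss1 R]_x f (r * x)%R =
   \int[leb R]_x (f x * (normal_pdf 0 r x)%:E))%E.
Proof.
move=> r0 mf f0.
have mrf : measurable_fun setT (fun x => f (r * x)).
  by apply: measurableT_comp => //; exact: measurable_funM.
have mg : measurable_fun setT (fun x => f x * (normal_pdf 0 r x)%:E)%E.
  by apply: emeasurable_funM => //; apply/measurable_EFinP; exact: measurable_normal_pdf.
have g0 x : (0 <= f x * (normal_pdf 0 r x)%:E)%E.
  by rewrite mule_ge0// lee_fin normal_pdf_ge0.
rewrite (ge0_integral_gauss1 mrf (fun x => f0 _)).
rewrite (ge0_integral_affine 0 r0 mg g0).
rewrite -ge0_integralZl//; last first.
  exact: (measurableT_comp mg (measurable_affine r 0)).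
apply: eq_integral => x _; rewrite addr0 muleCA; congr (_ * _)%E.
rewrite -EFinM; congr _%:E.
rewrite !normal_pdfE ?oner_neq0// /normal_peak /normal_fun !subr0.
have -> : r ^+ 2 * pi *+ 2 = r ^+ 2 * (1 ^+ 2 * pi *+ 2) :> R.
  by rewrite expr1n mul1r mulrnAr.
rewrite sqrtrM ?sqr_ge0// sqrtr_sqr invfM !mulrA mulfV ?normr_eq0// mul1r.
congr (_ * expR _); rewrite exprMn expr1n; field.
by [].
Qed.

Definition likelihood (R : realType) (f x : R) : R :=
  (Num.sqrt (1 + f))^-1 * expR (x ^+ 2 / 2 * (1 - (1 + f)^-1)).

Lemma measurable_likelihood (R : realType) (f : R) :
  measurable_fun setT (likelihood f).
Proof.
apply: measurable_funM => //; apply: measurableT_comp => //.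
by apply: measurable_funM => //; apply: measurable_funM.
Qed.

Lemma likelihood_ge0 (R : realType) (f x : R) : 0 <= likelihood f x.
Proof. by rewrite mulr_ge0// ?invr_ge0// expR_ge0. Qed.

Lemma ge0_integral_likelihood (R : realType) (f : R) (h : R -> \bar R) :
  -1 < f -> measurable_fun setT h -> (forall x, (0 <= h x)%E) ->
  (\int[gauss1 R]_x h (Num.sqrt (1 + f) * x)%R =
   \int[gauss1 R]_x (h x * (likelihood f x)%:E))%E.
Proof.
move=> f1 mh h0; have f1' : 0 < 1 + f by lra.
have r0 : Num.sqrt (1 + f) != 0 by rewrite gt_eqF// sqrtr_gt0.
have ml : measurable_fun setT (fun x => h x * (likelihood f x)%:E)%E.
  apply: emeasurable_funM => //; apply/measurable_EFinP.
  exact: measurable_likelihood.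
have l0 x : (0 <= h x * (likelihood f x)%:E)%E.
  by rewrite mule_ge0// lee_fin likelihood_ge0.
rewrite (ge0_integral_scaled_gauss1 r0 mh h0) (ge0_integral_gauss1 ml l0).
apply: eq_integral => x _; rewrite -muleA; congr (_ * _)%E; rewrite -EFinM; congr _%:E.
rewrite !normal_pdfE ?oner_neq0// /normal_peak /normal_fun !subr0 /likelihood.
rewrite sqr_sqrtr ?ltW//.
have -> : (1 + f) * pi *+ 2 = (1 + f) * (1 ^+ 2 * pi *+ 2) :> R.
  by rewrite expr1n mul1r mulrnAr.
rewrite sqrtrM ?ltW// invfM [RHS]mulrACA -expRD; congr (_ * expR _).
by rewrite expr1n; field; rewrite gt_eqF.
Qed.

(** The second moment of the likelihood ratio of N(0, 1 + f) to N(0, 1) is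
    (1 - f^2)^(-1/2). *)
Lemma likelihood_sq_le (R : realType) (f : R) : `|f| <= 2^-1 ->
  (\int[gauss1 R]_x ((likelihood f x) ^+ 2)%:E <= (expR (f ^+ 2))%:E)%E.
Proof.
move=> f12; have [fl fr] : -2^-1 <= f /\ f <= 2^-1 by apply/andP; rewrite -ler_norml.
have f1 : 0 < 1 + f by lra.
have f2 : 0 < 1 - f by lra.
pose v := (1 + f) / (1 - f); have v0 : 0 < v by rewrite divr_gt0.
pose K := (Num.sqrt (1 - f ^+ 2))^-1.
have f3 : 0 < 1 - f ^+ 2 by rewrite (_ : 1 - f ^+ 2 = (1 - f) * (1 + f)) ?mulr_gt0//; ring.
have ml : measurable_fun setT (fun x => (likelihood f x ^+ 2)%:E).
  by apply/measurable_EFinP; apply: measurable_funX; exact: measurable_likelihood.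
rewrite (ge0_integral_gauss1 ml); last by move=> x; rewrite lee_fin sqr_ge0.
have -> : (\int[leb R]_x
    ((likelihood f x ^+ 2)%:E * (normal_pdf 0 1 x)%:E) =
  \int[leb R]_x (K%:E * (normal_pdf 0 (Num.sqrt v) x)%:E))%E.
  apply: eq_integral => x _; rewrite -!EFinM; congr _%:E.
  rewrite !normal_pdfE ?oner_neq0//; last by rewrite gt_eqF// sqrtr_gt0.
  rewrite /normal_peak /normal_fun !subr0 /likelihood exprMn sqr_sqrtr ?ltW//.
  rewrite exprVn sqr_sqrtr ?ltW//.
  have -> : v * pi *+ 2 = v * (1 ^+ 2 * pi *+ 2) :> R.
    by rewrite expr1n mul1r mulrnAr.
  rewrite sqrtrM ?ltW// invfM.
  have eK : K * (Num.sqrt v)^-1 = (1 + f)^-1.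
    rewrite /K -invfM -sqrtrM ?ltW//; congr _^-1.
    have -> : (1 - f ^+ 2) * v = (1 + f) ^+ 2 by rewrite /v; field; rewrite gt_eqF.
    by rewrite sqrtr_sqr gtr0_norm.
  set P := (Num.sqrt (1 ^+ 2 * pi *+ 2))^-1.
  rewrite -expRM_natl.
  transitivity ((1 + f)^-1 * P * expR (- x ^+ 2 / (v *+ 2))); last by rewrite -eK; ring.
  rewrite mulrACA -expRD; congr (_ * _ * expR _).
  by rewrite expr1n /v; field; rewrite !gt_eqF.
rewrite ge0_integralZl//; last 3 first.
- by apply/measurable_EFinP; exact: measurable_normal_pdf.
- by move=> x _; rewrite lee_fin normal_pdf_ge0.
- by rewrite lee_fin invr_ge0.
rewrite lebE; last 2 first.
- by apply/measurable_EFinP; exact: measurable_normal_pdf.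
- by move=> x; rewrite lee_fin normal_pdf_ge0.
rewrite integral_normal_pdf mule1 lee_fin.
have u4 : f ^+ 2 <= 4^-1.
  have -> : 4^-1 = 2^-1 ^+ 2 :> R by field.
  by rewrite -(real_normK (num_real f)) lerXn2r ?nnegrE.
set u := f ^+ 2 in f3 u4 *; have u0 : 0 <= u by rewrite sqr_ge0.
rewrite /K -(ler_pXn2r (n := 2)) ?nnegrE ?invr_ge0 ?expR_ge0//.
rewrite exprVn -/u sqr_sqrtr ?(ltW f3)// -expRM_natl.
apply: (le_trans _ (expR_ge1Dx _)).
rewrite -(ler_pM2l f3) mulfV ?gt_eqF//; nra.
Qed.

Lemma gauss1_moment4 (R : realType) : (\int[gauss1 R]_x (x ^+ 4)%:E <= 200%:E)%E.
Proof.
(* x^4 is dominated by the square of a likelihood ratio *)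
have f3 : `|3^-1 : R| <= 2^-1 by rewrite ger0_norm//; lra.
have ml : measurable_fun setT (fun x : R => (likelihood 3^-1 x ^+ 2)%:E).
  by apply/measurable_EFinP; apply: measurable_funX; exact: measurable_likelihood.
apply: (@le_trans _ _ (\int[gauss1 R]_x (96%:E * (likelihood 3^-1 x ^+ 2)%:E))%E).
  apply: ge0_le_integral => //.
  - by move=> x _; rewrite lee_fin exprn_even_ge0.
  - by apply/measurable_EFinP; exact: measurable_funX.
  - by apply: measurable_funeM.
  move=> x _; rewrite -EFinM lee_fin /likelihood exprMn exprVn sqr_sqrtr; last by lra.
  rewrite -expRM_natl.
  have -> : 2 * (x ^+ 2 / 2 * (1 - (1 + 3^-1)^-1)) = x ^+ 2 / 4 by field.
  set u := x ^+ 2 / 4.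
  have u0 : 0 <= u by rewrite divr_ge0// sqr_ge0.
  have -> : x ^+ 4 = 16 * u ^+ 2 by rewrite /u; field.
  set w := u / 2; have w0 : 0 <= w by rewrite divr_ge0.
  have -> : u = 2 * w by rewrite /w; field.
  have e1 := expR_ge1Dx w.
  rewrite expRM_natl (_ : (1 + 3^-1)^-1 = 3 / 4); last by field.
  have : (1 + w) ^+ 2 <= expR w ^+ 2 by rewrite lerXn2r ?nnegrE ?expR_ge0// addr_ge0.
  set e := expR w ^+ 2; nra.
rewrite ge0_integralZl//; last by move=> x _; rewrite lee_fin sqr_ge0.
apply: (@le_trans _ _ (96%:E * (expR (3^-1 ^+ 2))%:E)%E).
  by rewrite lee_pmul2l//; exact: likelihood_sq_le.
rewrite -EFinM lee_fin.
have := expR_ge1Dx (- (3^-1 ^+ 2) : R); rewrite expRN => e1.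
have : 0 < expR (3^-1 ^+ 2 : R) by exact: expR_gt0.
set e := expR _ in e1 *; move=> e0.
have : e * (1 + - 3^-1 ^+ 2) <= 1 by rewrite -ler_pdivlMl// mulr1.
lra.
Qed.

(** * Rotation invariance *)

Lemma integral_gauss1_gauss1 (R : realType) (f : (R * R)%type -> \bar R) :
  measurable_fun setT f -> (forall x, (0 <= f x)%E) ->
  (\int[gauss1 R]_x \int[gauss1 R]_y f (x, y) =
   \int[leb R]_x \int[leb R]_y
     (f (x, y) * (normal_pdf 0 1 x * normal_pdf 0 1 y)%:E))%E.
Proof.
move=> mf f0.
have mF := measurable_fun_fubini_tonelli_F (m2 := gauss1 R) f mf f0.
rewrite (ge0_integral_gauss1 mF); last first.
  by move=> x; apply: integral_ge0.
apply: eq_integral => x _; rewrite /fubini_F.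
have mfx : measurable_fun [set: R] (fun y => f (x, y)).
  by apply: measurableT_comp => //; exact: measurable_pair1.
rewrite (ge0_integral_gauss1 mfx (fun y => f0 _)) muleC.
have mp : measurable_fun [set: R] (fun y => (f (x, y) * (normal_pdf 0 1 y)%:E)%E).
  by apply: emeasurable_funM => //; apply/measurable_EFinP; exact: measurable_normal_pdf.
rewrite -ge0_integralZl//; last 2 first.
- by move=> y _; rewrite mule_ge0// lee_fin normal_pdf_ge0.
- by rewrite lee_fin normal_pdf_ge0.
by apply: eq_integral => y _; rewrite EFinM muleCA.
Qed.

Lemma measurable_rotation (R : realType) (a b a' b' : R) :
  measurable_fun [set: (R * R)%type]
    (fun z : (R * R)%type => (a * z.1 + b * z.2, a' * z.1 + b' * z.2)).
Proof.
by apply: measurable_fun_pair; apply: measurable_funD; apply: measurable_funM.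
Qed.

(** The rotation is performed by two successive affine substitutions, one in each
    variable; the two Jacobians cancel. *)
Lemma leb_rotation (R : realType) (c s : R) (h : (R * R)%type -> \bar R) :
  c != 0 -> c ^+ 2 + s ^+ 2 = 1 ->
  measurable_fun setT h -> (forall z, (0 <= h z)%E) ->
  (\int[leb R]_x \int[leb R]_y h (c * x + s * y, - s * x + c * y)%R =
   \int[leb R]_x \int[leb R]_y h (x, y))%E.
Proof.
move=> c0 cs mh h0.
have mg : measurable_fun setT
    (fun z : (R * R)%type => h (z.1, c^-1 * z.2 + (- s / c) * z.1)).
  apply: (measurableT_comp mh); apply: measurable_fun_pair => //.
  by apply: measurable_funD; apply: measurable_funM.
have mh' := measurableT_comp mh (measurable_rotation c s (- s) c).
rewrite (fubini_tonelli (m1 := leb R) (m2 := leb R) _ mh' (fun z => h0 _)).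
(* x is replaced by (x - s y) / c *)
have step1 y : (\int[leb R]_x h (c * x + s * y, - s * x + c * y)%R =
    (`|c|^-1)%:E * \int[leb R]_x h (x, c^-1 * y + (- s / c) * x)%R)%E.
  have mgy : measurable_fun setT (fun x => h (x, c^-1 * y + (- s / c) * x)).
    apply: (measurableT_comp mh); apply: measurable_fun_pair => //.
    by apply: measurable_funD => //; exact: measurable_funM.
  rewrite [in RHS](ge0_integral_affine (s * y) c0 mgy (fun x => h0 _)).
  rewrite muleA -EFinM mulVf ?normr_eq0// mul1e.
  apply: eq_integral => x _; congr (h (_, _)).
  transitivity (c^-1 * ((c ^+ 2 + s ^+ 2) * y) - s * x - c^-1 * s ^+ 2 * y); first by field.
  by rewrite cs mul1r; field.
transitivity (\int[leb R]_y ((`|c|^-1)%:E *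
    \int[leb R]_x h (x, c^-1 * y + (- s / c) * x)%R))%E.
  by apply: eq_integral => y _; exact: step1.
have mG := measurable_fun_fubini_tonelli_G (m1 := leb R) _ mg (fun z => h0 _).
have mF := measurable_fun_fubini_tonelli_F (m2 := leb R) _ mg (fun z => h0 _).
have c0' : 0 <= `|c|^-1 by rewrite invr_ge0.
rewrite (ge0_integralZl _ _ mG); last 3 first.
- by [].
- by move=> y _; apply: integral_ge0.
- by [].
rewrite -(fubini_tonelli (m1 := leb R) (m2 := leb R) _ mg (fun z => h0 _)).
rewrite -(ge0_integralZl _ _ mF); last 3 first.
- by [].
- by move=> y _; apply: integral_ge0.
- by [].
apply: eq_integral => x _; rewrite /fubini_F /=.
have mhx : measurable_fun [set: R] (fun y => h (x, y)).
  by apply: (measurableT_comp mh); exact: measurable_pair1.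
have ci0 : c^-1 != 0 by rewrite invr_eq0.
by rewrite (ge0_integral_affine ((- s / c) * x) ci0 mhx (fun y => h0 _)) normfV.
Qed.

Lemma gauss1_rotation_neq0 (R : realType) (c s : R) (f : (R * R)%type -> \bar R) :
  c != 0 -> c ^+ 2 + s ^+ 2 = 1 ->
  measurable_fun setT f -> (forall x, (0 <= f x)%E) ->
  (\int[gauss1 R]_x \int[gauss1 R]_y f (c * x + s * y, - s * x + c * y)%R =
   \int[gauss1 R]_x \int[gauss1 R]_y f (x, y))%E.
Proof.
move=> c0 cs mf f0.
have p_rot x y : normal_pdf (0 : R) 1 (c * x + s * y) * normal_pdf 0 1 (- s * x + c * y)
    = normal_pdf 0 1 x * normal_pdf 0 1 y.
  rewrite !normal_pdfE ?oner_neq0// /normal_fun !subr0.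
  rewrite mulrACA [RHS]mulrACA -!expRD; congr (_ * expR _).
  rewrite expr1n -!mulrDl -!opprD; congr (- _ / _).
  transitivity ((c ^+ 2 + s ^+ 2) * (x ^+ 2 + y ^+ 2)); first by ring.
  by rewrite cs mul1r.
rewrite (integral_gauss1_gauss1 mf f0).
rewrite (integral_gauss1_gauss1 (measurableT_comp mf (measurable_rotation c s (- s) c)) (fun z => f0 _)).
have mh : measurable_fun setT (fun xy : (R * R)%type =>
    f xy * (normal_pdf 0 1 xy.1 * normal_pdf 0 1 xy.2)%:E)%E.
  apply: emeasurable_funM => //; apply/measurable_EFinP.
  by apply: measurable_funM; apply: measurableT_comp => //; exact: measurable_normal_pdf.
have h0 (xy : (R * R)%type) : (0 <= f xy * (normal_pdf 0 1 xy.1 * normal_pdf 0 1 xy.2)%:E)%E.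
  by rewrite mule_ge0// lee_fin mulr_ge0// normal_pdf_ge0.
rewrite -(leb_rotation c0 cs mh h0).
apply: eq_integral => x _; apply: eq_integral => y _.
by rewrite [in RHS]/fst [in RHS]/snd p_rot.
Qed.

Lemma gauss1_rotation (R : realType) (c s : R) (f : (R * R)%type -> \bar R) :
  c ^+ 2 + s ^+ 2 = 1 ->
  measurable_fun setT f -> (forall x, (0 <= f x)%E) ->
  (\int[gauss1 R]_x \int[gauss1 R]_y f (c * x + s * y, - s * x + c * y)%R =
   \int[gauss1 R]_x \int[gauss1 R]_y f (x, y))%E.
Proof.
move=> cs mf f0; have [c0|c0] := eqVneq c 0; last exact: gauss1_rotation_neq0.
(* a quarter turn is the square of an eighth of a turn *)
pose a : R := (Num.sqrt 2)^-1.
have a0 : a != 0 by rewrite invr_eq0 gt_eqF// sqrtr_gt0.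
have aa : a ^+ 2 = 2^-1 by rewrite exprVn sqr_sqrtr.
have s1 : s ^+ 2 = 1 by rewrite -cs c0; ring.
have as1 : a ^+ 2 + (a * s) ^+ 2 = 1 by rewrite exprMn s1 aa; field.
pose g z := f (a * z.1 + (a * s) * z.2, - (a * s) * z.1 + a * z.2).
have mg : measurable_fun setT g.
  apply: (measurableT_comp mf); apply: measurable_fun_pair;
  by apply: measurable_funD; apply: measurable_funM.
rewrite -(gauss1_rotation_neq0 a0 as1 mf f0).
rewrite -[RHS](gauss1_rotation_neq0 a0 as1 mg (fun z => f0 _)).
apply: eq_integral => x _; apply: eq_integral => y _; rewrite /g/= c0.
congr (f (_, _)).
- transitivity (a ^+ 2 * ((1 - s ^+ 2) * x + 2 * s * y)); last by ring.
  by rewrite aa s1; field.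
- transitivity (a ^+ 2 * ((1 - s ^+ 2) * y - 2 * s * x)); last by ring.
  by rewrite aa s1; field.
Qed.

Lemma gauss1_opp (R : realType) (f : R -> \bar R) :
  measurable_fun setT f -> (forall x, (0 <= f x)%E) ->
  (\int[gauss1 R]_x f (- x)%R = \int[gauss1 R]_x f x)%E.
Proof.
move=> mf f0; rewrite (ge0_integral_gauss1 mf f0).
have r0 : -1 != 0 :> R by rewrite oppr_eq0 oner_eq0.
transitivity (\int[gauss1 R]_x f (-1 * x)%R)%E.
  by apply: eq_integral => x _; rewrite mulN1r.
rewrite (ge0_integral_scaled_gauss1 r0 mf f0).
apply: eq_integral => x _; congr (_ * _%:E)%E.
by rewrite !normal_pdfE ?oner_neq0// /normal_peak /normal_fun sqrrN.
Qed.

Lemma measurable_mulmx (R : realType) d (T : measurableType d) p q r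
    (A : T -> 'M[R]_(p, q)) (B : T -> 'M[R]_(q, r)) :
  measurable_fun setT A -> measurable_fun setT B ->
  measurable_fun setT (fun t => A t *m B t).
Proof.
move=> /measurable_mxP mA /measurable_mxP mB; apply/measurable_mxP => i j.
under eq_fun do rewrite mxE.
by apply: measurable_sum => k; apply: measurable_funM.
Qed.

Lemma measurable_mulmxl (R : realType) p q r (A : 'M[R]_(p, q)) :
  measurable_fun [set: 'M[R]_(q, r)] (mulmx A).
Proof. by apply: (measurable_mulmx (A := fun=> A)) => //; exact: measurable_cst. Qed.

Definition gauss_invariant (R : realType) N (O : 'M[R]_N) :=
  forall f : 'cV[R]_N -> \bar R, measurable_fun [set: 'cV[R]_N] f ->
    (forall v, (0 <= f v)%E) ->
  (\int[gauss R N]_v f (O *m v) = \int[gauss R N]_v f v)%E.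

Lemma gauss_invariantM (R : realType) N (O Q : 'M[R]_N) :
  gauss_invariant O -> gauss_invariant Q -> gauss_invariant (O *m Q).
Proof.
move=> hO hQ f mf f0; rewrite -(hO f mf f0).
rewrite -(hQ (fun v => f (O *m v))) => //.
  by apply: eq_integral => v _; rewrite mulmxA.
by apply: (measurableT_comp mf); exact: measurable_mulmxl.
Qed.

Lemma gauss_invariantV (R : realType) N (O Q : 'M[R]_N) :
  gauss_invariant O -> O *m Q = 1%:M -> gauss_invariant Q.
Proof.
move=> hO OQ f mf f0; rewrite -(hO (fun v => f (Q *m v))) => //; last first.
  by apply: (measurableT_comp mf); exact: measurable_mulmxl.
by apply: eq_integral => v _; rewrite mulmxA (mulmx1C OQ) mul1mx.
Qed.

Definition border1 (R : realType) N (O : 'M[R]_N) : 'M[R]_N.+1 :=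
  block_mx (1%:M : 'M[R]_1) 0 0 O.

Lemma border1_cons (R : realType) N (O : 'M[R]_N) xv :
  border1 O *m mx_cons xv = mx_cons (xv.1, O *m xv.2).
Proof.
apply: (etrans (mul_block_col (1%:M : 'M[R]_1) 0 0 O (scalar_mx (xv.1) : 'M[R]_1) (xv.2))).
by rewrite !mul1mx !mul0mx addr0 add0r.
Qed.

(** Fubini in the first coordinate. *)
Lemma gauss_invariant_border1 (R : realType) N (O : 'M[R]_N) :
  gauss_invariant O -> gauss_invariant (border1 O).
Proof.
move=> hO f mf f0; rewrite (gauss_integralS mf f0).
have mfO : measurable_fun [set: 'cV[R]_N.+1] (fun v => f (border1 O *m v)).
  by apply: (measurableT_comp mf); exact: measurable_mulmxl.
rewrite (gauss_integralS mfO (fun v => f0 _)).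
apply: eq_integral => x _.
transitivity (\int[gauss R N]_v f (mx_cons (x, O *m v)))%E.
  by apply: eq_integral => v _; rewrite border1_cons.
apply: (hO (fun v => f (mx_cons (x, v)))) => //.
apply: (measurableT_comp mf); apply: (measurableT_comp (@measurable_mx_cons R N)).
exact: measurable_pair1.
Qed.

Definition planar_rotation (R : realType) N (c s : R) : 'M[R]_N.+2 :=
  block_mx (c%:M : 'M[R]_1) (row_mx (s%:M : 'M[R]_1) (0 : 'M[R]_(1, N)))
    (col_mx ((- s)%:M : 'M[R]_1) 0) (block_mx (c%:M : 'M[R]_1) 0 0 1%:M).

Lemma planar_rotation_cons (R : realType) N (c s x y : R) (v : 'cV[R]_N) :
  planar_rotation N c s *m mx_cons (x, mx_cons (y, v)) =
  mx_cons (c * x + s * y, mx_cons (- s * x + c * y, v)).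
Proof.
apply: (etrans (mul_block_col (c%:M : 'M[R]_1) (row_mx (s%:M : 'M[R]_1) 0)
  (col_mx ((- s)%:M : 'M[R]_1) 0) (block_mx (c%:M : 'M[R]_1) 0 0 1%:M)
  (x%:M : 'M[R]_1) (col_mx (y%:M : 'M[R]_1) v))).
rewrite /mx_cons/= (mul_row_col (s%:M : 'M[R]_1)) mul_col_mx.
rewrite (mul_block_col (c%:M : 'M[R]_1)) !mul0mx !addr0 add0r mul1mx.
rewrite -!scalar_mxM (add_col_mx ((- s * x)%:M : 'M[R]_1)) add0r.
by rewrite -!raddfD.
Qed.

Lemma gauss_invariant_planar (R : realType) N (c s : R) :
  c ^+ 2 + s ^+ 2 = 1 -> gauss_invariant (planar_rotation N c s).
Proof.
move=> cs f mf f0.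
have unfold2 g : measurable_fun [set: 'cV[R]_N.+2] g -> (forall v, (0 <= g v)%E) ->
  (\int[gauss R N.+2]_v g v = \int[gauss1 R]_x \int[gauss1 R]_y \int[gauss R N]_v
     g (mx_cons (x, mx_cons (y, v))))%E.
  move=> mg g0; rewrite (gauss_integralS mg g0); apply: eq_integral => x _.
  rewrite (gauss_integralS (f := fun v => g (mx_cons (x, v)))) => //.
  apply: (measurableT_comp mg); apply: (measurableT_comp (@measurable_mx_cons R N.+1)).
  exact: measurable_pair1.
have mfO : measurable_fun [set: 'cV[R]_N.+2] (fun v => f (planar_rotation N c s *m v)).
  by apply: (measurableT_comp mf); exact: measurable_mulmxl.
apply: etrans (unfold2 _ mfO (fun v => f0 _)) _.
apply: etrans _ (esym (unfold2 f mf f0)).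
pose h (w : ((R * R) * 'cV[R]_N)%type) := f (mx_cons (w.1.1, mx_cons (w.1.2, w.2))).
have mh : measurable_fun setT h.
  apply: (measurableT_comp mf); apply: (measurableT_comp (@measurable_mx_cons R N.+1)).
  apply: measurable_fun_pair; first exact: measurableT_comp.
  apply: (measurableT_comp (@measurable_mx_cons R N)).
  by apply: measurable_fun_pair => //; exact: measurableT_comp.
have mF := measurable_fun_fubini_tonelli_F (m2 := gauss R N) h mh (fun w => f0 _).
have F0 z : (0 <= fubini_F (gauss R N) h z)%E 
  by rewrite /fubini_F; apply: integral_ge0 => v _; exact: f0.
apply: etrans _ (gauss1_rotation cs mF F0).
apply: eq_integral => x _; apply: eq_integral => y _.
rewrite /fubini_F; apply: eq_integral => v _.
by rewrite /h/= planar_rotation_cons.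
Qed.

Lemma gauss_invariant_sign (R : realType) : gauss_invariant ((-1)%:M : 'M[R]_1).
Proof.
move=> f mf f0.
have mfO : measurable_fun [set: 'cV[R]_1] (fun v => f ((-1)%:M *m v)).
  by apply: (measurableT_comp mf); exact: measurable_mulmxl.
apply: etrans (gauss_integralS mfO (fun v => f0 _)) _.
apply: etrans _ (esym (gauss_integralS mf f0)).
have m0 (g : 'cV[R]_0 -> \bar R) : measurable_fun setT g.
  move=> _ Y mY; rewrite setTI.
  have [Y0|Y0] := pselect (Y (g 0)).
    rewrite (_ : _ @^-1` _ = setT)//; apply/seteqP; split=> v //= _.
    by rewrite (_ : v = 0)//; apply/matrixP => -[].
  rewrite (_ : _ @^-1` _ = set0)//; apply/seteqP; split=> v //=.
  by rewrite (_ : v = 0)//; apply/matrixP => -[].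
pose h x := (\int[gauss R 0]_v f (mx_cons (x, v)))%E.
have mh : measurable_fun [set: R] h.
  apply: (measurable_fun_fubini_tonelli_F (m2 := gauss R 0) (fun w : (R * 'cV[R]_0)%type => f (mx_cons w))) => //.
  by apply: (measurableT_comp mf); exact: measurable_mx_cons.
have h0 x : (0 <= h x)%E by apply: integral_ge0.
rewrite -(gauss1_opp mh h0); apply: eq_integral => x _.
apply: eq_integral => v _; congr f; apply/matrixP => i j.
by rewrite mul_scalar_mx mxE (ord1 i) (ord1 j) !mx_cons0 mulN1r.
Qed.

Lemma block_scalar1 (R : comRingType) N : (block_mx (1%:M : 'M[R]_1) 0 0 1%:M : 'M[R]_N.+1) = 1%:M.
Proof. by rewrite -(@scalar_mx_block _ 1 N 1). Qed.

Lemma border1_orthogonal (R : realType) N (O : 'M[R]_N) :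
  (border1 O)^T *m border1 O = 1%:M <-> O^T *m O = 1%:M.
Proof.
have -> : (border1 O)^T *m border1 O = border1 (O^T *m O).
  have E : (block_mx (1%:M : 'M[R]_1) 0 0 O)^T *m block_mx (1%:M : 'M[R]_1) 0 0 O =
      block_mx (1%:M : 'M[R]_1) 0 0 (O^T *m O).
    rewrite tr_block_mx !trmx0 trmx1 mulmx_block.
    by rewrite !mulmx0 !mul0mx mulmx1 !addr0 !add0r.
  exact: E.
split=> [e|->]; last exact: block_scalar1.
have : block_mx (1%:M : 'M[R]_1) 0 0 (O^T *m O) = block_mx (1%:M : 'M[R]_1) 0 0 1%:M.
  exact: etrans e (esym (block_scalar1 R N)).
by move=> /eq_block_mx[].
Qed.

Lemma cV_cons (R : realType) N (v : 'cV[R]_N.+1) :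
  v = mx_cons (v ord0 0, \col_i v (lift ord0 i) 0).
Proof.
apply/matrixP => i j; rewrite (ord1 j); case: (unliftP ord0 i) => [k|] ->.
  by rewrite mx_consS mxE.
by rewrite mx_cons0.
Qed.

Lemma mx_cons_sqnorm (R : realType) N (x : R) (v : 'cV[R]_N) :
  ((mx_cons (x, v))^T *m mx_cons (x, v)) 0 0 = x ^+ 2 + (v^T *m v) 0 0.
Proof.
rewrite mxE big_ord_recl mxE mx_cons0 -expr2; congr (_ + _).
by rewrite [RHS]mxE; apply: eq_bigr => i _; rewrite mxE mx_consS [in RHS]mxE.
Qed.

Lemma mulmx_fix_eq1 (R : comNzRingType) N (A : 'M[R]_N) :
  (forall v : 'cV_N, A *m v = v) -> A = 1%:M.
Proof.
move=> Av; apply/matrixP => i j.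
by have := congr1 (fun v : 'cV_N => v i 0) (Av (delta_mx j 0)); rewrite -colE !mxE eqxx andbT.
Qed.

Lemma planar_rotation_orthogonal (R : realType) N (c s : R) : c ^+ 2 + s ^+ 2 = 1 ->
  (planar_rotation N c s)^T *m planar_rotation N c s = 1%:M.
Proof.
move=> cs; have -> : (planar_rotation N c s)^T = planar_rotation N c (- s).
  apply: (etrans (tr_block_mx (c%:M : 'M[R]_1) (row_mx (s%:M : 'M[R]_1) 0)
    (col_mx ((- s)%:M : 'M[R]_1) 0) (block_mx (c%:M : 'M[R]_1) 0 0 1%:M))).
  rewrite (tr_col_mx ((- s)%:M : 'M[R]_1)) (tr_row_mx (s%:M : 'M[R]_1)).
  rewrite (tr_block_mx (c%:M : 'M[R]_1)) !tr_scalar_mx !trmx0.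
  by rewrite /planar_rotation opprK.
apply: mulmx_fix_eq1 => v; rewrite -mulmxA (cV_cons v).
set w := \col_i _; rewrite (cV_cons w) !planar_rotation_cons.
congr (mx_cons (_, mx_cons (_, _))).
- transitivity ((c ^+ 2 + s ^+ 2) * v ord0 0); first by ring.
  by rewrite cs mul1r.
- transitivity ((c ^+ 2 + s ^+ 2) * w ord0 0); first by ring.
  by rewrite cs mul1r.
Qed.

(** By induction on the dimension: align the tail of [u] with the second axis, then
    rotate the plane of the first two axes. *)
Lemma gauss_invariant_align (R : realType) N (u : 'cV[R]_N.+1) :
  (u^T *m u) 0 0 = 1 ->
  exists G, [/\ gauss_invariant G, G^T *m G = 1%:M & G *m u = mx_cons (1, 0)].
Proof.
elim: N => [|N IH] in u *.
  rewrite (cV_cons u); set x := u ord0 0; set v := \col_i _.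
  have -> : v = 0 by apply/matrixP => -[].
  rewrite mx_cons_sqnorm mulmx0 mxE addr0 => /eqP; rewrite sqrf_eq1 => /orP[]/eqP->.
    exists 1%:M; split=> //; rewrite ?trmx1 ?mulmx1 ?mul1mx//.
    by move=> f mf f0; apply: eq_integral => w _; rewrite mul1mx.
  exists ((-1)%:M); split; first exact: gauss_invariant_sign.
    by rewrite tr_scalar_mx -scalar_mxM mulrNN mulr1.
  apply/matrixP => i j; rewrite (ord1 j) (ord1 i) mul_scalar_mx mxE !mx_cons0.
  by rewrite mulrNN mulr1.
rewrite (cV_cons u); set x := u ord0 0; set v := \col_i _ => uu.
pose q := Num.sqrt ((v^T *m v) 0 0).
have vv0 : 0 <= (v^T *m v) 0 0.
  by rewrite mxE sumr_ge0// => i _; rewrite mxE -expr2 sqr_ge0.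
have cs : x ^+ 2 + q ^+ 2 = 1 by rewrite sqr_sqrtr// -mx_cons_sqnorm.
have [G [hG GG Gv]] : exists G, [/\ gauss_invariant G, G^T *m G = 1%:M &
    G *m v = mx_cons (q, 0)].
  have [q0|q0] := eqVneq q 0.
    exists 1%:M; split=> //; rewrite ?trmx1 ?mulmx1 ?mul1mx//.
      by move=> f mf f0; apply: eq_integral => w _; rewrite mul1mx.
    have vv : ((v^T) *m (v^T)^T) 0 0 = 0.
      by rewrite trmxK -(sqr_sqrtr vv0) -/q q0 expr0n.
    have /eqP : (v^T) == 0 by rewrite -dot_eq0 vv.
    move/(congr1 trmx); rewrite trmxK trmx0 q0 => ->.
    apply/matrixP => i j; rewrite (ord1 j) mxE; case: (unliftP ord0 i) => [k|] ->.
      by rewrite mx_consS mxE.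
    by rewrite mx_cons0.
  have [|G [hG GG Gv]] := IH (q^-1 *: v).
    by rewrite [(_ *: v)^T]linearZ/= -scalemxAl -scalemxAr scalerA mxE -invfM -expr2 sqr_sqrtr// mulVf// -(sqr_sqrtr vv0) expf_neq0.
  exists G; split=> //.
  rewrite -[v](scalerKV q0) -scalemxAr Gv.
  apply/matrixP => i j; rewrite (ord1 j) mxE; case: (unliftP ord0 i) => [k|] ->.
    by rewrite !mx_consS !mxE mulr0.
  by rewrite !mx_cons0 mulr1.
exists (planar_rotation N x q *m border1 G); split.
- apply: gauss_invariantM; first exact: gauss_invariant_planar.
  exact: gauss_invariant_border1.
- rewrite trmx_mul mulmxA -(mulmxA _^T) planar_rotation_orthogonal// mulmx1.
  exact/border1_orthogonal.
- rewrite -mulmxA border1_cons/= Gv planar_rotation_cons.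
  rewrite -!expr2 cs mulNr [q * x]mulrC addNr.
  congr (mx_cons (_, _)).
  apply/matrixP => i j; rewrite (ord1 j) [RHS]mxE; case: (unliftP ord0 i) => [k|] ->.
    by rewrite mx_consS mxE.
  by rewrite mx_cons0.
Qed.

Lemma fix_axis_border1 (R : realType) N (Q : 'M[R]_N.+1) :
  Q *m mx_cons (1, 0) = mx_cons (1, 0) -> Q^T *m mx_cons (1, 0) = mx_cons (1, 0) ->
  exists O, Q = border1 O.
Proof.
suff : forall Q : 'M[R]_(1 + N),
  Q *m col_mx (1%:M : 'M[R]_1) 0 = col_mx (1%:M : 'M[R]_1) 0 ->
  Q^T *m col_mx (1%:M : 'M[R]_1) 0 = col_mx (1%:M : 'M[R]_1) 0 ->
  Q = block_mx (1%:M : 'M[R]_1) 0 0 (drsubmx Q).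
  by move=> /(_ Q) h Q1 Q1'; exists (drsubmx (Q : 'M[R]_(1 + N))); exact: h.
move=> {}Q; rewrite -[Q]submxK tr_block_mx !mul_block_col !mulmx0 !addr0 !mulmx1.
move=> /eq_col_mx[-> ->] /eq_col_mx[_ /(congr1 trmx)].
by rewrite trmxK trmx0 block_mxKdr => ->.
Qed.

(** Bringing the image of the first axis back to that axis reduces [O] to an
    isometry of its orthogonal complement. *)
Theorem gauss_orthogonal (R : realType) N (O : 'M[R]_N) :
  O^T *m O = 1%:M -> gauss_invariant O.
Proof.
elim: N => [|N IH] in O *.
  by move=> _ f mf f0; apply: eq_integral => v _; congr f; apply/matrixP => -[].
move=> OO; pose u := col ord0 O.
have uE : O *m mx_cons (1, 0) = u.
  rewrite /u colE; congr (_ *m _); apply/matrixP => i j.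
  rewrite (ord1 j) [RHS]mxE andbT; case: (unliftP ord0 i) => [k|] ->.
    by rewrite mx_consS mxE.
  by rewrite mx_cons0.
have uu : (u^T *m u) 0 0 = 1.
  rewrite -uE trmx_mul mulmxA -(mulmxA _^T) OO mulmx1 mx_cons_sqnorm.
  by rewrite mulmx0 mxE expr1n addr0.
have [G [hG GG Gu]] := gauss_invariant_align uu.
have GO1 : (G *m O) *m mx_cons (1, 0) = mx_cons (1, 0) by rewrite -mulmxA uE.
have QQ : (G *m O)^T *m (G *m O) = 1%:M.
  by rewrite trmx_mul mulmxA -(mulmxA _^T) GG mulmx1.
have GO1' : (G *m O)^T *m mx_cons (1, 0) = mx_cons (1, 0).
  by rewrite -[in LHS]GO1 mulmxA QQ mul1mx.
have [B GOE] := fix_axis_border1 GO1 GO1'.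
have hGO : gauss_invariant (G *m O).
  rewrite GOE; apply: gauss_invariant_border1; apply: IH.
  by apply/border1_orthogonal; rewrite -GOE.
have -> : O = G^T *m (G *m O) by rewrite mulmxA GG mul1mx.
apply: gauss_invariantM hGO; apply: gauss_invariantV hG _.
exact: mulmx1C.
Qed.

(** * Perturbation of the covariance *)

(** The two maps differ by an isometry of the source ([gram_orthogonal]). *)
Lemma gauss_gram (R : realType) q N (B H : 'M[R]_(q, N)) (f : 'cV[R]_q -> \bar R) :
  B *m B^T = H *m H^T ->
  measurable_fun [set: 'cV[R]_q] f -> (forall v, (0 <= f v)%E) ->
  (\int[gauss R N]_v f (B *m v) = \int[gauss R N]_v f (H *m v))%E.
Proof.
move=> BH mf f0; have [Q QQ BQ] := gram_orthogonal BH.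
have mfB : measurable_fun [set: 'cV[R]_N] (fun v => f (B *m v)).
  by apply: (measurableT_comp mf); exact: measurable_mulmxl.
apply: etrans (esym (gauss_orthogonal (orthogonal_tr QQ) mfB (fun v => f0 _))) _.
by apply: eq_integral => v _; rewrite mulmxA BQ.
Qed.

Definition scale_cV (R : realType) N (r : 'I_N -> R) (v : 'cV[R]_N) : 'cV[R]_N :=
  \col_i (r i * v i 0).

Lemma measurable_scale_cV (R : realType) N (r : 'I_N -> R) :
  measurable_fun [set: 'cV[R]_N] (scale_cV r).
Proof.
apply/measurable_mxP => i j; under eq_fun do rewrite mxE.
by apply: measurable_funM => //; exact: measurable_entry.
Qed.

Lemma scale_cV_cons (R : realType) N (r : 'I_N.+1 -> R) x (v : 'cV[R]_N) :
  scale_cV r (mx_cons (x, v)) =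
  mx_cons (r ord0 * x, scale_cV (fun i => r (lift ord0 i)) v).
Proof.
apply/matrixP => i j; rewrite (ord1 j) [LHS]mxE.
case: (unliftP ord0 i) => [k|] ->; last by rewrite !mx_cons0.
by rewrite !mx_consS [in RHS]mxE.
Qed.

Definition likelihood_cV (R : realType) N (d : 'I_N -> R) (v : 'cV[R]_N) : R :=
  \prod_i likelihood (d i) (v i 0).

Lemma likelihood_cV_ge0 (R : realType) N (d : 'I_N -> R) v : 0 <= likelihood_cV d v.
Proof. by apply: prodr_ge0 => i _; exact: likelihood_ge0. Qed.

Lemma measurable_likelihood_cV (R : realType) N (d : 'I_N -> R) :
  measurable_fun [set: 'cV[R]_N] (likelihood_cV d).
Proof.
apply: measurable_prod => i _; apply: measurableT_comp; last exact: measurable_entry.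
exact: measurable_likelihood.
Qed.

Lemma likelihood_cV_cons (R : realType) N (d : 'I_N.+1 -> R) x (v : 'cV[R]_N) :
  likelihood_cV d (mx_cons (x, v)) =
  likelihood (d ord0) x * likelihood_cV (fun i => d (lift ord0 i)) v.
Proof.
rewrite /likelihood_cV big_ord_recl mx_cons0; congr (_ * _).
by apply: eq_bigr => i _; rewrite mx_consS.
Qed.

Lemma measurable_cons_slice (R : realType) N (f : 'cV[R]_N.+1 -> \bar R) x :
  measurable_fun [set: 'cV[R]_N.+1] f ->
  measurable_fun [set: 'cV[R]_N] (fun v => f (mx_cons (x, v))).
Proof.
move=> mf; apply: (measurableT_comp mf); apply: (measurableT_comp (@measurable_mx_cons R N)).
exact: measurable_pair1.
Qed.

Lemma ge0_integral_likelihood_cV (R : realType) N (d : 'I_N -> R)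
    (f : 'cV[R]_N -> \bar R) : (forall i, -1 < d i) ->
  measurable_fun [set: 'cV[R]_N] f -> (forall v, (0 <= f v)%E) ->
  (\int[gauss R N]_v f (scale_cV (fun i => Num.sqrt (1 + d i)) v) =
   \int[gauss R N]_v (f v * (likelihood_cV d v)%:E))%E.
Proof.
elim: N => [|N IH] in d f *.
  move=> _ mf f0; apply: eq_integral => v _.
  rewrite /likelihood_cV big_ord0 mule1; congr f; by apply/matrixP => -[].
move=> d1 mf f0.
set r := fun i => Num.sqrt (1 + d i).
have mfr : measurable_fun [set: 'cV[R]_N.+1] (fun v => f (scale_cV r v)).
  by apply: (measurableT_comp mf); exact: measurable_scale_cV.
have mfl : measurable_fun [set: 'cV[R]_N.+1] (fun v => f v * (likelihood_cV d v)%:E)%E.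
  by apply: emeasurable_funM => //; apply/measurable_EFinP; exact: measurable_likelihood_cV.
have fl0 v : (0 <= f v * (likelihood_cV d v)%:E)%E.
  by rewrite mule_ge0// lee_fin likelihood_cV_ge0.
apply: etrans (gauss_integralS mfr (fun v => f0 _)) _.
apply: etrans _ (esym (gauss_integralS mfl fl0)).
pose d' i := d (lift ord0 i).
pose F x := (\int[gauss R N]_v f (mx_cons (x, scale_cV (fun i => r (lift ord0 i)) v)))%E.
have FE x : F x = (\int[gauss R N]_v (f (mx_cons (x, v)) * (likelihood_cV d' v)%:E))%E.
  apply: (IH d' (fun v => f (mx_cons (x, v)))) => //; last exact: measurable_cons_slice.
  by move=> i; exact: d1.
have mF : measurable_fun [set: R] F.
  rewrite (funext FE); apply: (measurable_fun_fubini_tonelli_F (m2 := gauss R N)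
    (fun w : (R * 'cV[R]_N)%type => f (mx_cons w) * (likelihood_cV d' w.2)%:E)%E).
    apply: emeasurable_funM.
      by apply: (measurableT_comp mf); exact: measurable_mx_cons.
    apply/measurable_EFinP; apply: measurableT_comp => //.
    exact: measurable_likelihood_cV.
  by move=> w; rewrite mule_ge0// lee_fin likelihood_cV_ge0.
have F0 x : (0 <= F x)%E by apply: integral_ge0.
transitivity (\int[gauss1 R]_x F (r ord0 * x)%R)%E.
  by apply: eq_integral => x _; apply: eq_integral => v _; rewrite scale_cV_cons.
apply: etrans (ge0_integral_likelihood (d1 ord0) mF F0) _.
apply: eq_integral => x _; rewrite FE muleC.
rewrite -ge0_integralZl//; last 3 first.
- apply: emeasurable_funM; first exact: measurable_cons_slice.
  by apply/measurable_EFinP; exact: measurable_likelihood_cV.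
- by move=> v _; rewrite mule_ge0// lee_fin likelihood_cV_ge0.
- by rewrite lee_fin likelihood_ge0.
by apply: eq_integral => v _; rewrite likelihood_cV_cons EFinM muleCA.
Qed.

Lemma likelihood_cV_sq_le (R : realType) N (d : 'I_N -> R) :
  (forall i, `|d i| <= 2^-1) ->
  (\int[gauss R N]_v (likelihood_cV d v ^+ 2)%:E <= (expR (\sum_i d i ^+ 2))%:E)%E.
Proof.
have msq M (e : 'I_M -> R) : measurable_fun [set: 'cV[R]_M] (fun v => (likelihood_cV e v ^+ 2)%:E).
  by apply/measurable_EFinP; apply: measurable_funX; exact: measurable_likelihood_cV.
elim: N => [|N IH] in d *.
  move=> _; rewrite big_ord0 expR0.
  rewrite (eq_integral (fun=> 1%E)) => [|v _]; last by rewrite /likelihood_cV big_ord0 expr1n.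
  by rewrite integral_cst// mul1e; exact: probability_le1.
move=> d1; pose d' i := d (lift ord0 i).
rewrite (gauss_integralS (msq _ d)); last by move=> v; rewrite lee_fin sqr_ge0.
have ml : measurable_fun [set: R] (fun x => (likelihood (d ord0) x ^+ 2)%:E).
  by apply/measurable_EFinP; apply: measurable_funX; exact: measurable_likelihood.
set K := (\int[gauss R N]_v (likelihood_cV d' v ^+ 2)%:E)%E.
have K0 : (0 <= K)%E by apply: integral_ge0 => v _; rewrite lee_fin sqr_ge0.
apply: (@le_trans _ _ ((\int[gauss1 R]_x (likelihood (d ord0) x ^+ 2)%:E) * K)%E).
  rewrite le_eqVlt; apply/orP; left; apply/eqP.
  rewrite -ge0_integralZr//; last by move=> x _; rewrite lee_fin sqr_ge0.
  apply: eq_integral => x _; rewrite /K -ge0_integralZl//; last 3 first.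
  - exact: msq.
  - by move=> v _; rewrite lee_fin sqr_ge0.
  - by rewrite lee_fin sqr_ge0.
  by apply: eq_integral => v _; rewrite likelihood_cV_cons exprMn EFinM.
rewrite big_ord_recl expRD EFinM; apply: lee_pmul.
- by apply: integral_ge0 => v _; rewrite lee_fin sqr_ge0.
- exact: K0.
- exact: likelihood_sq_le.
- by apply: IH => i; exact: d1.
Qed.

Lemma gauss_preimage_integral (R : realType) q N (phi : 'cV[R]_N -> 'cV[R]_q) (S : set 'cV[R]_q) :
  measurable_fun setT phi -> measurable S ->
  gauss R N [set v | S (phi v)] = (\int[gauss R N]_v (\1_S (phi v))%:E)%E.
Proof.
move=> mphi mS; have mpS : measurable (phi @^-1` S).
  by rewrite -[X in measurable X]setTI; exact: mphi.
rewrite -[LHS](_ : gauss R N ((phi @^-1` S) `&` setT) = _); last by rewrite setIT.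
by rewrite -integral_indic.
Qed.

(** Pointwise, 1_S Lambda <= t Lambda^2 + 1_S / (4 t), where Lambda is the
    likelihood ratio. *)
Lemma gauss_scale_le (R : realType) N (d : 'I_N -> R) (S : set 'cV[R]_N) (t : R) :
  0 < t -> (forall i, `|d i| <= 2^-1) -> measurable S ->
  (gauss R N [set v | S (scale_cV (fun i => Num.sqrt (1 + d i)) v)] <=
   (t * expR (\sum_i d i ^+ 2))%:E + ((4 * t)^-1)%:E * gauss R N S)%E.
Proof.
move=> t0 d1 mS.
have d2 i : -1 < d i by have := d1 i; rewrite ler_norml => /andP[]; lra.
have mI : measurable_fun [set: 'cV[R]_N] (fun v => (\1_S v)%:E : \bar R).
  by apply/measurable_EFinP; exact: measurable_indic.
have -> : gauss R N [set v | S (scale_cV (fun i => Num.sqrt (1 + d i)) v)] =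
    (\int[gauss R N]_v (\1_S (scale_cV (fun i => Num.sqrt (1 + d i)) v))%:E)%E.
  by rewrite gauss_preimage_integral//; exact: measurable_scale_cV.
rewrite (ge0_integral_likelihood_cV d2 mI); last by move=> v; rewrite lee_fin.
have mL2 : measurable_fun [set: 'cV[R]_N] (fun v => (likelihood_cV d v ^+ 2)%:E).
  by apply/measurable_EFinP; apply: measurable_funX; exact: measurable_likelihood_cV.
apply: (@le_trans _ _ (\int[gauss R N]_v (t%:E * (likelihood_cV d v ^+ 2)%:E +
   ((4 * t)^-1)%:E * (\1_S v)%:E))%E).
  apply: ge0_le_integral => //.
  - by move=> v _; rewrite mule_ge0// lee_fin ?likelihood_cV_ge0.
  - by apply: emeasurable_funM => //; apply/measurable_EFinP; exact: measurable_likelihood_cV.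
  - by apply: emeasurable_funD; apply: measurable_funeM.
  move=> v _; rewrite -!EFinM -EFinD lee_fin.
  have L0 := likelihood_cV_ge0 d v; set x := likelihood_cV d v in L0 *.
  rewrite indicE; case: (v \in S); rewrite ?mul1r ?mulr1 ?mul0r ?mulr0 ?addr0.
    have -> : t * x ^+ 2 + (4 * t)^-1 = x + (t * (x - (2 * t)^-1) ^+ 2).
      by field; rewrite gt_eqF.
    by rewrite lerDl mulr_ge0 ?sqr_ge0// ltW.
  by rewrite mulr_ge0 ?sqr_ge0// ltW.
have t4 : 0 <= (4 * t)^-1 by rewrite invr_ge0 mulr_ge0// ltW.
rewrite ge0_integralD//; last 4 first.
- by move=> v _; rewrite mule_ge0// lee_fin ?sqr_ge0// ltW.
- exact: measurable_funeM.
- by move=> v _; rewrite mule_ge0// lee_fin.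
- exact: measurable_funeM.
rewrite ge0_integralZl//; last 2 first.
- by move=> v _; rewrite lee_fin sqr_ge0.
- by rewrite lee_fin ltW.
rewrite ge0_integralZl//.
rewrite integral_indic// setIT; apply: leeD => //.
by rewrite EFinM lee_pmul2l//; exact: likelihood_cV_sq_le.
Qed.

(** Diagonalizing M and rotating the source turns 1 + M into a change of scale of
    each coordinate; exp (tr M^2) bounds the chi-square affinity of the two laws. *)
Theorem gauss_perturbation (R : realType) q N (B0 B1 : 'M[R]_(q, N)) (M : 'M[R]_N)
    (S : set 'cV[R]_q) (t : R) :
  0 < t -> M^T = M ->
  (forall x : 'rV[R]_N, `|(x *m M *m x^T) 0 0| <= 2^-1 * (x *m x^T) 0 0) ->
  B1 *m B1^T = B0 *m (1%:M + M) *m B0^T -> measurable S ->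
  (gauss R N [set v | S (B1 *m v)] <=
   (t * expR (\tr (M *m M)))%:E + ((4 * t)^-1)%:E * gauss R N [set v | S (B0 *m v)])%E.
Proof.
move=> t0 MT Mbd BB mS.
have [Q [d [QQ ME]]] := symmetric_spectral MT.
have QtQ := orthogonal_tr QQ.
have QMQ : Q *m M *m Q^T = diag_mx d.
  by rewrite ME !mulmxA QQ mul1mx -mulmxA QQ mulmx1.
have d1 i : `|d 0 i| <= 2^-1.
  have -> : d 0 i = (row i Q *m M *m (row i Q)^T) 0 0.
    transitivity ((Q *m M *m Q^T) i i); first by rewrite QMQ mxE eqxx mulr1n.
    by rewrite -row_mul !mxE; apply: eq_bigr => k _; rewrite !mxE.
  apply: (le_trans (Mbd _)).
  have -> : (row i Q *m (row i Q)^T) 0 0 = 1.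
    transitivity ((Q *m Q^T) i i); last by rewrite QQ mxE eqxx.
    by rewrite !mxE; apply: eq_bigr => k _; rewrite !mxE.
  by rewrite mulr1.
have trE : \tr (M *m M) = \sum_i d 0 i ^+ 2.
  rewrite [in LHS]ME !mulmxA -(mulmxA _ Q) QQ mulmx1 mxtrace_mulC !mulmxA QQ mul1mx.
  by rewrite mulmx_diag mxtrace_diag; apply: eq_bigr => i _; rewrite mxE expr2.
pose r i := Num.sqrt (1 + d 0 i).
have r2 i : r i * r i = 1 + d 0 i.
  by rewrite -expr2 sqr_sqrtr//; have := d1 i; rewrite ler_norml => /andP[]; lra.
pose Dr := diag_mx (\row_i r i).
have H : B1 *m B1^T = (B0 *m Q^T *m Dr) *m (B0 *m Q^T *m Dr)^T.
  rewrite BB !trmx_mul trmxK tr_diag_mx !mulmxA -(mulmxA _ Dr Dr) mulmx_diag.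
  rewrite -!mulmxA; congr (_ *m _); rewrite !mulmxA; congr (_ *m _).
  have -> : diag_mx (\row_j ((\row_i r i) 0 j * (\row_i r i) 0 j)) = 1%:M + diag_mx d.
    apply/matrixP => i j; rewrite !mxE r2; case: (i == j); rewrite ?mulr1n ?mulr0n ?addr0//.
  by rewrite mulmxDr mulmx1 mulmxDl QtQ -ME.
have mI : measurable_fun [set: 'cV[R]_q] (fun v => (\1_S v)%:E : \bar R).
  by apply/measurable_EFinP; exact: measurable_indic.
have I0 (v : 'cV[R]_q) : (0 <= (\1_S v : R)%:E)%E by rewrite lee_fin.
have mS' : measurable [set v | S (B0 *m Q^T *m v)].
  by rewrite -[X in measurable X]setTI; exact: (@measurable_mulmxl _ _ _ 1 (B0 *m Q^T) measurableT S mS).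
have -> : gauss R N [set v | S (B1 *m v)] =
    gauss R N [set v | [set w | S (B0 *m Q^T *m w)] (scale_cV r v)].
  apply: etrans (gauss_preimage_integral (@measurable_mulmxl _ _ _ 1 B1) mS) _.
  apply: etrans (gauss_gram H mI I0) _.
  apply: etrans _ (esym (gauss_preimage_integral (measurable_scale_cV r) mS')).
  apply: eq_integral => v _; congr (_%:E); rewrite !indicE; congr (_%:R); congr nat_of_bool.
  have -> : scale_cV r v = Dr *m v.
    by apply/matrixP => i j; rewrite mul_diag_mx !mxE (ord1 j).
  by rewrite -mulmxA; apply/idP/idP; rewrite !inE.
rewrite trE; apply: le_trans (gauss_scale_le t0 d1 mS') _.
rewrite leeD2l// le_eqVlt; apply/orP; left; apply/eqP; congr (_ * _)%E.
apply: etrans (gauss_preimage_integral (@measurable_mulmxl _ _ _ 1 (B0 *m Q^T)) mS) _.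
apply: etrans _ (esym (gauss_preimage_integral (@measurable_mulmxl _ _ _ 1 B0) mS)).
apply: gauss_gram mI I0.
by rewrite trmx_mul trmxK mulmxA -(mulmxA B0) QtQ mulmx1.
Qed.

(** * The perturbed covariance and its compression *)

Definition quad_bounded (R : realFieldType) n (h : R) (D : 'M[R]_n) :=
  forall y : 'rV[R]_n, `|(y *m D *m y^T) 0 0| <= h * (y *m y^T) 0 0.

(** The covariance of [A X w + sigma g], for [X^2 = x0^2 (1 + D)]. *)
Definition signal_cov (R : realFieldType) q p (x0 sigma : R) (A : 'M[R]_(q, p))
    (D : 'M[R]_p) : 'M[R]_q :=
  (x0 ^+ 2) *: (A *m (1%:M + D) *m A^T) + (sigma ^+ 2)%:M.

Definition base_map (R : realFieldType) q p (x0 sigma : R) (A : 'M[R]_(q, p)) :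
  'M[R]_(q, p + q) := row_mx (x0 *: A) sigma%:M.

Definition base_cov (R : realFieldType) q p (x0 sigma : R) (A : 'M[R]_(q, p)) :=
  (x0 ^+ 2) *: (A *m A^T) + (sigma ^+ 2)%:M.

Lemma trmxZ (R : comNzRingType) m n (a : R) (A : 'M[R]_(m, n)) : (a *: A)^T = a *: A^T.
Proof. by apply/matrixP => i j; rewrite !mxE. Qed.

Lemma base_map_gram (R : realFieldType) q p (x0 sigma : R) (A : 'M[R]_(q, p)) :
  base_map x0 sigma A *m (base_map x0 sigma A)^T = base_cov x0 sigma A.
Proof.
rewrite /base_map tr_row_mx mul_row_col trmxZ tr_scalar_mx -scalemxAl -scalemxAr.
by rewrite scalerA -scalar_mxM -!expr2.
Qed.

Definition pad (R : realFieldType) p q (D : 'M[R]_p) : 'M[R]_(p + q) :=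
  block_mx D 0 0 0.

Lemma base_map_pad (R : realFieldType) q p (x0 sigma : R) (A : 'M[R]_(q, p)) D :
  base_map x0 sigma A *m (1%:M + pad q D) *m (base_map x0 sigma A)^T =
  signal_cov x0 sigma A D.
Proof.
rewrite mulmxDr mulmx1 mulmxDl base_map_gram /signal_cov /base_cov.
rewrite mulmxDr mulmx1 mulmxDl scalerDr addrAC; congr (_ + _ + _).
rewrite /base_map /pad mul_row_block !mulmx0 !addr0 tr_row_mx mul_row_col mul0mx addr0.
by rewrite trmxZ -!scalemxAl -scalemxAr scalerA expr2.
Qed.

Lemma pad_sym (R : realFieldType) p q (D : 'M[R]_p) : D^T = D -> (pad q D)^T = pad q D.
Proof. by rewrite /pad tr_block_mx !trmx0 => ->. Qed.

Lemma pad_bounded (R : realFieldType) p q h (D : 'M[R]_p) :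
  0 <= h -> quad_bounded h D -> quad_bounded h (pad q D).
Proof.
move=> h0 hD y; rewrite -[y]hsubmxK /pad mul_row_block !mulmx0 !addr0.
rewrite tr_row_mx !mul_row_col mul0mx addr0 [X in h * X]mxE.
by apply: (le_trans (hD _)); rewrite ler_wpM2l// lerDl dot_ge0.
Qed.

Lemma pad_sqtrace (R : realFieldType) p q (D : 'M[R]_p) :
  \tr (pad q D *m pad q D) = \tr (D *m D).
Proof.
rewrite /pad mulmx_block !mulmx0 !mul0mx !addr0 mxtrace_block.
by rewrite mxtrace0 addr0.
Qed.

(** The orthogonal projection onto the row space of [B]. *)
Definition row_proj (R : realFieldType) q N (B : 'M[R]_(q, N)) : 'M[R]_N :=
  B^T *m invmx (B *m B^T) *m B.

Lemma row_proj_sym (R : realFieldType) q N (B : 'M[R]_(q, N)) :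
  (row_proj B)^T = row_proj B.
Proof. by rewrite /row_proj !trmx_mul trmxK trmx_inv trmx_mul trmxK mulmxA. Qed.

Lemma mul_row_proj (R : realFieldType) q N (B : 'M[R]_(q, N)) :
  B *m B^T \in unitmx -> B *m row_proj B = B.
Proof. by move=> u; rewrite /row_proj !mulmxA mulmxV// mul1mx. Qed.

Lemma row_proj_idem (R : realFieldType) q N (B : 'M[R]_(q, N)) :
  B *m B^T \in unitmx -> row_proj B *m row_proj B = row_proj B.
Proof. by move=> u; rewrite {1}/row_proj -!mulmxA mul_row_proj// !mulmxA. Qed.

Lemma row_proj_contract (R : realFieldType) q N (B : 'M[R]_(q, N)) (x : 'rV[R]_N) :
  B *m B^T \in unitmx ->
  ((x *m row_proj B) *m (x *m row_proj B)^T) 0 0 <= (x *m x^T) 0 0.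
Proof.
move=> u; set P := row_proj B.
have PP : P *m P = P by apply: row_proj_idem.
have PT : P^T = P by apply: row_proj_sym.
set y := x *m P.
have xy : x *m y^T = y *m x^T by rewrite /y trmx_mul PT mulmxA.
have yy : y *m y^T = y *m x^T by rewrite {2}/y trmx_mul PT mulmxA /y -(mulmxA x) PP.
have := dot_ge0 (x - y); rewrite raddfB/= mulmxBl !mulmxBr xy yy subrr subr0.
by rewrite [in X in X -> _]mxE [in X in _ + X]mxE subr_ge0.
Qed.

Lemma sandwich_bounded (R : realFieldType) q N (B : 'M[R]_(q, N)) h (M : 'M[R]_N) :
  B *m B^T \in unitmx -> 0 <= h -> quad_bounded h M ->
  quad_bounded h (row_proj B *m M *m row_proj B).
Proof.
move=> u h0 hM y; set P := row_proj B.
have -> : y *m (P *m M *m P) *m y^T = (y *m P) *m M *m (y *m P)^T.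
  by rewrite trmx_mul row_proj_sym !mulmxA.
by apply: (le_trans (hM _)); rewrite ler_wpM2l// row_proj_contract.
Qed.

(** The block of the projection onto the row space of [base_map x0 sigma A] that
    acts on the signal coordinates. *)
Definition signal_proj (R : realFieldType) q p (x0 sigma : R) (A : 'M[R]_(q, p)) : 'M[R]_p :=
  (x0 ^+ 2) *: (A^T *m invmx (base_cov x0 sigma A) *m A).

Lemma row_proj_ul (R : realFieldType) q p (x0 sigma : R) (A : 'M[R]_(q, p)) :
  ulsubmx (row_proj (base_map x0 sigma A)) = signal_proj x0 sigma A.
Proof.
rewrite /row_proj base_map_gram /base_map tr_row_mx mul_col_mx mul_col_row block_mxKul.
by rewrite trmxZ -!scalemxAl -!scalemxAr scalerA -expr2.
Qed.

(** The trace of the square involves only the signal block of the projection. *)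
Lemma sandwich_sqtrace (R : realFieldType) q p (x0 sigma : R) (A : 'M[R]_(q, p)) D :
  base_cov x0 sigma A \in unitmx ->
  let P := row_proj (base_map x0 sigma A) in
  \tr ((P *m pad q D *m P) *m (P *m pad q D *m P)) =
  \tr (signal_proj x0 sigma A *m D *m signal_proj x0 sigma A *m D).
Proof.
move=> u P; rewrite -row_proj_ul -/P.
have : P *m P = P by apply: row_proj_idem; rewrite base_map_gram.
clearbody P => PP.
transitivity (\tr (P *m pad q D *m (P *m pad q D))).
  by rewrite !mulmxA -(mulmxA _ P P) PP mxtrace_mulC !mulmxA PP.
rewrite -[P]submxK /pad !mulmx_block !mulmx0 !addr0 block_mxKul.
by rewrite mxtrace_block !(mul0mx, mulmx0, addr0) mxtrace0 addr0 !mulmxA.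
Qed.

Definition blockdiag (R : pzRingType) L m n (A : 'I_L -> 'M[R]_(m, n)) :
    'M[R]_(\sum_(l < L) m, \sum_(l < L) n) :=
  \mxblock_(i, j) (if i == j then A i else 0).

Lemma mul_blockdiag (R : pzRingType) L m n p (A : 'I_L -> 'M[R]_(m, n))
    (B : 'I_L -> 'M[R]_(n, p)) :
  blockdiag A *m blockdiag B = blockdiag (fun l => A l *m B l).
Proof.
rewrite /blockdiag mul_mxblock; apply: eq_mxblock => i k.
rewrite (bigD1 i)//= eqxx big1 ?addr0 => [|j ji]; last first.
  by rewrite eq_sym (negbTE ji) mul0mx.
by case: eqP => [->|_] //; rewrite mulmx0.
Qed.

Lemma tr_blockdiag (R : pzRingType) L m n (A : 'I_L -> 'M[R]_(m, n)) :
  (blockdiag A)^T = blockdiag (fun l => (A l)^T).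
Proof.
rewrite /blockdiag tr_mxblock; apply: eq_mxblock => i j; rewrite eq_sym.
by case: eqP => [->|_] //; rewrite trmx0.
Qed.

Lemma blockdiagD (R : pzRingType) L m n (A B : 'I_L -> 'M[R]_(m, n)) :
  blockdiag A + blockdiag B = blockdiag (fun l => A l + B l).
Proof.
rewrite /blockdiag -mxblockD; apply: eq_mxblock => i j.
by case: eqP => // _; rewrite addr0.
Qed.

Lemma blockdiagZ (R : pzRingType) L m n (a : R) (A : 'I_L -> 'M[R]_(m, n)) :
  a *: blockdiag A = blockdiag (fun l => a *: A l).
Proof.
apply/mxblockP => i j; rewrite mxblockK.
have -> : submxblock (a *: blockdiag A) i j = a *: submxblock (blockdiag A) i j.
  by apply/matrixP => k l; rewrite !mxE.
by rewrite mxblockK; case: eqP => // _; rewrite scaler0.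
Qed.

Lemma blockdiag_scalar (R : pzRingType) L m (a : R) :
  blockdiag (fun _ : 'I_L => a%:M : 'M[R]_m) = a%:M.
Proof.
rewrite -[RHS](mxdiagZ (p_ := fun=> m)) /mxdiag /blockdiag; apply: eq_mxblock => i j.
by case: eqP => // _; rewrite conform_mx_id.
Qed.

Lemma blockdiag_trace (R : pzRingType) L m (A : 'I_L -> 'M[R]_m) :
  \tr (blockdiag A) = \sum_l \tr (A l).
Proof.
by rewrite /blockdiag mxtrace_mxblock; apply: eq_bigr => l _; rewrite eqxx.
Qed.

Lemma blockdiag_mul_mxcol (R : pzRingType) L m n p (A : 'I_L -> 'M[R]_(m, n))
    (v : 'I_L -> 'M[R]_(n, p)) :
  blockdiag A *m \mxcol_l v l = \mxcol_l (A l *m v l).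
Proof.
rewrite /blockdiag mul_mxblock_mxrow; apply: eq_mxcol => i.
rewrite (bigD1 i)//= eqxx big1 ?addr0// => j ji.
by rewrite eq_sym (negbTE ji) mul0mx.
Qed.

Lemma blockdiag_unit (R : comUnitRingType) L m (A : 'I_L -> 'M[R]_m) :
  (forall l, A l \in unitmx) ->
  blockdiag A \in unitmx /\ invmx (blockdiag A) = blockdiag (fun l => invmx (A l)).
Proof.
move=> uA; have e : blockdiag A *m blockdiag (fun l => invmx (A l)) = 1%:M.
  rewrite mul_blockdiag -[RHS]blockdiag_scalar; apply: eq_mxblock => i j.
  by rewrite mulmxV.
have [u _] := mulmx1_unit e; split => //.
by rewrite -[LHS]mulmx1 -e mulKmx.
Qed.

Lemma blockdiag_base_cov (R : realFieldType) L m n (x0 sigma : R)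
    (A : 'I_L -> 'M[R]_(m, n)) :
  base_cov x0 sigma (blockdiag A) = blockdiag (fun l => base_cov x0 sigma (A l)).
Proof.
by rewrite /base_cov tr_blockdiag mul_blockdiag blockdiagZ -(blockdiag_scalar L) blockdiagD.
Qed.

Lemma blockdiag_signal_proj (R : realFieldType) L m n (x0 sigma : R)
    (A : 'I_L -> 'M[R]_(m, n)) : (forall l, base_cov x0 sigma (A l) \in unitmx) ->
  signal_proj x0 sigma (blockdiag A) = blockdiag (fun l => signal_proj x0 sigma (A l)).
Proof.
move=> u; have [_ e] := blockdiag_unit u.
by rewrite /signal_proj blockdiag_base_cov e tr_blockdiag !mul_blockdiag blockdiagZ.
Qed.

Lemma blockdiag_bounded (R : realFieldType) L n h (D : 'M[R]_n) :
  quad_bounded h D -> quad_bounded h (blockdiag (fun _ : 'I_L => D)).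
Proof.
move=> hD y; rewrite -[y]submxrowK tr_mxrow -mulmxA blockdiag_mul_mxcol.
rewrite !mul_mxrow_mxcol !summxE mulr_sumr.
apply: (le_trans (ler_norm_sum _ _ _)); apply: ler_sum => l _.
by rewrite mulmxA.
Qed.

Lemma diag_sandwich_trace (R : realFieldType) n (P : 'M[R]_n) (r : 'rV[R]_n) :
  P^T = P -> \tr (P *m diag_mx r *m P *m diag_mx r) =
  \sum_i \sum_j r 0 i * r 0 j * P i j ^+ 2.
Proof.
move=> PT; have PC i j : P j i = P i j by rewrite -[in LHS]PT mxE.
rewrite /mxtrace; apply: eq_bigr => i _; rewrite mul_mx_diag mxE mxE mulr_suml.
by apply: eq_bigr => j _; rewrite mul_mx_diag mxE PC; ring.
Qed.

Lemma diag_bounded (R : realFieldType) n h (r : 'rV[R]_n) :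
  (forall i, `|r 0 i| <= h) -> quad_bounded h (diag_mx r).
Proof.
move=> hr y; rewrite mul_mx_diag !mxE mulr_sumr.
apply: (le_trans (ler_norm_sum _ _ _)); apply: ler_sum => i _.
rewrite !mxE (_ : y 0 i * r 0 i * y 0 i = r 0 i * y 0 i ^+ 2); last by ring.
by rewrite normrM (ger0_norm (sqr_ge0 _)) -expr2 ler_wpM2r// sqr_ge0.
Qed.

(** The signal block of a projection of rank q inherits these bounds from the rows
    of the projection. *)
Lemma signal_proj_diag (R : realFieldType) q p (x0 sigma : R) (A : 'M[R]_(q, p)) :
  base_cov x0 sigma A \in unitmx ->
  let P := signal_proj x0 sigma A in
  [/\ P^T = P, (forall i, 0 <= P i i),
      (forall i j, P i j ^+ 2 <= P i i * P j j),
      (forall i, \sum_j P i j ^+ 2 <= P i i) &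
      \tr P <= q%:R /\ (forall i, P i i <= 1)].
Proof.
move=> u P; pose B := base_map x0 sigma A; pose W := row_proj B.
have uB : B *m B^T \in unitmx by rewrite base_map_gram.
have WT : W^T = W by exact: row_proj_sym.
have WW : W *m W = W by exact: row_proj_idem.
have PE i j : P i j = W (lshift q i) (lshift q j).
  by rewrite /P -row_proj_ul /W !mxE.
have WC i j : W j i = W i j by rewrite -[in LHS]WT mxE.
have Wdot i j : W i j = \sum_k W i k * W j k.
  by rewrite -[in LHS]WW mxE; apply: eq_bigr => k _; rewrite (WC j).
have Wii i : W i i = \sum_k W i k ^+ 2.
  by rewrite Wdot; apply: eq_bigr => k _; rewrite expr2.
have Wii0 i : 0 <= W i i by rewrite Wii sumr_ge0// => k _; rewrite sqr_ge0.
have trW : \tr W = q%:R.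
  by rewrite /W /row_proj -mulmxA mxtrace_mulC -mulmxA mulVmx// mxtrace1.
split.
- by apply/matrixP => i j; rewrite mxE !PE WC.
- by move=> i; rewrite PE.
- move=> i j; rewrite !PE.
  set a := lshift q i; set b := lshift q j.
  (* Cauchy-Schwarz for the rows a and b of the projection *)
  have [Wb0|Wb0] := eqVneq (W b b) 0.
    have Wb k : W b k = 0.
      move: Wb0; rewrite Wii => /eqP; rewrite psumr_eq0 => [/allP h|l _]; last exact: sqr_ge0.
      by have /implyP/(_ isT) := h k (mem_index_enum _); rewrite sqrf_eq0 => /eqP.
    by rewrite WC Wb expr0n Wb0 mulr0.
  have : 0 <= \sum_k (W b b * W a k - W a b * W b k) ^+ 2.
    by apply: sumr_ge0 => k _; rewrite sqr_ge0.
  have -> : \sum_k (W b b * W a k - W a b * W b k) ^+ 2 =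
     W b b ^+ 2 * W a a - 2 * (W b b * W a b) * W a b + W a b ^+ 2 * W b b.
    rewrite [W a a]Wii [in X in _ - _ * X]Wdot [in X in _ + _ * X]Wii.
    rewrite !mulr_sumr -sumrB -big_split/=.
    by apply: eq_bigr => k _; ring.
  rewrite (_ : _ + _ = W b b * (W a a * W b b - W a b ^+ 2)); last by ring.
  by rewrite pmulr_rge0 ?lt_def ?Wb0 ?Wii0// subr_ge0.
- move=> i; rewrite PE Wii big_split_ord/=.
  rewrite (eq_bigr (fun j => W (lshift q i) (lshift q j) ^+ 2)); last by move=> j _; rewrite PE.
  by rewrite lerDl sumr_ge0// => k _; rewrite sqr_ge0.
split.
  rewrite -trW /mxtrace big_split_ord/= (eq_bigr (fun j => W (lshift q j) (lshift q j))).
    by rewrite lerDl sumr_ge0// => k _.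
  by move=> j _; rewrite PE.
move=> i; rewrite PE; set a := lshift q i.
  have : W a a ^+ 2 <= W a a.
    by rewrite [leRHS]Wii (bigD1 a)//= lerDl sumr_ge0// => k _; rewrite sqr_ge0.
  have := Wii0 a; nra.
Qed.

(** With S the covariance and a a column of A, S >= sigma^2 gives
    a^T S^-1 a <= |a|^2 / sigma^2. *)
Lemma signal_proj_le (R : realFieldType) q p (x0 sigma : R) (A : 'M[R]_(q, p)) i :
  base_cov x0 sigma A \in unitmx -> 0 < sigma ->
  signal_proj x0 sigma A i i <= x0 ^+ 2 / sigma ^+ 2 * \sum_k A k i ^+ 2.
Proof.
move=> u s0; set S := base_cov x0 sigma A.
(* v = S^-1 x0 a_i, for a_i the i-th column of A *)
pose v := invmx S *m (x0 *: col i A).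
have Sv : S *m v = x0 *: col i A by rewrite /v mulKVmx.
have PE : signal_proj x0 sigma A i i = x0 * ((col i A)^T *m v) 0 0.
  rewrite /signal_proj /v -scalemxAr -scalemxAr -mulmxA mxE [X in _ = x0 * X]mxE mulrA -expr2.
  congr (_ * _); rewrite -/S !mxE; apply: eq_bigr => k _; rewrite !mxE; congr (_ * _).
  by apply: eq_bigr => l _; rewrite !mxE.
clearbody v; set a := col i A in Sv PE *; set q2 := (a^T *m v) 0 0 in PE *.
have e1 : x0 * q2 = x0 ^+ 2 * ((A^T *m v)^T *m (A^T *m v)) 0 0 + sigma ^+ 2 * (v^T *m v) 0 0.
  have : (v^T *m (S *m v)) 0 0 = x0 * q2.
    rewrite Sv -scalemxAr mxE; congr (_ * _).
    by rewrite /q2 !mxE; apply: eq_bigr => k _; rewrite !mxE mulrC.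
  move=> <-.
  have -> : v^T *m (S *m v) =
      x0 ^+ 2 *: ((A^T *m v)^T *m (A^T *m v)) + sigma ^+ 2 *: (v^T *m v).
    rewrite /S /base_cov mulmxDl mulmxDr mul_scalar_mx -!scalemxAl -!scalemxAr.
    by rewrite trmx_mul trmxK !mulmxA.
  by rewrite [LHS]mxE [X in X + _]mxE [X in _ + X]mxE.
have n1 : 0 <= ((A^T *m v)^T *m (A^T *m v)) 0 0.
  by rewrite mxE sumr_ge0// => k _; rewrite mxE -expr2 sqr_ge0.
have n2 : 0 <= (v^T *m v) 0 0.
  by rewrite mxE sumr_ge0// => k _; rewrite mxE -expr2 sqr_ge0.
have n3 : 0 <= ((x0 / sigma *: a - sigma *: v)^T *m (x0 / sigma *: a - sigma *: v)) 0 0.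
  by rewrite mxE sumr_ge0// => k _; rewrite mxE -expr2 sqr_ge0.
have aE : (a^T *m a) 0 0 = \sum_k A k i ^+ 2.
  by rewrite mxE; apply: eq_bigr => k _; rewrite !mxE expr2.
have e3 : ((x0 / sigma *: a - sigma *: v)^T *m (x0 / sigma *: a - sigma *: v)) 0 0 =
  x0 ^+ 2 / sigma ^+ 2 * (a^T *m a) 0 0 - 2 * (x0 * q2) + sigma ^+ 2 * (v^T *m v) 0 0.
  rewrite /q2 !mxE !mulr_sumr -sumrB -big_split/=; apply: eq_bigr => k _.
  by rewrite !mxE; field; rewrite gt_eqF.
have n4 : 0 <= x0 ^+ 2 * ((A^T *m v)^T *m (A^T *m v)) 0 0 by rewrite mulr_ge0// sqr_ge0.
by move: n3; rewrite e3 PE -aE; lra.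
Qed.

Lemma base_cov_unit (R : realFieldType) q p (x0 sigma : R) (A : 'M[R]_(q, p)) :
  0 < sigma -> base_cov x0 sigma A \in unitmx.
Proof.
move=> s0; rewrite -row_free_unit -kermx_eq0; apply/eqP/row_matrixP => i.
rewrite row0; set v := row i _.
have vS : v *m base_cov x0 sigma A = 0.
  by rewrite /v -row_mul mulmx_ker row0.
have : (v *m base_cov x0 sigma A *m v^T) 0 0 = 0 by rewrite vS mul0mx mxE.
rewrite /base_cov mulmxDr mulmxDl mul_mx_scalar -!scalemxAr -!scalemxAl.
have -> : v *m (A *m A^T) *m v^T = (v *m A) *m (v *m A)^T by rewrite trmx_mul !mulmxA.
rewrite mxE [X in X + _]mxE [X in _ + X]mxE => e.
have n1 := dot_ge0 (v *m A); have n2 := dot_ge0 v.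
have := mulr_ge0 (sqr_ge0 x0) n1; have := mulr_ge0 (sqr_ge0 sigma) n2 => m2 m1.
have /eqP : sigma ^+ 2 * (v *m v^T) 0 0 = 0 by lra.
by rewrite mulf_eq0 sqrf_eq0 gt_eqF//= dot_eq0 => /eqP.
Qed.

(** * Second moments of isotropic random matrices *)

Definition bmeas (R : realType) d (T : measurableType d) (f : T -> R) :=
  measurable_fun setT f /\ exists K, forall x, `|f x| <= K.

Lemma bmeas_integrable (R : realType) d (T : measurableType d)
    (mu : probability T R) (f : T -> R) : bmeas f -> mu.-integrable setT (EFin \o f).
Proof.
move=> [mf [K fK]]; apply: measurable_bounded_integrable => //.
  by apply: (le_lt_trans (probability_le1 mu measurableT)); rewrite ltry.
exists K; split; first exact: num_real.
by move=> x Kx y _; apply: (le_trans (fK y)); exact: ltW.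
Qed.

Lemma bmeasD (R : realType) d (T : measurableType d) (f g : T -> R) :
  bmeas f -> bmeas g -> bmeas (fun x => f x + g x).
Proof.
move=> [mf [K fK]] [mg [H gH]]; split; first exact: measurable_funD.
by exists (K + H) => x; apply: (le_trans (ler_normD _ _)); exact: lerD.
Qed.

Lemma bmeasM (R : realType) d (T : measurableType d) (f g : T -> R) :
  bmeas f -> bmeas g -> bmeas (fun x => f x * g x).
Proof.
move=> [mf [K fK]] [mg [H gH]]; split; first exact: measurable_funM.
by exists (K * H) => x; rewrite normrM ler_pM.
Qed.

Lemma bmeas_cst (R : realType) d (T : measurableType d) (r : R) :
  bmeas (fun _ : T => r).
Proof. by split=> //; exists `|r|. Qed.

Lemma bmeasX (R : realType) d (T : measurableType d) (f : T -> R) k :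
  bmeas f -> bmeas (fun x => f x ^+ k).
Proof.
move=> bf; elim: k => [|k IH]; first exact: bmeas_cst.
by under eq_fun do rewrite exprS; exact: bmeasM.
Qed.

Lemma bmeas_sum (R : realType) d (T : measurableType d) (I : Type) (s : seq I)
    (f : I -> T -> R) :
  (forall i, bmeas (f i)) -> bmeas (fun x => \sum_(i <- s) f i x).
Proof.
move=> bf; elim: s => [|i s IH].
  by under eq_fun do rewrite big_nil; exact: bmeas_cst.
by under eq_fun do rewrite big_cons; exact: bmeasD.
Qed.

Lemma Rintegral_sum (R : realType) d (T : measurableType d) (mu : probability T R)
    (I : Type) (s : seq I) (f : I -> T -> R) : (forall i, bmeas (f i)) ->
  \int[mu]_x (\sum_(i <- s) f i x) = \sum_(i <- s) \int[mu]_x f i x.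
Proof.
move=> bf; elim: s => [|i s IH].
  under eq_Rintegral do rewrite big_nil.
  by rewrite big_nil Rintegral_cst// mul0r.
under eq_Rintegral do rewrite big_cons.
rewrite big_cons RintegralD// ?IH//; apply: bmeas_integrable => //.
exact: bmeas_sum.
Qed.

Lemma RintegralZ (R : realType) d (T : measurableType d) (mu : probability T R)
    (r : R) (f : T -> R) : bmeas f -> \int[mu]_x (r * f x) = r * \int[mu]_x f x.
Proof. by move=> bf; rewrite RintegralZl//; exact: bmeas_integrable. Qed.

Lemma EFin_Rintegral (R : realType) d (T : measurableType d) (mu : probability T R)
    (f : T -> R) : bmeas f -> (\int[mu]_x (f x)%:E)%E = (\int[mu]_x f x)%:E.
Proof.
move=> bf; rewrite /Rintegral fineK//.
exact: (integrable_fin_num measurableT (bmeas_integrable mu bf)).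
Qed.

Lemma Rintegral_le_cst (R : realType) d (T : measurableType d) (mu : probability T R)
    (f : T -> R) (K : R) : bmeas f -> (forall x, f x <= K) -> \int[mu]_x f x <= K.
Proof.
move=> bf fK; apply: (@le_trans _ _ (\int[mu]_x K)).
  apply: le_Rintegral => //; first exact: bmeas_integrable.
  by apply: bmeas_integrable; exact: bmeas_cst.
by rewrite Rintegral_cst//= probability_setT mulr1.
Qed.

Definition quad (R : realType) n (u : 'cV[R]_n) (P : 'M[R]_n) : R :=
  (u^T *m P *m u) 0 0.

Lemma quad_delta (R : realType) n (P : 'M[R]_n) i j (s : R) : P^T = P ->
  quad (delta_mx i 0 + s *: delta_mx j 0) P = P i i + s ^+ 2 * P j j + 2 * s * P i j.
Proof.
move=> PT.
have E k l : ((delta_mx k 0 : 'cV[R]_n)^T *m P *m (delta_mx l 0 : 'cV[R]_n)) 0 0 = P k l.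
  by rewrite trmx_delta -rowE -colE !mxE.
have PC : P j i = P i j by rewrite -[in LHS]PT mxE.
rewrite /quad [(_ + _)^T]raddfD/= trmxZ !mulmxDl !mulmxDr -!scalemxAl -!scalemxAr ?scalerA.
have F (A B C D : 'M[R]_1) a b c : (A + a *: B + (b *: C + c *: D)) 0 0 =
  A 0 0 + a * B 0 0 + (b * C 0 0 + c * D 0 0) by rewrite !mxE.
by rewrite F !E PC; ring.
Qed.

(** Polarization of the fourth-degree identity, at u = e_i + e_j and e_i - e_j. *)
Lemma isotropic_polarization (R : realType) d (T : measurableType d)
    (mu : probability T R) n (P : T -> 'M[R]_n) (alpha : R) :
  (forall t, (P t)^T = P t) -> (forall i j, bmeas (fun t => P t i j)) ->
  (forall u : 'cV[R]_n, \int[mu]_t (quad u (P t) ^+ 2) = alpha * ((u^T *m u) 0 0) ^+ 2) ->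
  forall i j, \int[mu]_t (P t i i * P t j j) + 2 * \int[mu]_t (P t i j ^+ 2) =
    alpha * (1 + 2 * (i == j)%:R).
Proof.
move=> PT bP H i j.
have norm2 s : i != j ->
    (((delta_mx i 0 + s *: delta_mx j 0 : 'cV[R]_n))^T *m
     (delta_mx i 0 + s *: delta_mx j 0 : 'cV[R]_n)) 0 0 = 1 + s ^+ 2.
  move=> ij; have := @quad_delta R n 1%:M i j s (trmx1 _ _).
  by rewrite /quad mulmx1 => ->; rewrite !mxE !eqxx (negbTE ij) !mulr1 mulr0 addr0.
have normi : ((delta_mx i 0 : 'cV[R]_n)^T *m (delta_mx i 0 : 'cV[R]_n)) 0 0 = 1.
  by rewrite trmx_delta mul_delta_mx mxE eqxx.
have quadi t : quad (delta_mx i 0) (P t) = P t i i.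
  by rewrite /quad trmx_delta -rowE -colE !mxE.
have Hi : \int[mu]_t (P t i i ^+ 2) = alpha.
  have := H (delta_mx i 0); rewrite normi expr1n mulr1 => <-.
  by apply: eq_Rintegral => t _; rewrite quadi.
have [<-|ij] := eqVneq i j.
  have -> : \int[mu]_t (P t i i * P t i i) = \int[mu]_t (P t i i ^+ 2).
    by apply: eq_Rintegral => t _; rewrite expr2.
  by rewrite Hi mulr1; ring.
have Hj : \int[mu]_t (P t j j ^+ 2) = alpha.
  have := H (delta_mx j 0); rewrite trmx_delta mul_delta_mx mxE eqxx expr1n mulr1 => <-.
  by apply: eq_Rintegral => t _; rewrite /quad trmx_delta -rowE -colE !mxE.
have bq u : bmeas (fun t => quad u (P t) ^+ 2).
  apply: bmeasX; rewrite /quad; under eq_fun do rewrite mxE.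
  apply: bmeas_sum => k; apply: bmeasM; last exact: bmeas_cst.
  by under eq_fun do rewrite mxE; apply: bmeas_sum => l; apply: bmeasM => //; exact: bmeas_cst.
have sumE : \int[mu]_t (quad (delta_mx i 0 + 1 *: delta_mx j 0) (P t) ^+ 2) +
            \int[mu]_t (quad (delta_mx i 0 + (-1) *: delta_mx j 0) (P t) ^+ 2) =
  2 * \int[mu]_t (P t i i ^+ 2) + 2 * \int[mu]_t (P t j j ^+ 2) +
  4 * \int[mu]_t (P t i i * P t j j) + 8 * \int[mu]_t (P t i j ^+ 2).
  have b1 : bmeas (fun t => P t i i ^+ 2) by exact: bmeasX.
  have b2 : bmeas (fun t => P t j j ^+ 2) by exact: bmeasX.
  have b3 : bmeas (fun t => P t i i * P t j j) by exact: bmeasM.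
  have b4 : bmeas (fun t => P t i j ^+ 2) by exact: bmeasX.
  have bZ (r : R) f : bmeas f -> bmeas (fun t : T => r * f t).
    by move=> bf; apply: bmeasM => //; exact: bmeas_cst.
  rewrite -!RintegralZ// -!RintegralD//; do ?[by apply: bmeas_integrable; do ?apply: bmeasD; try exact: bZ; try exact: bq].
  by apply: eq_Rintegral => t _; rewrite !quad_delta//; ring.
move: sumE; rewrite !H !norm2// Hi Hj mulr0 addr0 mulr1 => sumE.
by lra.
Qed.

(** Sum [isotropic_polarization] over all pairs of indices. *)
Lemma isotropic_total (R : realType) d (T : measurableType d)
    (mu : probability T R) n (P : T -> 'M[R]_n) (alpha : R) :
  (forall t, (P t)^T = P t) -> (forall i j, bmeas (fun t => P t i j)) ->
  (forall u : 'cV[R]_n, \int[mu]_t (quad u (P t) ^+ 2) = alpha * ((u^T *m u) 0 0) ^+ 2) ->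
  n%:R * (n%:R + 2) * alpha =
  \int[mu]_t ((\tr (P t)) ^+ 2 + 2 * \sum_i \sum_j P t i j ^+ 2).
Proof.
move=> PT bP H.
have bPP i j : bmeas (fun t => P t i i * P t j j) by exact: bmeasM.
have bP2 i j : bmeas (fun t => P t i j ^+ 2) by exact: bmeasX.
have bS1 i : bmeas (fun t => \sum_j P t i i * P t j j) by exact: bmeas_sum.
have bS2 i : bmeas (fun t => \sum_j P t i j ^+ 2) by exact: bmeas_sum.
transitivity (\int[mu]_t (\sum_i \sum_j P t i i * P t j j) +
    2 * \int[mu]_t (\sum_i \sum_j P t i j ^+ 2)); last first.
  rewrite -RintegralZ; last exact: bmeas_sum.
  rewrite -RintegralD//.
  - by apply: eq_Rintegral => t _; rewrite expr2 {1}/mxtrace mulr_suml; congr (_ + _);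
      apply: eq_bigr => i _; rewrite /mxtrace mulr_sumr.
  - by apply: bmeas_integrable; exact: bmeas_sum.
  - by apply: bmeas_integrable; apply: bmeasM; [exact: bmeas_cst|exact: bmeas_sum].
rewrite !Rintegral_sum// mulr_sumr -big_split/=.
transitivity (\sum_(i < n) \sum_(j < n) (alpha * (1 + 2 * (i == j)%:R))).
  transitivity (\sum_(i < n) (alpha * (n%:R + 2))).
    by rewrite sumr_const card_ord -[_ *+ n]mulr_natl; ring.
  apply: eq_bigr => i _; rewrite -mulr_sumr big_split/= sumr_const card_ord.
  rewrite -mulr_sumr (bigD1 i)//= eqxx big1 ?addr0 ?mulr1// => j ji.
  by rewrite eq_sym (negbTE ji).
apply: eq_bigr => i _; rewrite !Rintegral_sum// mulr_sumr -big_split/=.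
by apply: eq_bigr => j _; rewrite (isotropic_polarization PT bP H).
Qed.

(** Since r sums to 0, the off-diagonal terms contribute - beta |r|^2 <= 0. *)
Lemma isotropic_balanced (R : realType) d (T : measurableType d)
    (mu : probability T R) n (P : T -> 'M[R]_n) (alpha beta : R) (r : 'rV[R]_n) :
  (forall i j, bmeas (fun t => P t i j)) ->
  (forall i, \int[mu]_t (P t i i ^+ 2) = alpha) ->
  (forall i j, i != j -> \int[mu]_t (P t i j ^+ 2) = beta) ->
  \sum_i r 0 i = 0 ->
  \int[mu]_t (\sum_i \sum_j r 0 i * r 0 j * P t i j ^+ 2) <=
    alpha * \sum_i r 0 i ^+ 2.
Proof.
move=> bP Ha Hb r0.
have bP2 i j : bmeas (fun t => P t i j ^+ 2) by exact: bmeasX.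
have bc i j : bmeas (fun t => r 0 i * r 0 j * P t i j ^+ 2).
  by apply: bmeasM => //; exact: bmeas_cst.
have [n1|n1] := leqP n 1.
  have rE i : r 0 i = 0.
    rewrite -[RHS]r0 (bigD1 i)//= big1 ?addr0// => j /eqP ji; exfalso; apply: ji.
    have ord_eq0 (k : 'I_n) : (k : nat) = 0%N.
      by apply/eqP; rewrite -leqn0 -ltnS (leq_trans (ltn_ord k)).
    by apply/val_inj; rewrite /= !ord_eq0.
  rewrite big1 ?mulr0 => [|i _]; last by rewrite rE expr0n.
  rewrite Rintegral_sum; last by move=> i; exact: bmeas_sum.
  rewrite big1// => i _; rewrite Rintegral_sum// big1// => j _.
  by rewrite RintegralZ// rE !mul0r.
have b0 : 0 <= beta.
  rewrite -(Hb (Ordinal (ltn_trans (ltn0Sn 0) n1)) (Ordinal n1))//.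
  by apply: Rintegral_ge0 => t _; rewrite sqr_ge0.
rewrite Rintegral_sum; last by move=> i; exact: bmeas_sum.
have -> : \sum_i \int[mu]_t (\sum_j r 0 i * r 0 j * P t i j ^+ 2) =
    \sum_i ((alpha - beta) * r 0 i ^+ 2).
  apply: eq_bigr => i _; rewrite Rintegral_sum//.
  rewrite (eq_bigr (fun j => r 0 i * r 0 j * (beta + (alpha - beta) * (i == j)%:R))); last first.
    move=> j _; rewrite RintegralZ//; congr (_ * _); have [<-|ij] := eqVneq i j.
      by rewrite Ha mulr1; ring.
    by rewrite Hb// mulr0 addr0.
  transitivity (r 0 i * beta * (\sum_j r 0 j) +
     \sum_j ((alpha - beta) * (r 0 i * r 0 j) * (i == j)%:R)).
    by rewrite mulr_sumr -big_split/=; apply: eq_bigr => j _; ring.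
  rewrite r0 mulr0 add0r (bigD1 i)//= eqxx big1 ?addr0.
    by rewrite mulr1 expr2.
  by move=> j ji; rewrite eq_sym (negbTE ji) mulr0.
rewrite -mulr_sumr ler_wpM2r//; first by apply: sumr_ge0 => i _; rewrite sqr_ge0.
by rewrite gerBl.
Qed.

(** * Gaussian sensing matrices *)

Definition std_normal_law (R : realType) p q (mu : probability 'M[R]_(p, q) R) :=
  forall S : 'I_p -> 'I_q -> set R, (forall i j, measurable (S i j)) ->
  mu (box S) = (\prod_(ij : 'I_p * 'I_q) gauss1 R (S ij.1 ij.2))%E.

Definition mx_of_cV (R : realType) p q (v : 'cV[R]_(p * q)) : 'M[R]_(p, q) :=
  vec_mx v^T.

Lemma mx_of_cVE (R : realType) p q (v : 'cV[R]_(p * q)) i j :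
  mx_of_cV v i j = v (mxvec_index i j) 0.
Proof. by rewrite /mx_of_cV mxE mxE. Qed.

Lemma measurable_mx_of_cV (R : realType) p q :
  measurable_fun setT (@mx_of_cV R p q).
Proof.
apply/measurable_mxP => i j; under eq_fun do rewrite mx_of_cVE.
exact: measurable_entry.
Qed.

HB.instance Definition _ (R : realType) p q :=
  isMeasurableFun.Build _ _ _ _ (@mx_of_cV R p q) (@measurable_mx_of_cV R p q).

Lemma std_normal_law_integral (R : realType) p q (mu : probability 'M[R]_(p, q) R)
    (f : 'M[R]_(p, q) -> \bar R) : std_normal_law mu ->
  measurable_fun [set: 'M[R]_(p, q)] f -> (forall A, (0 <= f A)%E) ->
  (\int[mu]_A f A = \int[gauss R (p * q)]_v f (mx_of_cV v))%E.
Proof.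
move=> hmu mf f0.
have muE : forall B, measurable B ->
    mu B = distribution (gauss R (p * q)) (@mx_of_cV R p q : {mfun _ >-> _}) B.
  apply: mx_law_unique => S mS; rewrite (hmu S mS).
  pose S' k := S (enum_val (cast_ord (esym (mxvec_cast p q)) k)).1
                 (enum_val (cast_ord (esym (mxvec_cast p q)) k)).2.
  have S'E i l : S' (mxvec_index i l) = S i l by rewrite /S' cast_ordK enum_rankK.
  have E : (@mx_of_cV R p q) @^-1` box S = box (fun k (_ : 'I_1) => S' k).
    apply/seteqP; split=> v /= h.
      move=> k j; rewrite (ord1 j); case/mxvec_indexP: k => i l.
      by rewrite S'E -mx_of_cVE; exact: h.
    move=> i l; rewrite mx_of_cVE; have := h (mxvec_index i l) 0.
    by rewrite S'E.
  transitivity (gauss R (p * q) (box (fun k (_ : 'I_1) => S' k))); last by rewrite -E.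
  rewrite gauss_box; last by move=> k; exact: mS.
  rewrite [RHS](reindex (uncurry (@mxvec_index p q))) /=; last first.
    have [g gK Kg] := curry_mxvec_bij p q.
    by exists g => x _; [exact: gK|exact: Kg].
  by apply: eq_bigr => -[i l] _ /=; rewrite S'E.
transitivity (\int[distribution (gauss R (p * q)) (@mx_of_cV R p q : {mfun _ >-> _})]_A f A)%E.
  by apply: eq_measure_integral => A mA _; exact: muE.
exact: ge0_integral_distribution.
Qed.

(** Read as a vector, A O is the image of A by an isometry. *)
Lemma std_normal_right_invariant (R : realType) p q (mu : probability 'M[R]_(p, q) R)
    (O : 'M[R]_q) (f : 'M[R]_(p, q) -> \bar R) : std_normal_law mu ->
  O *m O^T = 1%:M ->
  measurable_fun [set: 'M[R]_(p, q)] f -> (forall A, (0 <= f A)%E) ->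
  (\int[mu]_A f (A *m O) = \int[mu]_A f A)%E.
Proof.
move=> hmu OO mf f0.
have mfO : measurable_fun [set: 'M[R]_(p, q)] (fun A => f (A *m O)).
  apply: (measurableT_comp mf); apply: (measurable_mulmx (A := id) (B := fun=> O)).
    exact: measurable_id.
  exact: measurable_cst.
apply: etrans (std_normal_law_integral hmu mfO (fun A => f0 _)) _.
apply: etrans _ (esym (std_normal_law_integral hmu mf f0)).
pose K : 'M[R]_(p * q) := (lin_mulmxr O)^T.
have Kv v : mx_of_cV (K *m v) = mx_of_cV v *m O.
  by rewrite /mx_of_cV trmx_mul trmxK mul_rV_lin mxvecK.
have KT : K^T = lin_mulmxr O by rewrite trmxK.
have KE : K = lin_mulmxr O^T.
  apply/matrixP => k l; case/mxvec_indexP: k => i j; case/mxvec_indexP: l => i' j'.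
  rewrite /K mxE !mxE !mxvecE /= !mxE !vec_mx_delta.
  rewrite (bigD1 j')//= [RHS](bigD1 j)//= !mxE !eqxx [i' == i]eq_sym !big1 ?addr0//.
  - by move=> k kj; rewrite mxE (negbTE kj) andbF mul0r.
  - by move=> k kj; rewrite mxE (negbTE kj) andbF mul0r.
have KK : K^T *m K = 1%:M.
  rewrite KT KE; apply/row_matrixP => k; rewrite row_mul rowE !mul_rV_lin.
  by rewrite /= mxvecK -mulmxA OO mulmx1 vec_mxK [RHS]rowE mulmx1.
have mfv : measurable_fun [set: 'cV[R]_(p * q)] (fun v => f (mx_of_cV v)).
  by apply: (measurableT_comp mf); exact: measurable_mx_of_cV.
rewrite -(gauss_orthogonal KK mfv (fun v => f0 _)).
by apply: eq_integral => v _; rewrite Kv.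
Qed.

Lemma measurable_inv (R : realType) d (T : measurableType d) (f : T -> R) :
  measurable_fun setT f -> measurable_fun setT (fun t => (f t)^-1).
Proof.
move=> mf; rewrite (_ : (fun t => (f t)^-1) = (fun t => f t * (f t ^+ 2) `^ (-1))).
  apply: measurable_funM => //.
  apply: (measurableT_comp (measurable_powR _)).
  exact: measurable_funX.
apply/funext => t; rewrite powR_inv1 ?sqr_ge0//.
have [->|f0] := eqVneq (f t) 0; first by rewrite invr0 mul0r.
by field.
Qed.

Lemma measurable_det (R : realType) d (T : measurableType d) n (M : T -> 'M[R]_n) :
  measurable_fun setT M -> measurable_fun setT (fun t => \det (M t)).
Proof.
move=> /measurable_mxP mM; rewrite /determinant; apply: measurable_sum => s.
by apply: measurable_funM => //; apply: measurable_prod => i _.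
Qed.

Lemma measurable_adj (R : realType) d (T : measurableType d) n (M : T -> 'M[R]_n) :
  measurable_fun setT M -> measurable_fun setT (fun t => \adj (M t)).
Proof.
move=> mM; apply/measurable_mxP => i j; under eq_fun do rewrite mxE /cofactor.
apply: measurable_funM => //; apply: measurable_det; apply/measurable_mxP => k l.
by under eq_fun do rewrite !mxE; move/measurable_mxP : mM; exact.
Qed.

Lemma measurable_trmx (R : realType) d (T : measurableType d) m n (M : T -> 'M[R]_(m, n)) :
  measurable_fun setT M -> measurable_fun setT (fun t => (M t)^T).
Proof.
move=> /measurable_mxP mM; apply/measurable_mxP => i j.
by under eq_fun do rewrite mxE; exact: mM.
Qed.

Lemma measurable_base_cov (R : realType) q p (x0 sigma : R) :
  measurable_fun setT (@base_cov R q p x0 sigma).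
Proof.
apply/measurable_mxP => i j; under eq_fun do rewrite !mxE.
apply: measurable_funD => //; apply: measurable_funM => //.
apply: measurable_sum => k; under eq_fun do rewrite mxE.
by apply: measurable_funM; exact: measurable_entry.
Qed.

(** [signal_proj], extended by 0 to singular covariances; the formula is Cramer's
    rule, because the inverse of 0 is 0. *)
Definition signal_proj0 (R : realType) q p (x0 sigma : R) (A : 'M[R]_(q, p)) : 'M[R]_p :=
  (\det (base_cov x0 sigma A))^-1 *:
    ((x0 ^+ 2) *: (A^T *m \adj (base_cov x0 sigma A) *m A)).

Lemma signal_proj0E (R : realType) q p (x0 sigma : R) (A : 'M[R]_(q, p)) :
  signal_proj0 x0 sigma A =
  if base_cov x0 sigma A \in unitmx then signal_proj x0 sigma A else 0.
Proof.
rewrite /signal_proj0 /signal_proj; case: ifPn => [u|].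
  by rewrite /invmx u -scalemxAr -scalemxAl !scalerA mulrC.
by rewrite unitmxE unitfE negbK => /eqP->; rewrite invr0 scale0r.
Qed.

Lemma measurable_signal_proj0 (R : realType) q p (x0 sigma : R) :
  measurable_fun setT (@signal_proj0 R q p x0 sigma).
Proof.
have mS := @measurable_base_cov R q p x0 sigma.
have mid := @measurable_id _ 'M[R]_(q, p) setT.
have mP : measurable_fun [set: 'M[R]_(q, p)]
    (fun A => A^T *m \adj (base_cov x0 sigma A) *m A).
  apply: measurable_mulmx => //; apply: measurable_mulmx; first exact: measurable_trmx.
  exact: measurable_adj.
apply/measurable_mxP => i j; under eq_fun do rewrite mxE [X in _ * X]mxE.
apply: measurable_funM; first by apply: measurable_inv; exact: measurable_det.
by apply: measurable_funM => //; move/measurable_mxP : mP; exact.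
Qed.

Lemma signal_proj0_facts (R : realType) q p (x0 sigma : R) (A : 'M[R]_(q, p)) :
  let P := signal_proj0 x0 sigma A in
  [/\ P^T = P, (forall i, 0 <= P i i),
      (forall i j, P i j ^+ 2 <= P i i * P j j),
      (forall i, \sum_j P i j ^+ 2 <= P i i) &
      \tr P <= q%:R /\ (forall i, P i i <= 1)].
Proof.
rewrite /= signal_proj0E; case: ifPn => [u|_]; first exact: signal_proj_diag.
split; [exact: trmx0|by move=> i; rewrite mxE|by move=> i j; rewrite !mxE expr0n mulr0| |].
  by move=> i; rewrite big1 => [|j _]; rewrite !mxE// expr0n.
by rewrite mxtrace0; split=> // i; rewrite mxE.
Qed.

Lemma signal_proj0_rot (R : realType) q p (x0 sigma : R) (A : 'M[R]_(q, p)) (O : 'M[R]_p) :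
  O *m O^T = 1%:M ->
  signal_proj0 x0 sigma (A *m O) = O^T *m signal_proj0 x0 sigma A *m O.
Proof.
move=> OO; have e : base_cov x0 sigma (A *m O) = base_cov x0 sigma A.
  by rewrite /base_cov trmx_mul mulmxA -(mulmxA A) OO mulmx1.
rewrite /signal_proj0 e trmx_mul -!scalemxAr -!scalemxAl !scalerA.
by rewrite !mulmxA.
Qed.

Lemma bmeas_signal_proj0 (R : realType) q p (x0 sigma : R) i j :
  bmeas (fun A : 'M[R]_(q, p) => signal_proj0 x0 sigma A i j).
Proof.
split; first by have /measurable_mxP := @measurable_signal_proj0 R q p x0 sigma; exact.
exists 1 => A; have [_ P0 CS _ [_ P1]] := signal_proj0_facts x0 sigma A.
rewrite -(expr_le1 (n := 2))// real_normK ?num_real//.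
apply: (le_trans (CS i j)); rewrite -[leRHS]mulr1; apply: ler_pM => //.
Qed.

(** * Rotation invariance of the second moments *)

Definition bilin (R : realType) n (u v : 'rV[R]_n) (P : 'M[R]_n) : R := (u *m P *m v^T) 0 0.

Lemma quad_bilin (R : realType) n (u : 'cV[R]_n) (P : 'M[R]_n) : quad u P = bilin u^T u^T P.
Proof. by rewrite /quad /bilin trmxK. Qed.

Lemma bilin_delta (R : realType) n (P : 'M[R]_n) i j :
  bilin (delta_mx 0 i) (delta_mx 0 j) P = P i j.
Proof. by rewrite /bilin trmx_delta -rowE -colE !mxE. Qed.

Lemma bmeas_bilin (R : realType) q n (x0 sigma : R) (u v : 'rV[R]_n) :
  bmeas (fun A : 'M[R]_(q, n) => bilin u v (signal_proj0 x0 sigma A)).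
Proof.
rewrite /bilin; under eq_fun do rewrite mxE.
apply: bmeas_sum => k; apply: bmeasM; last exact: bmeas_cst.
under eq_fun do rewrite mxE; apply: bmeas_sum => l; apply: bmeasM.
  exact: bmeas_cst.
exact: bmeas_signal_proj0.
Qed.

(** By rotation invariance the law of u P v^T depends only on the Gram matrix of
    (u, v). *)
Lemma signal_proj0_bilin (R : realType) q n (mu : probability 'M[R]_(q, n) R)
    (x0 sigma : R) (u v u' v' : 'rV[R]_n) : std_normal_law mu ->
  u *m u^T = u' *m u'^T -> u *m v^T = u' *m v'^T -> v *m v^T = v' *m v'^T ->
  \int[mu]_A (bilin u v (signal_proj0 x0 sigma A) ^+ 2) =
  \int[mu]_A (bilin u' v' (signal_proj0 x0 sigma A) ^+ 2).
Proof.
move=> hmu uu uv vv.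
have [ O OO E] : exists2 O, O *m O^T = 1%:M & col_mx u v *m O = col_mx u' v'.
  apply: gram_orthogonal; rewrite !tr_col_mx !mul_col_row uu uv vv; congr block_mx.
  by rewrite -[LHS]trmxK trmx_mul trmxK uv trmx_mul trmxK.
move: E; rewrite mul_col_mx => /eq_col_mx[<- <-].
have OO' : O^T *m O^T^T = 1%:M by rewrite trmxK; exact: orthogonal_tr.
have b2 := bmeasX 2 (bmeas_bilin q x0 sigma u v).
have rot A : bilin (u *m O) (v *m O) (signal_proj0 x0 sigma A) =
             bilin u v (signal_proj0 x0 sigma (A *m O^T)).
  by rewrite signal_proj0_rot// trmxK /bilin trmx_mul !mulmxA.
rewrite /Rintegral; congr fine; under [RHS]eq_integral do rewrite rot.
have mb : measurable_fun setT
    (fun A : 'M[R]_(q, n) => (bilin u v (signal_proj0 x0 sigma A) ^+ 2)%:E).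
  by apply/measurable_EFinP; exact: b2.1.
symmetry; apply: (std_normal_right_invariant hmu OO' mb) => A.
by rewrite lee_fin sqr_ge0.
Qed.

Lemma std_normal_entry (R : realType) p q (mu : probability 'M[R]_(p, q) R) i j
    (f : R -> \bar R) : std_normal_law mu ->
  measurable_fun [set: R] f -> (forall x, (0 <= f x)%E) ->
  (\int[mu]_A f (A i j) = \int[gauss1 R]_x f x)%E.
Proof.
move=> hmu mf f0.
pose h : {mfun 'M[R]_(p, q) >-> R} := mfun_Sub (mem_set (@measurable_entry R p q i j)).
transitivity (\int[distribution mu h]_x f x)%E.
  by rewrite ge0_integral_distribution.
apply: eq_measure_integral => B mB _ /=.
pose S k l : set R := if (k == i) && (l == j) then B else setT.
have -> : distribution mu h B = mu (box S).
  rewrite /distribution/= /pushforward; congr (mu _); apply/seteqP; split=> A /=.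
    by move=> hA k l; rewrite /S; case: ifPn => // /andP[/eqP-> /eqP->].
  by move=> /(_ i j); rewrite /S !eqxx.
rewrite hmu; last by move=> k l; rewrite /S; case: ifP.
rewrite (bigD1 (i, j))//= {1}/S !eqxx/= big1 ?mule1// => -[k l] kl.
by rewrite /S/= -[_ && _]/((k, l) == (i, j)) (negbTE kl) probability_setT.
Qed.

Lemma sqr_sum_le (R : realFieldType) q (b : 'I_q -> R) :
  (\sum_k b k) ^+ 2 <= q%:R * \sum_k b k ^+ 2.
Proof.
have : 0 <= \sum_k \sum_l (b k - b l) ^+ 2.
  by apply: sumr_ge0 => k _; apply: sumr_ge0 => l _; rewrite sqr_ge0.
have -> : \sum_k \sum_l (b k - b l) ^+ 2 =
    \sum_k (q%:R * b k ^+ 2 + \sum_l b l ^+ 2 - 2 * (b k * \sum_l b l)).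
  apply: eq_bigr => k _.
  rewrite (eq_bigr (fun l => b k ^+ 2 + b l ^+ 2 - 2 * b k * b l)); last first.
    by move=> l _; ring.
  by rewrite sumrB big_split/= sumr_const card_ord -mulr_sumr -[_ *+ q]mulr_natl; ring.
rewrite sumrB big_split/= -!mulr_sumr -mulr_suml -expr2 sumr_const card_ord -mulr_natl.
by lra.
Qed.

(** [alpha] is the common second moment of the diagonal entries: its first bound
    comes from the trace, its second one from the size of the entries of A. *)
Lemma signal_proj0_second_moment (R : realType) q n (mu : probability 'M[R]_(q, n) R)
    (x0 sigma : R) : std_normal_law mu -> (0 < q)%N -> (0 < n)%N -> 0 < x0 ->
  exists alpha : R,
  [/\ forall r : 'rV[R]_n, \sum_i r 0 i = 0 ->
       \int[mu]_A (\sum_i \sum_j r 0 i * r 0 j * signal_proj0 x0 sigma A i j ^+ 2)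
         <= alpha * \sum_i r 0 i ^+ 2,
     alpha <= 3 * q%:R ^+ 2 / n%:R ^+ 2 &
     0 < sigma -> alpha <= 200 * x0 ^+ 4 * q%:R ^+ 2 / sigma ^+ 4].
Proof.
move=> hmu q0 n0 x00; pose i0 := Ordinal n0.
pose P (A : 'M[R]_(q, n)) : 'M[R]_n := signal_proj0 x0 sigma A.
have PE (A : 'M[R]_(q, n)) := signal_proj0_facts x0 sigma A.
have bP i j : bmeas (fun A => P A i j) by exact: bmeas_signal_proj0.
have PT A : (P A)^T = P A by have [] := PE A.
pose alpha := \int[mu]_A (P A i0 i0 ^+ 2).
have delta_dot i j : (delta_mx 0 i : 'rV[R]_n) *m (delta_mx 0 j : 'rV[R]_n)^T =
    (i == j)%:R%:M.
  rewrite trmx_delta mul_delta_mx_cond; apply/matrixP => a b; rewrite !ord1 [RHS]mxE.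
  by rewrite eqxx mulr1n; case: (i == j); rewrite ?mulr1n ?mulr0n mxE ?eqxx.
have H (u : 'cV[R]_n) : \int[mu]_A (quad u (P A) ^+ 2) = alpha * ((u^T *m u) 0 0) ^+ 2.
  set c := (u^T *m u) 0 0.
  have c0 : 0 <= c by have := dot_ge0 u^T; rewrite trmxK.
  pose s := Num.sqrt c.
  have ss : s * s = c by rewrite -expr2 sqr_sqrtr.
  have uu : u^T *m u^T^T = (s *: delta_mx 0 i0) *m (s *: delta_mx 0 i0)^T.
    rewrite trmxZ -scalemxAl -scalemxAr scalerA delta_dot eqxx ss.
    by rewrite trmxK [LHS]mx11_scalar scale_scalar_mx mulr1.
  under eq_Rintegral do rewrite quad_bilin.
  rewrite (signal_proj0_bilin x0 sigma hmu uu uu uu).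
  rewrite mulrC -RintegralZ; last exact: bmeasX.
  apply: eq_Rintegral => A _; rewrite /bilin trmxZ -scalemxAr -!scalemxAl.
  by rewrite scalerA ss mxE -/(bilin _ _ _) bilin_delta exprMn.
have PB i j : \int[mu]_A (P A i j ^+ 2) =
    \int[mu]_A (bilin (delta_mx 0 i) (delta_mx 0 j) (signal_proj0 x0 sigma A) ^+ 2).
  by apply: eq_Rintegral => A _; rewrite bilin_delta.
have Pii i : \int[mu]_A (P A i i ^+ 2) = alpha.
  by rewrite /alpha !PB; apply: (signal_proj0_bilin x0 sigma hmu); rewrite !delta_dot !eqxx.
have [beta Pij] : exists beta, forall i j, i != j -> \int[mu]_A (P A i j ^+ 2) = beta.
  have [[[k l] /= kl]|no] := pselect (exists kl : 'I_n * 'I_n, kl.1 != kl.2); last first.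
    by exists 0 => i j ij; exfalso; apply: no; exists (i, j).
  exists (\int[mu]_A (P A k l ^+ 2)) => i j ij.
  rewrite !PB; apply: (signal_proj0_bilin x0 sigma hmu); rewrite !delta_dot ?eqxx//.
  by rewrite (negbTE ij) (negbTE kl).
exists alpha; split.
- by move=> r r0; exact: (isotropic_balanced bP Pii Pij r0).
- have nR : 0 < n%:R :> R by rewrite ltr0n.
  have qR : 1 <= q%:R :> R by rewrite ler1n.
  have total := isotropic_total PT bP H.
  have : n%:R * (n%:R + 2) * alpha <= 3 * q%:R ^+ 2.
    rewrite total; apply: Rintegral_le_cst => [|A].
      apply: bmeasD; first by apply: bmeasX; exact: bmeas_sum.
      apply: bmeasM; first exact: bmeas_cst.
      by apply: bmeas_sum => i; apply: bmeas_sum => j; exact: bmeasX.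
    have [_ P0 _ Prow [Ptr _]] := PE A.
    have tr0 : 0 <= \tr (P A) by apply: sumr_ge0 => i _; exact: P0.
    have S : \sum_i \sum_j P A i j ^+ 2 <= \tr (P A) by apply: ler_sum => i _; exact: Prow.
    have T2 : \tr (P A) ^+ 2 <= q%:R ^+ 2 by rewrite ler_sqr// nnegrE.
    rewrite -/(P A) in Ptr.
    have : q%:R <= q%:R ^+ 2 :> R by rewrite expr2 ler_peMr// ltW// (lt_le_trans ltr01).
    by lra.
  have a0 : 0 <= alpha by apply: Rintegral_ge0 => A _; rewrite sqr_ge0.
  move=> le3; rewrite ler_pdivlMr ?exprn_gt0//; apply: le_trans le3.
  rewrite mulrC expr2; apply: ler_wpM2r => //; apply: ler_wpM2l; first exact: ltW.
  by rewrite lerDl.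
- move=> s0; have s40 : 0 < sigma ^+ 4 by rewrite exprn_gt0.
  rewrite -lee_fin -EFin_Rintegral; last exact: bmeasX.
  pose C := x0 ^+ 4 / sigma ^+ 4 * q%:R.
  have C0 : 0 <= C by rewrite !mulr_ge0 ?invr_ge0// ltW// exprn_gt0.
  have bd A : P A i0 i0 ^+ 2 <= C * \sum_k A k i0 ^+ 4.
    have := signal_proj_le i0 (base_cov_unit x0 A s0) s0.
    have -> : signal_proj x0 sigma A = P A.
      by rewrite /P signal_proj0E (base_cov_unit x0 A s0).
    have [_ /(_ i0) P0 _ _ _] := PE A; rewrite -/(P A) in P0.
    move=> le1; apply: (@le_trans _ _ ((x0 ^+ 2 / sigma ^+ 2 * \sum_k A k i0 ^+ 2) ^+ 2)).
      by rewrite ler_sqr ?nnegrE// (le_trans P0).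
    have -> : (x0 ^+ 2 / sigma ^+ 2 * \sum_k A k i0 ^+ 2) ^+ 2 =
        x0 ^+ 4 / sigma ^+ 4 * (\sum_k A k i0 ^+ 2) ^+ 2.
      by rewrite exprMn expr_div_n -!exprM.
    rewrite [leRHS](_ : _ = x0 ^+ 4 / sigma ^+ 4 * (q%:R * \sum_k A k i0 ^+ 4)); last first.
      by rewrite /C -!mulrA.
    apply: ler_wpM2l; first by rewrite mulr_ge0 ?invr_ge0// ltW// exprn_gt0.
    have := sqr_sum_le (fun k => A k i0 ^+ 2).
    by under [X in _ <= _ * X]eq_bigr do rewrite -exprM.
  have m4 k : measurable_fun [set: 'M[R]_(q, n)] (fun A : 'M[R]_(q, n) => (A k i0 ^+ 4)%:E).
    by apply/measurable_EFinP; apply: measurable_funX; exact: measurable_entry.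
  have p4 k (A : 'M[R]_(q, n)) : (0 <= (A k i0 ^+ 4)%:E)%E.
    by rewrite lee_fin exprn_even_ge0.
  apply: (@le_trans _ _ (\int[mu]_A (C%:E * \sum_k (A k i0 ^+ 4)%:E))%E).
    apply: ge0_le_integral => //.
    - by move=> A _; rewrite lee_fin sqr_ge0.
    - by apply/measurable_EFinP; have [] := bmeasX 2 (bP i0 i0).
    - by apply: measurable_funeM; exact: emeasurable_sum.
    - by move=> A _; rewrite sumEFin -EFinM lee_fin.
  rewrite ge0_integralZl//; last 2 first.
  - exact: emeasurable_sum.
  - by move=> A _; apply: sume_ge0.
  rewrite ge0_integral_sum//.
  apply: (@le_trans _ _ (C%:E * \sum_(k < q) 200%:E)%E).
    apply: lee_wpmul2l; first by rewrite lee_fin.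
    apply: lee_sum => k _; have m4' : measurable_fun [set: R] (fun x : R => (x ^+ 4)%:E).
      by apply/measurable_EFinP; exact: measurable_funX.
    rewrite (std_normal_entry (f := fun x => (x ^+ 4)%:E) k i0 hmu m4'); last first.
      by move=> x; rewrite lee_fin exprn_even_ge0.
    exact: gauss1_moment4.
  rewrite sumEFin sumr_const card_ord -EFinM lee_fin -[200 *+ q]mulr_natr /C.
  rewrite le_eqVlt; apply/orP; left; apply/eqP; rewrite expr2; ring.
Qed.

Lemma gauss1_finite (R : realType) (S : set R) : finite_set S -> gauss1 R S = 0%E.
Proof.
move=> fS; rewrite gauss1E.
have /null_content_dominatesP dom := normal_prob_dominates (0 : R) 1.
have cS : countable S by exact: finite_set_countable.
have mS : measurable S := countable_measurable (fun t => measurable_set1 t) cS.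
apply: dom => //.
exact: countable_lebesgue_measure0.
Qed.

(** After rotating the direction J onto the first axis, the sections of the set are
    finite, hence null, and Fubini applies. *)
Lemma gauss_null_line (R : realType) N (S : set 'cV[R]_N) (J : 'cV[R]_N) :
  J != 0 -> measurable S ->
  (forall v, finite_set [set t : R | S (v + t *: J)]) -> gauss R N S = 0%E.
Proof.
case: N S J => [|N] S J J0 mS fin; first by move/eqP: J0 => []; apply/matrixP => -[].
set c := (J^T *m J) 0 0.
have c0 : 0 < c.
  have := dot_eq0 J^T; have := dot_ge0 J^T; rewrite trmxK -/c le_eqVlt => /orP[/eqP<-|//].
  by rewrite eqxx -trmx0 (inj_eq trmx_inj) (negbTE J0).
pose s := Num.sqrt c.
have ss : s * s = c by rewrite -expr2 sqr_sqrtr// ltW.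
have s0 : s != 0 by apply: contraTneq c0 => s0; rewrite -ss s0 mul0r ltxx.
have [ O OO dO] : exists2 O, O *m O^T = 1%:M & (s *: (delta_mx 0 ord0 : 'rV[R]_N.+1)) *m O = J^T.
  apply: gram_orthogonal; rewrite trmxZ -scalemxAl -scalemxAr scalerA ss.
  rewrite trmx_delta mul_delta_mx trmxK; apply/matrixP => i j.
  by rewrite !ord1 [LHS]mxE [delta_mx _ _ _ _]mxE !eqxx mulr1.
have Od : O^T *m (delta_mx ord0 0 : 'cV[R]_N.+1) = s^-1 *: J.
  rewrite -[J]trmxK -dO trmx_mul trmxZ -scalemxAr scalerA mulVf// scale1r.
  by rewrite trmx_delta.
have mI : measurable_fun [set: 'cV[R]_N.+1] (fun v => (\1_S v : R)%:E).
  by apply/measurable_EFinP; exact: measurable_indic.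
have mIO : measurable_fun [set: 'cV[R]_N.+1] (fun v => (\1_S (O^T *m v) : R)%:E).
  by apply: (measurableT_comp mI); exact: measurable_mulmxl.
have I0 (v : 'cV[R]_N.+1) : (0 <= (\1_S v : R)%:E)%E by rewrite lee_fin.
have OO' : O^T^T *m O^T = 1%:M by rewrite trmxK.
have -> : gauss R N.+1 S = (\int[gauss R N.+1]_v (\1_S v : R)%:E)%E.
  by rewrite integral_indic// setIT.
rewrite -(gauss_orthogonal OO' mI I0) (gauss_integralS mIO (fun v => I0 _)).
have mc : measurable_fun [set: R * 'cV[R]_N]
    (fun xv => (\1_S (O^T *m mx_cons xv) : R)%:E).
  by apply: (measurableT_comp mIO); exact: measurable_mx_cons.
rewrite (fubini_tonelli (fun xv => (\1_S (O^T *m mx_cons xv) : R)%:E) mc (fun xv => I0 _)).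
rewrite integral0_eq// => v _ /=.
pose w : 'cV[R]_N.+1 := mx_cons (0, v).
have lineE x : O^T *m mx_cons (x, v) = O^T *m w + (x / s) *: J.
  rewrite -scalerA -Od scalemxAr -mulmxDr; congr (_ *m _).
  apply/matrixP => i j; rewrite (ord1 j) [RHS]mxE [X in _ + X]mxE [delta_mx _ _ _ _]mxE /w.
  case: (unliftP ord0 i) => [k ->|->]; rewrite eqxx andbT.
    by rewrite !mx_consS/= mulr0 addr0.
  by rewrite !mx_cons0/= add0r mulr1.
pose U := [set x : R | S (O^T *m w + (x / s) *: J)].
have fU : finite_set U.
  have -> : U = (fun t => t * s) @` [set t | S (O^T *m w + t *: J)].
    apply/seteqP; split=> x /=; first by move=> Ux; exists (x / s) => //; rewrite divfK.
    by move=> [t St <-]; rewrite /U/= mulfK.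
  exact: finite_image.
have mU : measurable U :=
  countable_measurable (fun t => measurable_set1 t) (finite_set_countable fU).
transitivity (\int[gauss1 R]_x (\1_U x : R)%:E)%E.
  by apply: eq_integral => x _; rewrite lineE !indicE; congr (_%:R%:E); apply/idP/idP; rewrite !inE.
have := @integral_indic _ _ _ (gauss1 R) setT measurableT U mU.
by rewrite setIT => ->; exact: gauss1_finite.
Qed.

Lemma finite_roots (R : idomainType) (p : {poly R}) : p != 0 ->
  finite_set [set t | root p t].
Proof.
move=> p0; apply: contrapT => /(infinite_set_fset (size p))[B BS sB].
have rB : all (root p) (finmap.enum_fset B) by apply/allP => t tB; exact: BS.
by have := max_poly_roots p0 rB (finmap.fset_uniq B); rewrite ltnNge sB.
Qed.

(** Adding t I to the leading m x m block of a matrix makes the determinant of that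
    block a monic polynomial in t, so [gauss_null_line] applies. *)
Lemma std_normal_full_rank (R : realType) m p (mu : probability 'M[R]_(m, m + p) R) x0 :
  std_normal_law mu -> (0 < m)%N -> x0 != 0 ->
  mu [set A | base_cov x0 0 A \notin unitmx] = 0%E.
Proof.
move=> hmu m0 x00; pose S := [set A : 'M[R]_(m, m + p) | \det (lsubmx A) == 0].
have mS : measurable S.
  have md : measurable_fun setT (fun A : 'M[R]_(m, m + p) => \det (lsubmx A)).
    apply: measurable_det; apply/measurable_mxP => i j; under eq_fun do rewrite mxE.
    exact: measurable_entry.
  rewrite (_ : S = setT `&` (fun A => \det (lsubmx A)) @^-1` [set 0]).
    by apply: md.
  by rewrite setTI; apply/seteqP; split=> A /eqP.
have S0 : mu S = 0%E.
  have mI : measurable_fun [set: 'M[R]_(m, m + p)] (fun A => (\1_S A : R)%:E).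
    by apply/measurable_EFinP; exact: measurable_indic.
  have -> : mu S = (\int[mu]_A (\1_S A : R)%:E)%E by rewrite integral_indic// setIT.
  rewrite (std_normal_law_integral hmu mI) => [|A]; last by rewrite lee_fin.
  have mS' : measurable (@mx_of_cV R m (m + p) @^-1` S).
    by rewrite -[X in measurable X]setTI; exact: measurable_mx_of_cV.
  transitivity (gauss R (m * (m + p)) (@mx_of_cV R m (m + p) @^-1` S)).
    by rewrite -[X in gauss _ _ X]setIT -integral_indic.
  pose J : 'M[R]_(m, m + p) := row_mx 1%:M 0.
  have JE : mx_of_cV (mxvec J)^T = J by rewrite /mx_of_cV trmxK mxvecK.
  apply: (gauss_null_line (J := (mxvec J)^T)) => //.
    apply/eqP => J0; have := JE; rewrite J0 /mx_of_cV trmx0 linear0.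
    move=> /esym/(congr1 lsubmx); rewrite row_mxKl linear0.
    move=> /matrixP/(_ (Ordinal m0) (Ordinal m0))/eqP.
    by rewrite !mxE eqxx oner_eq0.
  move=> v; set A0 := lsubmx (mx_of_cV v).
  have lineE t : \det (lsubmx (mx_of_cV (v + t *: (mxvec J)^T))) =
      (char_poly (- A0)).[t].
    have -> : lsubmx (mx_of_cV (v + t *: (mxvec J)^T)) = A0 + t%:M.
      rewrite /A0 /mx_of_cV [(_ + _)^T]raddfD/= trmxZ trmxK raddfD/= linearZ/= mxvecK.
      rewrite linearD/= linearZ/= row_mxKl scale_scalar_mx mulr1//.
    rewrite /char_poly -horner_evalE -det_map_mx; congr (\det _).
    apply/matrixP => i j; rewrite !mxE /= horner_evalE !hornerE.
    by rewrite hornerMn hornerX opprK addrC.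
  have c0 : char_poly (- A0) != 0 by rewrite monic_neq0// char_poly_monic.
  rewrite (_ : [set t | _] = [set t | root (char_poly (- A0)) t]); last first.
    by apply/seteqP; split=> t; rewrite /S/= lineE.
  exact: finite_roots.
apply/eqP; rewrite eq_le measure_ge0 andbT -S0; apply: le_measure; rewrite ?inE//.
  rewrite (_ : [set A | _] = setT `&` (fun A => \det (base_cov x0 0 A)) @^-1` [set 0]).
    have md := measurable_det (@measurable_base_cov R m (m + p) x0 0).
    by apply: md.
  by rewrite setTI; apply/seteqP; split=> A /=; rewrite unitmxE unitfE negbK => /eqP.
move=> A /=; apply: contraR; rewrite -unitfE -unitmxE => uA.
rewrite -row_free_unit -kermx_eq0; apply/eqP/row_matrixP => i; rewrite row0.
set v := row i _.
have vS : v *m base_cov x0 0 A = 0 by rewrite /v -row_mul mulmx_ker row0.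
have vA : v *m A = 0.
  apply/eqP; rewrite -dot_eq0 trmx_mul mulmxA -(mulmxA v).
  move: vS; rewrite /base_cov expr0n/= raddf0 addr0 -scalemxAr => /eqP.
  by rewrite scalemx_eq0 expf_eq0 (negbTE x00)/= => /eqP->; rewrite mul0mx mxE.
have vL : v *m lsubmx A = 0 by rewrite -[A]hsubmxK mul_mx_row in vA *; rewrite row_mxKl; move: vA; rewrite -[RHS]row_mx0 => /eq_row_mx[].
by rewrite -[v](mulmxK uA) vL mul0mx.
Qed.

(** * One signal against the flat one, for fixed sensing matrices *)

(** All observations are the image of one standard Gaussian vector, made of the
    stacked speckles and of the stacked normalized noises. *)
Definition stacked_map (R : realType) L m n (sigma : R) (A : 'I_L -> 'M[R]_(m, n))
    (x : 'cV[R]_n) :=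
  row_mx (blockdiag (fun l => A l *m diag_mx x^T)) (sigma%:M : 'M[R]_(\sum_(l < L) m)).

Lemma stacked_map_const (R : realType) L m n (x0 sigma : R) (A : 'I_L -> 'M[R]_(m, n)) :
  stacked_map sigma A (const_mx x0) = base_map x0 sigma (blockdiag A).
Proof.
rewrite /stacked_map /base_map; congr row_mx; rewrite blockdiagZ; apply: eq_mxblock => i j.
case: eqP => // _; apply/matrixP => k l; rewrite mul_mx_diag !mxE.
by rewrite mulrC.
Qed.

Lemma stacked_map_gram (R : realType) L m n (x0 sigma : R) (A : 'I_L -> 'M[R]_(m, n))
    (x : 'cV[R]_n) (r : 'rV[R]_n) :
  (forall i, x i 0 ^+ 2 = x0 ^+ 2 * (1 + r 0 i)) ->
  stacked_map sigma A x *m (stacked_map sigma A x)^T =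
  signal_cov x0 sigma (blockdiag A) (blockdiag (fun _ : 'I_L => diag_mx r)).
Proof.
move=> xr; rewrite /stacked_map tr_row_mx mul_row_col tr_scalar_mx -scalar_mxM -expr2.
rewrite /signal_cov; congr (_ + _).
rewrite tr_blockdiag mul_blockdiag -(blockdiag_scalar L) blockdiagD tr_blockdiag.
rewrite !mul_blockdiag blockdiagZ; apply: eq_mxblock => i j; case: eqP => // _.
rewrite trmx_mul tr_diag_mx mulmxA -(mulmxA (A i)) scalemxAl scalemxAr.
congr (_ *m _ *m _); apply/matrixP => k l; rewrite mul_mx_diag !mxE.
have [->|kl] := eqVneq k l; last by rewrite !mulr0n mul0r addr0 mulr0.
by rewrite !mulr1n -expr2 xr.
Qed.

(** The perturbation may be replaced by its compression to the row space of the
    measurement map, which is much smaller when there are few measurements. *)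
Lemma channel_perturbation (R : realType) L m n (x0 sigma kappa t : R)
    (A : 'I_L -> 'M[R]_(m, n)) (x : 'cV[R]_n) (r : 'rV[R]_n)
    (S : set 'cV[R]_(\sum_(l < L) m)) :
  0 < t -> (forall i, x i 0 ^+ 2 = x0 ^+ 2 * (1 + r 0 i)) ->
  (forall i, `|r 0 i| <= 2^-1) -> measurable S ->
  L%:R * \sum_i r 0 i ^+ 2 <= kappa \/
  (forall l, base_cov x0 sigma (A l) \in unitmx) /\
  \sum_l \sum_i \sum_j r 0 i * r 0 j * signal_proj x0 sigma (A l) i j ^+ 2 <= kappa ->
  (gauss R _ [set v | S (stacked_map sigma A x *m v)] <=
   (t * expR kappa)%:E + ((4 * t)^-1)%:E *
   gauss R _ [set v | S (stacked_map sigma A (const_mx x0) *m v)])%E.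
Proof.
move=> t0 xr r2 mS hk; rewrite stacked_map_const.
pose D := blockdiag (fun _ : 'I_L => diag_mx r).
have DT : D^T = D by rewrite tr_blockdiag; apply: eq_mxblock => i j; rewrite tr_diag_mx.
have Db : quad_bounded 2^-1 D by apply: blockdiag_bounded; exact: diag_bounded.
have gram : stacked_map sigma A x *m (stacked_map sigma A x)^T =
    base_map x0 sigma (blockdiag A) *m (1%:M + pad _ D) *m (base_map x0 sigma (blockdiag A))^T.
  by rewrite base_map_pad; exact: stacked_map_gram.
have PDT : (pad (\sum_(l < L) m) D)^T = pad _ D by exact: pad_sym.
have h0 : 0 <= 2^-1 :> R by rewrite invr_ge0.
have PDb := pad_bounded (q := \sum_(l < L) m) h0 Db.
suff [M [MT Mb Mg Mt]] : exists M, [/\ M^T = M, quad_bounded 2^-1 M,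
    stacked_map sigma A x *m (stacked_map sigma A x)^T =
    base_map x0 sigma (blockdiag A) *m (1%:M + M) *m (base_map x0 sigma (blockdiag A))^T &
    \tr (M *m M) <= kappa].
  apply: (le_trans (gauss_perturbation t0 MT Mb Mg mS)).
  by rewrite leeD2r// lee_fin ler_pM2l// ler_expR.
case: hk => [hk|[uA hk]].
  exists (pad _ D); split=> //; rewrite pad_sqtrace /D mul_blockdiag blockdiag_trace.
  rewrite (eq_bigr (fun=> \sum_i r 0 i ^+ 2)); last first.
    move=> l _; rewrite /mxtrace; apply: eq_bigr => i _.
    by rewrite mul_mx_diag !mxE eqxx mulr1n expr2.
  by rewrite sumr_const card_ord -[_ *+ L]mulr_natl.
have [uc _] := blockdiag_unit uA; rewrite -blockdiag_base_cov in uc.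
pose P := row_proj (base_map x0 sigma (blockdiag A)).
have uP : base_map x0 sigma (blockdiag A) *m (base_map x0 sigma (blockdiag A))^T
    \in unitmx by rewrite base_map_gram.
have PT : P^T = P by exact: row_proj_sym.
have BP : base_map x0 sigma (blockdiag A) *m P = base_map x0 sigma (blockdiag A).
  exact: mul_row_proj.
have Pb : quad_bounded 2^-1 (P *m pad _ D *m P) by exact: sandwich_bounded.
have Ptr := sandwich_sqtrace D uc; rewrite -/P in Ptr; clearbody P.
exists (P *m pad _ D *m P); split=> //.
- by rewrite !trmx_mul PDT PT mulmxA.
- rewrite gram mulmxDr mulmx1 [in RHS]mulmxDr mulmx1 !mulmxDl; congr (_ + _).
  rewrite !mulmxA BP -!mulmxA; congr (_ *m (_ *m _)).
  by apply: trmx_inj; rewrite trmx_mul trmxK PT BP.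
- rewrite Ptr blockdiag_signal_proj// !mul_blockdiag blockdiag_trace.
  apply: le_trans hk; apply: ler_sum => l _; rewrite diag_sandwich_trace//.
  by have [] := signal_proj_diag (uA l).
Qed.

(** * The joint law of the model *)

Lemma gaussian_law_scaled (R : realType) (s : R) (B : set R) : 0 <= s ->
  measurable B -> gaussian_law s B = gauss1 R [set x | B (s * x)].
Proof.
rewrite /gaussian_law => s0 mB; case: ifPn => [/eqP->|sn0].
  rewrite diracE; case: (asboolP (B 0)) => [B0|nB0].
    rewrite mem_set// (_ : [set x | _] = setT) ?probability_setT//.
    by apply/seteqP; split=> x //= _; rewrite mul0r.
  rewrite memNset// (_ : [set x | _] = set0) ?measure0//.
  by apply/seteqP; split=> x //=; rewrite mul0r.
have mI : measurable_fun [set: R] (fun x => (\1_B x : R)%:E).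
  by apply/measurable_EFinP; exact: measurable_indic.
have I0 (x : R) : (0 <= (\1_B x : R)%:E)%E by rewrite lee_fin.
have mB' : measurable [set x : R | B (s * x)].
  rewrite -[X in measurable X]setTI.
  have ms : measurable_fun [set: R] (fun x => s * x) by exact: measurable_funM.
  exact: (ms measurableT _ mB).
have e1 := @integral_indic _ _ _ (gauss1 R) setT measurableT _ mB'.
rewrite setIT in e1; rewrite -e1.
transitivity (\int[gauss1 R]_x (\1_B (s * x) : R)%:E)%E; last first.
  by apply: eq_integral => x _; rewrite !indicE; congr (_%:R%:E); apply/idP/idP; rewrite !inE.
rewrite (ge0_integral_scaled_gauss1 (f := fun x => (\1_B x : R)%:E) sn0 mI I0).
rewrite lebE; last 2 first.
- by apply: emeasurable_funM => //; apply/measurable_EFinP; exact: measurable_normal_pdf.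
- by move=> x; rewrite mule_ge0// lee_fin normal_pdf_ge0.
rewrite -(ge0_integral_normal_prob (f := fun x => (\1_B x : R)%:E) 0 s mI I0).
have := @integral_indic _ _ _ (normal_prob 0 s) setT measurableT B mB.
by rewrite setIT.
Qed.

Lemma independent_RVs_prod (R : realType) d (T : measurableType d) (P : probability T R)
    (I : finType) d' (T' : measurableType d') (X : I -> T -> T') (B : I -> set T') :
  independent_RVs P X -> (forall i, measurable (B i)) ->
  P [set t | forall i, B i (X i t)] = (\prod_i P (X i @^-1` B i))%E.
Proof.
move=> iX mB; have /(_ [set: I]%SET (fun i => X i @^-1` B i)) := iX.
have -> : \bigcap_(i in [set` [set: I]%SET]) (X i @^-1` B i) =
    [set t | forall i, B i (X i t)].
  by apply/seteqP; split=> t /= h i; [apply: h; rewrite /= inE|move=> _; exact: h].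
move=> ->; first by apply: eq_bigl => i; rewrite inE.
by move=> i _; exists (B i) => //; rewrite setTI.
Qed.

Lemma iid_gaussian_box (R : realType) d (T : measurableType d) (P : probability T R)
    (s : R) p q (X : T -> 'M[R]_(p, q)) (S : 'I_p -> 'I_q -> set R) : 0 <= s ->
  iid_gaussian_entries P s X -> (forall i j, measurable (S i j)) ->
  P (X @^-1` box S) =
  (\prod_(ij : 'I_p * 'I_q) gauss1 R [set x : R | S ij.1 ij.2 (s * x)%R])%E.
Proof.
move=> s0 [iX lX] mS.
rewrite (_ : X @^-1` box S = [set t | forall ij : 'I_p * 'I_q, S ij.1 ij.2 (X t ij.1 ij.2)]).
  rewrite (independent_RVs_prod iX (B := fun ij => S ij.1 ij.2))//.
  by apply: eq_bigr => -[i j] _; rewrite /= (lX i j)// gaussian_law_scaled.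
by apply/seteqP; split=> t /= h => [[i j]|i j]; [exact: h|exact: (h (i, j))].
Qed.

Lemma iid_gaussian_std (R : realType) d (T : measurableType d) (P : probability T R)
    p q (X : {RV P >-> 'M[R]_(p, q)}) :
  iid_gaussian_entries P 1 X -> std_normal_law (distribution P X).
Proof.
move=> gX S mS; apply: etrans (iid_gaussian_box ler01 gX mS) _.
apply: eq_bigr => -[i j] _; congr (gauss1 R _).
by apply/seteqP; split=> x /=; rewrite mul1r.
Qed.

Lemma split_lshiftE N M (k : 'I_N) : fintype.split (lshift M k) = inl k.
Proof. exact: (unsplitK (inl k)). Qed.

Lemma split_rshiftE N M (k : 'I_M) : fintype.split (rshift N k) = inr k.
Proof. exact: (unsplitK (inr k)). Qed.

Lemma prod_Rank (R : realType) L n (F : 'I_(\sum_(l < L) n) -> \bar R) :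
  (\prod_k F k = \prod_(l < L) \prod_(i < n) F (tagnat.Rank l i))%E.
Proof.
rewrite sig_big_dep/= (reindex (@tagnat.rank L (fun=> n)))/=.
  by apply: eq_bigr => -[l i] _; rewrite tagnat.rankE.
exact/onW_bij/tagnat.rank_bij.
Qed.

Definition scale_noise (R : realType) N M (sigma : R) (v : 'cV[R]_(N + M)) : 'cV[R]_(N + M) :=
  col_mx (usubmx v) (sigma *: dsubmx v).

Lemma measurable_scale_noise (R : realType) N M (sigma : R) :
  measurable_fun setT (@scale_noise R N M sigma).
Proof.
apply/measurable_mxP => k j; rewrite (ord1 j).
case: (split_ordP k) => k' ->; under eq_fun do rewrite ?col_mxEu ?col_mxEd !mxE.
  exact: measurable_entry.
by apply: measurable_funM => //; exact: measurable_entry.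
Qed.

HB.instance Definition _ (R : realType) N M (sigma : R) :=
  isMeasurableFun.Build _ _ _ _ (@scale_noise R N M sigma)
    (@measurable_scale_noise R N M sigma).

Lemma gauss_scale_noise_box (R : realType) N M (sigma : R) (S : 'I_(N + M) -> set R) :
  (forall k, measurable (S k)) ->
  gauss R (N + M) (@scale_noise R N M sigma @^-1` box (fun k _ => S k)) =
  (\prod_(k < N) gauss1 R (S (lshift M k)) *
   \prod_(k < M) gauss1 R [set x : R | S (rshift N k) (sigma * x)%R])%E.
Proof.
move=> mS; pose S' k := match fintype.split k with
  | inl _ => S k | inr _ => [set x : R | S k (sigma * x)] end.
have mS' k : measurable (S' k).
  rewrite /S'; case: fintype.split => // _; rewrite -[X in measurable X]setTI.
  have ms : measurable_fun [set: R] (fun x => sigma * x) by exact: measurable_funM.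
  exact: (ms measurableT _ (mS k)).
have SL k : S' (lshift M k) = S (lshift M k).
  by rewrite /S' split_lshiftE.
have SR k : S' (rshift N k) = [set x : R | S (rshift N k) (sigma * x)].
  by rewrite /S' split_rshiftE.
have -> : @scale_noise R N M sigma @^-1` box (fun k _ => S k) = box (fun k _ => S' k).
  apply/seteqP; split=> v /= h k j; have := h k j; rewrite (ord1 j) /scale_noise;
    case: (split_ordP k) => k' ->; rewrite ?SL ?SR ?col_mxEu ?col_mxEd !mxE//.
rewrite gauss_box// big_split_ord/=; congr (_ * _)%E; apply: eq_bigr => k _.
  by rewrite SL.
by rewrite SR.
Qed.

Lemma mxcol_Rank (R : realType) L p (X : 'I_L -> 'cV[R]_p) l i :
  (\mxcol_l' X l' : 'cV[R]_(\sum_(l < L) p)) (tagnat.Rank l i) 0 = X l i 0.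
Proof. by have := congr1 (fun B : 'cV[R]_p => B i 0) (mxcolK X l); rewrite mxE. Qed.

Lemma measurable_fun_ext d1 d2 (T1 : measurableType d1) (T2 : measurableType d2)
  (f g : T1 -> T2) : (forall x, f x = g x) -> measurable_fun setT g -> measurable_fun setT f.
Proof. by move=> /funext ->. Qed.

Section model_law.
Context (R : realType) d (T : measurableType d) (P : probability T R) (m n L : nat).
Context (A : 'I_L -> {RV P >-> 'M[R]_(m, n)}) (w : 'I_L -> {RV P >-> 'cV[R]_n})
  (z : 'I_L -> {RV P >-> 'cV[R]_m}) (sigma : R).
Hypothesis model : gaussian_model A w z sigma.
Hypothesis sigma0 : 0 <= sigma.

Definition sensing (t : T) : L.-tuple 'M[R]_(m, n) := [tuple A l t | l < L].

Definition speckle_noise (t : T) : 'cV[R]_(\sum_(l < L) n + \sum_(l < L) m) :=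
  col_mx (\mxcol_l w l t) (\mxcol_l z l t).

Lemma measurable_sensing : measurable_fun setT sensing.
Proof.
apply/measurable_fun_tnthP => l; rewrite /comp.
by under eq_fun do rewrite tnth_mktuple; exact: measurable_funPT.
Qed.

Lemma measurable_speckle_noise : measurable_fun setT speckle_noise.
Proof.
apply/measurable_mxP => k j; rewrite (ord1 j).
case: (split_ordP k) => k' ->; under eq_fun do rewrite ?col_mxEu ?col_mxEd mxE.
  by apply: (measurableT_comp (@measurable_entry R n 1 _ _)); exact: measurable_funPT.
by apply: (measurableT_comp (@measurable_entry R m 1 _ _)); exact: measurable_funPT.
Qed.

Lemma tuple_preimage_sigma d' (T' : measurableType d') (X : 'I_L -> T -> T')
    (B : set (L.-tuple T')) : measurable B ->
  g_sigma_preimage X ((fun t => [tuple X l t | l < L]) @^-1` B).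
Proof.
move=> mB.
have := @g_sigma_preimage_comp _ T' L (L.-tuple T')%type (fun l (tt : L.-tuple T') => tnth tt l) T
  (fun t => [tuple X l t | l < L]).
rewrite (_ : (fun l => (fun tt : L.-tuple T' => tnth tt l) \o
  (fun t => [tuple X l' t | l' < L])) = X); last first.
  by apply/funext => l; apply/funext => t /=; rewrite tnth_mktuple.
by move=> ->; exists B => //; rewrite setTI.
Qed.

Lemma families_split (X : set (L.-tuple 'M[R]_(m, n))) (W : set (L.-tuple 'cV[R]_n))
    (Z : set (L.-tuple 'cV[R]_m)) : measurable X -> measurable W -> measurable Z ->
  P ((sensing @^-1` X) `&` ([set t | W [tuple w l t | l < L]] `&`
     [set t | Z [tuple z l t | l < L]])) =
  (P (sensing @^-1` X) * (P [set t | W [tuple w l t | l < L]] *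
     P [set t | Z [tuple z l t | l < L]]))%E.
Proof.
move=> mX mW mZ.
pose E (i : 'I_3) : set T := match val i with
  | 0%N => sensing @^-1` X
  | 1%N => [set t | W [tuple w l t | l < L]]
  | _ => [set t | Z [tuple z l t | l < L]] end.
have := families_independent model (J := [set: 'I_3]%SET) (E := E).
have -> : \bigcap_(i in [set` [set: 'I_3]%SET]) E i = (sensing @^-1` X) `&`
    ([set t | W [tuple w l t | l < L]] `&` [set t | Z [tuple z l t | l < L]]).
  apply/seteqP; split=> t /= h.
    have H i : E i t by apply: h; rewrite /= inE.
    split; first exact: (H ord0).
    by split; [exact: (H (Ordinal (isT : 1 < 3)%N))|exact: (H (Ordinal (isT : 2 < 3)%N))].
  move=> [[|[|[|i]]] hi] _ //; rewrite /E/=; [exact: h.1|exact: h.2.1|exact: h.2.2].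
move=> ->; first by rewrite (eq_bigl xpredT) => [|i]; rewrite ?inE// !big_ord_recl big_ord0 mule1.
move=> [[|[|[|i]]] hi] _ //; rewrite /E/=; exact: tuple_preimage_sigma.
Qed.

Lemma stack_box p s (X : 'I_L -> {RV P >-> 'cV[R]_p}) (S : 'I_(\sum_(l < L) p) -> set R) :
  0 <= s -> independent_RVs P (fun l => X l : T -> _) ->
  (forall l, iid_gaussian_entries P s (X l)) -> (forall k, measurable (S k)) ->
  P [set t | forall l i, S (tagnat.Rank l i) (X l t i 0)] =
  (\prod_k gauss1 R [set x : R | S k (s * x)%R])%E.
Proof.
move=> s0 iX gX mS.
rewrite (_ : [set t | _] = [set t | forall l, box (fun i _ => S (tagnat.Rank l i)) (X l t)]).
  rewrite (independent_RVs_prod iX (B := fun l => box (fun i _ => S (tagnat.Rank l i)))); last first.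
    by move=> l; exact: measurable_box.
  rewrite prod_Rank; apply: eq_bigr => l _; rewrite (iid_gaussian_box s0 (gX l))//.
  rewrite -(pair_big xpredT xpredT (fun i (_ : 'I_1) => gauss1 R [set x : R | S (tagnat.Rank l i) (s * x)%R]))/=.
  by apply: eq_bigr => i _; rewrite big_ord1.
apply/seteqP; split=> t /= h l i; last exact: h.
by move=> j; rewrite (ord1 j); exact: h.
Qed.

Lemma speckle_noise_box (X : set (L.-tuple 'M[R]_(m, n))) S :
  measurable X -> (forall k, measurable (S k)) ->
  P ((sensing @^-1` X) `&` (speckle_noise @^-1` box (fun k _ => S k))) =
  (P (sensing @^-1` X) * gauss R _ (scale_noise sigma @^-1` box (fun k _ => S k)))%E.
Proof.
move=> mX mS.
pose W : set (L.-tuple 'cV[R]_n) :=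
  [set tt | forall l, box (fun i _ => S (lshift _ (tagnat.Rank l i))) (tnth tt l)].
pose Z : set (L.-tuple 'cV[R]_m) :=
  [set tt | forall l, box (fun i _ => S (rshift _ (tagnat.Rank l i))) (tnth tt l)].
have mtup p (B : 'I_L -> set 'cV[R]_p) : (forall l, measurable (B l)) ->
    measurable [set tt : L.-tuple 'cV[R]_p | forall l, B l (tnth tt l)].
  move=> mB; rewrite (_ : [set tt | _] = \bigcap_(l in [set: 'I_L]) ((fun tt => tnth tt l) @^-1` B l)).
    apply: fin_bigcap_measurable => // l _; rewrite -[X in measurable X]setTI.
    exact: (measurable_tnth l measurableT (mB l)).
  by apply/seteqP; split=> tt /= h l => [_|]; exact: h.
have mW : measurable W.
  apply: (mtup n (fun l => box (fun i _ => S (lshift _ (tagnat.Rank l i))))) => l.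
  by apply: measurable_box => i j; exact: mS.
have mZ : measurable Z.
  apply: (mtup m (fun l => box (fun i _ => S (rshift _ (tagnat.Rank l i))))) => l.
  by apply: measurable_box => i j; exact: mS.
rewrite gauss_scale_noise_box//.
transitivity (P ((sensing @^-1` X) `&` ([set t | W [tuple w l t | l < L]] `&`
     [set t | Z [tuple z l t | l < L]]))).
  congr (P (_ `&` _)); apply/seteqP; split=> t /=.
    move=> h; split=> l i j; rewrite (ord1 j) tnth_mktuple.
      by have := h (lshift _ (tagnat.Rank l i)) 0; rewrite col_mxEu mxcol_Rank.
    by have := h (rshift _ (tagnat.Rank l i)) 0; rewrite col_mxEd mxcol_Rank.
  move=> [hw hz] k j; rewrite (ord1 j) /speckle_noise.
  case: (split_ordP k) => k' ->; rewrite ?col_mxEu ?col_mxEd -(tagnat.sig2K k') mxcol_Rank.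
    by have := hw (tagnat.sig1 k') (tagnat.sig2 k') 0; rewrite tnth_mktuple.
  by have := hz (tagnat.sig1 k') (tagnat.sig2 k') 0; rewrite tnth_mktuple.
rewrite families_split//; congr (_ * (_ * _))%E.
- rewrite (_ : [set t | _] = [set t | forall l i, S (lshift _ (tagnat.Rank l i)) (w l t i 0)]).
    rewrite (stack_box (S := fun k => S (lshift _ k)) ler01 (speckle_independent model) (speckle_gaussian model))//.
    apply: eq_bigr => k _; congr (gauss1 R _).
    by apply/seteqP; split=> x /=; rewrite mul1r.
  apply/seteqP; split=> t h l i; first by have := h l i 0; rewrite tnth_mktuple.
  by move=> j; rewrite tnth_mktuple (ord1 j); exact: h.
- rewrite (_ : [set t | _] = [set t | forall l i, S (rshift _ (tagnat.Rank l i)) (z l t i 0)]).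
    by rewrite (stack_box (S := fun k => S (rshift _ k)) sigma0 (noise_independent model) (noise_gaussian model)).
  apply/seteqP; split=> t h l i; first by have := h l i 0; rewrite tnth_mktuple.
  by move=> j; rewrite tnth_mktuple (ord1 j); exact: h.
Qed.

Let sensingRV : {mfun T >-> L.-tuple 'M[R]_(m, n)} := mfun_Sub (mem_set measurable_sensing).

Let joint (t : T) := (sensing t, speckle_noise t).

Let measurable_joint : measurable_fun setT joint.
Proof. by apply: measurable_fun_pair; [exact: measurable_sensing|exact: measurable_speckle_noise]. Qed.

Let jointRV : {mfun T >-> (L.-tuple 'M[R]_(m, n) * 'cV[R]_(\sum_(l < L) n + \sum_(l < L) m))%type} :=
  mfun_Sub (mem_set measurable_joint).

Definition sensing_law : probability (L.-tuple 'M[R]_(m, n)) R := distribution P sensingRV.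

Definition speckle_noise_law : probability 'cV[R]_(\sum_(l < L) n + \sum_(l < L) m) R :=
  distribution (gauss R _) (@scale_noise R _ _ sigma : {mfun _ >-> _}).

(** Both sides agree on products of a measurable set and a box, by independence. *)
Lemma joint_law (Q : set (L.-tuple 'M[R]_(m, n) * 'cV[R]_(\sum_(l < L) n + \sum_(l < L) m))) :
  measurable Q ->
  P [set t | Q (sensing t, speckle_noise t)] = (sensing_law \x speckle_noise_law)%E Q.
Proof.
move=> mQ; symmetry.
apply: (@product_measure_unique _ _ _ _ R sensing_law speckle_noise_law (distribution P jointRV)) => //.
move=> X Y mX mY.
have mX' : measurable (sensing @^-1` X).
  by rewrite -[_ @^-1` _]setTI; exact: measurable_sensing.
have c0 : 0 <= fine (P (sensing @^-1` X)) by rewrite fine_ge0.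
pose noiseRV : {mfun T >-> 'cV[R]_(\sum_(l < L) n + \sum_(l < L) m)} :=
  mfun_Sub (mem_set measurable_speckle_noise).
transitivity (pushforward (mrestr P mX') noiseRV Y).
  by rewrite /pushforward/= /mrestr setIC.
transitivity (mscale (NngNum c0) speckle_noise_law Y); last first.
  by rewrite /mscale/= fineK// fin_num_measure.
have fin : (pushforward (mrestr P mX') noiseRV setT < +oo)%E.
  rewrite /pushforward/= /mrestr; apply: le_lt_trans (ltry 1).
  by apply: probability_le1; rewrite preimage_setT setTI.
apply: (mx_measure_unique fin _ mY) => S mS.
transitivity (P (speckle_noise @^-1` box S `&` sensing @^-1` X)); first by [].
rewrite setIC; transitivity (P (sensing @^-1` X `&` speckle_noise @^-1` box (fun k _ => S k 0))).
  congr (P (_ `&` _)); apply/seteqP; split=> t /= h k j;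
    by rewrite (ord1 j); exact: h.
rewrite (speckle_noise_box (S := fun k => S k 0) mX (fun k => mS k 0)).
transitivity ((fine (P (sensing @^-1` X)))%:E * speckle_noise_law (box S))%E; last by [].
rewrite fineK ?fin_num_measure//.
congr (_ * _)%E.
transitivity (gauss R _ (scale_noise sigma @^-1` box S)); last by [].
congr (gauss R _ _); apply/seteqP; split=> t /= h k j;
  by rewrite (ord1 j); exact: h.
Qed.

(** The data seen by an estimator, as a function of the sensing matrices and of
    the stacked speckles and noises. *)
Definition data_map (x : 'cV[R]_n)
    (au : L.-tuple 'M[R]_(m, n) * 'cV[R]_(\sum_(l < L) n + \sum_(l < L) m)) :
    (L.-tuple 'cV[R]_m * L.-tuple 'M[R]_(m, n))%type :=
  ([tuple tnth au.1 l *m diag_mx x^T *m submxcol (usubmx au.2) l +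
          submxcol (dsubmx au.2) l | l < L], au.1).

Lemma data_mapE x t :
  ([tuple measurement A w z x l t | l < L], [tuple A l t | l < L]) =
  data_map x (sensing t, speckle_noise t).
Proof.
rewrite /data_map /=; congr pair; apply: eq_from_tnth => l; rewrite !tnth_mktuple.
by rewrite /speckle_noise col_mxKu col_mxKd !mxcolK.
Qed.

Lemma measurable_data_map x : measurable_fun setT (data_map x).
Proof.
apply: measurable_fun_pair; last exact: measurable_fst.
have m2 k : measurable_fun setT (fun au : L.-tuple 'M[R]_(m, n) *
    'cV[R]_(\sum_(l < L) n + \sum_(l < L) m) => au.2 k 0).
  exact: (measurableT_comp (@measurable_entry R _ 1 k 0) measurable_snd).
apply/measurable_fun_tnthP => l; rewrite /comp.
apply: (measurable_fun_ext (fun au => tnth_mktuple _ _)).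
pose f (au : L.-tuple 'M[R]_(m, n) * 'cV[R]_(\sum_(l < L) n + \sum_(l < L) m)) : 'cV[R]_m :=
  tnth au.1 l *m diag_mx x^T *m submxcol (usubmx au.2) l.
have mf : measurable_fun setT f.
  apply: measurable_mulmx.
    apply: measurable_mulmx; last exact: measurable_cst.
    exact: (measurableT_comp (measurable_tnth l) measurable_fst).
  apply/measurable_mxP => i j; rewrite (ord1 j).
  apply: measurable_fun_ext (m2 (lshift _ (tagnat.Rank l i))) => au.
  by rewrite !mxE.
apply/measurable_mxP => i j; rewrite (ord1 j).
have mfi : measurable_fun setT (fun au => f au i 0) by move/measurable_mxP : mf; exact.
apply: measurable_fun_ext (measurable_funD mfi (m2 (rshift _ (tagnat.Rank l i)))) => au.
by rewrite [LHS]mxE /f /=; congr (_ + _); rewrite !mxE.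
Qed.

Definition unstack (y : 'cV[R]_(\sum_(l < L) m)) : L.-tuple 'cV[R]_m :=
  [tuple submxcol y l | l < L].

Lemma measurable_unstack : measurable_fun setT unstack.
Proof.
apply/measurable_fun_tnthP => l; rewrite /comp.
apply: (measurable_fun_ext (fun au => tnth_mktuple _ _)).
apply/measurable_mxP => i j; rewrite (ord1 j).
apply: measurable_fun_ext (@measurable_entry R (\sum_(l < L) m) 1 (tagnat.Rank l i) 0) => y.
by rewrite mxE.
Qed.

Lemma data_map_scale x a v :
  data_map x (a, scale_noise sigma v) = (unstack (stacked_map sigma (tnth a) x *m v), a).
Proof.
rewrite /data_map/= /unstack /scale_noise col_mxKu col_mxKd; congr pair.
apply: eq_from_tnth => l; rewrite !tnth_mktuple.
rewrite -[v in RHS]vsubmxK /stacked_map mul_row_col mul_scalar_mx submxcolD.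
rewrite -[usubmx v in RHS]submxcolK blockdiag_mul_mxcol mxcolK; congr (_ + _).
Qed.

(** Integrate [channel_perturbation] over the good sensing matrices. *)
Lemma model_perturbation (x0 kappa t : R) (x : 'cV[R]_n) (r : 'rV[R]_n)
    (B : set (L.-tuple 'cV[R]_m * L.-tuple 'M[R]_(m, n))) (G : set (L.-tuple 'M[R]_(m, n))) :
  0 < t -> (forall i, x i 0 ^+ 2 = x0 ^+ 2 * (1 + r 0 i)) ->
  (forall i, `|r 0 i| <= 2^-1) -> measurable B -> measurable G ->
  (forall a : L.-tuple 'M[R]_(m, n), G a -> L%:R * \sum_i r 0 i ^+ 2 <= kappa \/
    (forall l, base_cov x0 sigma (tnth a l) \in unitmx) /\
    \sum_l \sum_i \sum_j r 0 i * r 0 j * signal_proj x0 sigma (tnth a l) i j ^+ 2 <= kappa) ->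
  (P [set s | B (data_map x (sensing s, speckle_noise s)) /\ G (sensing s)] <=
   (t * expR kappa)%:E + ((4 * t)^-1)%:E *
   P [set s | B (data_map (const_mx x0) (sensing s, speckle_noise s))])%E.
Proof.
move=> t0 xr r2 mB mG hG.
have mBx y : measurable [set au | B (data_map y au)].
  by rewrite -[X in measurable X]setTI; exact: measurable_data_map.
pose Q := [set au | B (data_map x au) /\ G au.1].
have mQ : measurable Q.
  have mG1 := @measurable_fst _ _ (L.-tuple 'M[R]_(m, n))
    'cV[R]_(\sum_(l < L) n + \sum_(l < L) m) measurableT _ mG.
  by rewrite setTI in mG1; exact: (measurableI _ _ (mBx x) mG1).
have -> : P [set s | B (data_map x (sensing s, speckle_noise s)) /\ G (sensing s)] =
    P [set s | Q (sensing s, speckle_noise s)] by [].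
pose Q0 := [set au | B (data_map (const_mx x0) au)].
have -> : P [set s | B (data_map (const_mx x0) (sensing s, speckle_noise s))] =
    P [set s | Q0 (sensing s, speckle_noise s)] by [].
rewrite !joint_law//; last exact: mBx.
have secE (C : set _) a : speckle_noise_law (xsection C a) =
    gauss R _ [set v | C (a, scale_noise sigma v)].
  by congr (gauss R _ _); apply/seteqP; split=> v; rewrite /xsection /= inE.
have step a : (speckle_noise_law (xsection Q a) <=
    (t * expR kappa)%:E + ((4 * t)^-1)%:E * speckle_noise_law (xsection Q0 a))%E.
  have c0 : (0 <= (t * expR kappa)%:E + ((4 * t)^-1)%:E * speckle_noise_law (xsection Q0 a))%E.
    by rewrite adde_ge0 ?mule_ge0// lee_fin ?invr_ge0 mulr_ge0 ?expR_ge0// ltW.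
  have [Ga|nGa] := pselect (G a); last first.
    rewrite (_ : xsection Q a = set0) ?measure0//.
    by apply/seteqP; split=> v //; rewrite /xsection/= inE => -[].
  rewrite !secE.
  pose S := [set y | B (unstack y, a)].
  have mS : measurable S.
    rewrite -[X in measurable X]setTI.
    have mu : measurable_fun setT (fun y => (unstack y, a)).
      by apply: measurable_fun_pair => //; exact: measurable_unstack.
    exact: (mu measurableT _ mB).
  have := channel_perturbation t0 xr r2 mS (hG a Ga).
  rewrite (_ : [set v | Q _] = [set v | S (stacked_map sigma (tnth a) x *m v)]); last first.
    by apply/seteqP; split=> v; rewrite /Q/S/= data_map_scale; [case|split].
  rewrite (_ : [set v | Q0 _] = [set v | S (stacked_map sigma (tnth a) (const_mx x0) *m v)])//.
  by apply/seteqP; split=> v /=; rewrite /Q0/S/= data_map_scale.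
have mQ0 : measurable Q0 by exact: mBx.
have ms0 : measurable_fun setT (fun a => speckle_noise_law (xsection Q0 a)).
  exact: measurable_fun_xsection.
have c0 : (0 <= ((4 * t)^-1)%:E :> \bar R)%E by rewrite lee_fin invr_ge0 mulr_ge0// ltW.
have c1 : (0 <= (t * expR kappa)%:E)%E by rewrite lee_fin mulr_ge0 ?expR_ge0// ltW.
apply: (@le_trans _ _ (\int[sensing_law]_a ((t * expR kappa)%:E +
    ((4 * t)^-1)%:E * speckle_noise_law (xsection Q0 a)))%E).
  apply: ge0_le_integral => //.
  - exact: measurable_fun_xsection.
  - by apply: emeasurable_funD => //; exact: measurable_funeM.
  - by move=> a _; exact: step.
rewrite ge0_integralD//; last 2 first.
- by move=> a _; rewrite mule_ge0.
- exact: measurable_funeM.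
apply: leeD; last by rewrite ge0_integralZl.
rewrite integral_cst// -[leRHS]mule1; apply: lee_wpmul2l => //.
by apply: probability_le1.
Qed.

End model_law.

(** * Good sensing matrices *)

Lemma markov_bmeas (R : realType) d (T : measurableType d) (P : probability T R)
    (F : T -> R) (K e : R) : bmeas F -> (forall t, 0 <= F t) -> 0 < K ->
  \int[P]_t F t <= e * K -> (P [set t | (K < F t)%R] <= e%:E)%E.
Proof.
move=> bF F0 K0 FK.
have mS : measurable [set t | K < F t].
  rewrite -[X in measurable X]setTI.
  have -> : [set t | K < F t] = F @^-1` `]K, +oo[.
    by apply/seteqP; split=> t /=; rewrite in_itv/= andbT.
  by apply: bF.1.
rewrite -(@lee_pmul2l _ K%:E)// -EFinM [X in (_ <= X%:E)%E]mulrC.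
apply: (@le_trans _ _ (\int[P]_t F t)%:E); last by rewrite lee_fin.
rewrite -EFin_Rintegral//.
have -> : (K%:E * P [set t | (K < F t)%R] = \int[P]_(t in [set t | (K < F t)%R]) (cst K%:E t))%E.
  by rewrite integral_cst.
apply: (@le_trans _ _ (\int[P]_(t in [set t | (K < F t)%R]) (F t)%:E)%E).
  apply: ge0_le_integral => //.
  - by move=> t _; rewrite lee_fin ltW.
  - by apply/measurable_EFinP; apply: (measurable_funS measurableT) => //; exact: bF.1.
  - by move=> t /= Kt; rewrite lee_fin ltW.
apply: ge0_subset_integral => //.
- by apply/measurable_EFinP; exact: bF.1.
- by move=> t _; rewrite lee_fin.
Qed.

Lemma sqtrace_ge0 (R : realFieldType) n (M : 'M[R]_n) : M^T = M -> 0 <= \tr (M *m M).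
Proof.
move=> MT; apply: sumr_ge0 => i _; rewrite mxE; apply: sumr_ge0 => j _.
have -> : M j i = M i j by rewrite -[in LHS]MT mxE.
by rewrite -expr2 sqr_ge0.
Qed.

Definition compressed_cost (R : realType) q n (x0 sigma : R) (r : 'rV[R]_n)
    (A : 'M[R]_(q, n)) : R :=
  \sum_i \sum_j r 0 i * r 0 j * signal_proj0 x0 sigma A i j ^+ 2.

Lemma compressed_cost_ge0 (R : realType) q n (x0 sigma : R) (r : 'rV[R]_n)
    (A : 'M[R]_(q, n)) : 0 <= compressed_cost x0 sigma r A.
Proof.
rewrite /compressed_cost signal_proj0E; case: ifPn => [u|_]; last first.
  by rewrite big1// => i _; rewrite big1// => j _; rewrite mxE expr0n mulr0.
have [PT _ _ _ _] := signal_proj_diag u.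
rewrite -diag_sandwich_trace// -sandwich_sqtrace//; apply: sqtrace_ge0.
have PpT := row_proj_sym (base_map x0 sigma A).
have DT := pad_sym q (tr_diag_mx r).
by set W := row_proj _ in PpT *; clearbody W; rewrite !trmx_mul PpT DT mulmxA.
Qed.

Lemma bmeas_compressed_cost (R : realType) q n (x0 sigma : R) (r : 'rV[R]_n) :
  bmeas (fun A : 'M[R]_(q, n) => compressed_cost x0 sigma r A).
Proof.
apply: bmeas_sum => i; apply: bmeas_sum => j; apply: bmeasM; first exact: bmeas_cst.
by apply: bmeasX; exact: bmeas_signal_proj0.
Qed.

Lemma bmeas_comp (R : realType) d d' (T : measurableType d) (T' : measurableType d')
    (f : T' -> R) (X : T -> T') : measurable_fun setT X -> bmeas f -> bmeas (f \o X).
Proof.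
move=> mX [mf [K fK]]; split; first exact: measurableT_comp.
by exists K => t; exact: fK.
Qed.

Lemma std_normal_full_rank_le (R : realType) m n (mu : probability 'M[R]_(m, n) R) x0 :
  std_normal_law mu -> (0 < m)%N -> (m <= n)%N -> x0 != 0 ->
  mu [set A | base_cov x0 0 A \notin unitmx] = 0%E.
Proof.
move=> + m0 mn x00; move: mu; rewrite -(subnKC mn) => mu hmu.
exact: std_normal_full_rank.
Qed.

Section good_event.
Context (R : realType) d (T : measurableType d) (P : probability T R) (m n L : nat).
Context (A : 'I_L -> {RV P >-> 'M[R]_(m, n)}).
Hypothesis sensing_gaussian : forall l, iid_gaussian_entries P 1 (A l).
Hypotheses (m0 : (0 < m)%N) (n0 : (0 < n)%N).

Lemma expected_cost (x0 sigma alpha : R) (r : 'rV[R]_n) :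
  (forall mu : probability 'M[R]_(m, n) R, std_normal_law mu ->
     \int[mu]_B compressed_cost x0 sigma r B <= alpha) ->
  \int[P]_t (\sum_l compressed_cost x0 sigma r (A l t)) <= L%:R * alpha.
Proof.
move=> H; rewrite Rintegral_sum; last first.
  by move=> l; apply: (bmeas_comp (f := fun B => compressed_cost x0 sigma r B));
    [exact: measurable_funPT|exact: bmeas_compressed_cost].
rewrite [leRHS](_ : _ = \sum_(l < L) alpha); last by rewrite sumr_const card_ord mulr_natl.
apply: ler_sum => l _.
apply: le_trans (H _ (iid_gaussian_std (sensing_gaussian l))).
rewrite le_eqVlt; apply/orP; left; apply/eqP; rewrite /Rintegral; congr fine.
rewrite ge0_integral_distribution//.
- by apply/measurable_EFinP; have [] := bmeas_compressed_cost m x0 sigma r.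
- by move=> B; rewrite lee_fin; exact: compressed_cost_ge0.
Qed.

Lemma singular_null (x0 sigma : R) : 0 <= sigma -> x0 != 0 -> (0 < sigma) || (m <= n)%N ->
  let S := [set t | exists l, base_cov x0 sigma (A l t) \notin unitmx] in
  measurable S /\ P S = 0%E.
Proof.
move=> s0 x00; have [sp _|sn0] := ltP 0 sigma.
  rewrite (_ : [set t | _] = set0) ?measure0//.
  by apply/seteqP; split=> t // [l]; rewrite base_cov_unit.
have -> : sigma = 0 by apply/eqP; rewrite eq_le sn0 s0.
rewrite /= => mn.
have mS : measurable [set B : 'M[R]_(m, n) | base_cov x0 0 B \notin unitmx].
  rewrite (_ : [set B | _] = setT `&` (fun B => \det (base_cov x0 0 B)) @^-1` [set 0]).
    have md := measurable_det (@measurable_base_cov R m n x0 0).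
    by apply: md.
  by rewrite setTI; apply/seteqP; split=> B /=; rewrite unitmxE unitfE negbK => /eqP.
rewrite (_ : [set t | _] = \bigcup_(l in [set: 'I_L]) (A l @^-1` [set B | base_cov x0 0 B \notin unitmx])); last first.
  by apply/seteqP; split=> t /=; [case=> l h; exists l|case=> l _ h; exists l].
have mbad l : measurable (A l @^-1` [set B | base_cov x0 0 B \notin unitmx]).
  by rewrite -[X in measurable X]setTI; exact: measurable_funPT.
have bad0 l : P (A l @^-1` [set B | base_cov x0 0 B \notin unitmx]) = 0%E.
  exact: (std_normal_full_rank_le (iid_gaussian_std (sensing_gaussian l)) m0 mn x00).
have mU : measurable (\bigcup_(l in [set: 'I_L])
    (A l @^-1` [set B | base_cov x0 0 B \notin unitmx])).
  exact: fin_bigcup_measurable.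
split=> //; apply: measure_negligible => //.
rewrite (_ : \bigcup_(l in _) _ = \bigcup_k [set t | exists l : 'I_L,
    val l = k /\ base_cov x0 0 (A l t) \notin unitmx]); last first.
  apply/seteqP; split=> t /=; first by case=> l _ h; exists (val l) => //; exists l.
  by case=> k _ [l [_ h]]; exists l.
apply: negligible_bigcup => k; have [kL|Lk] := ltnP k L.
  rewrite (_ : [set t | _] = A (Ordinal kL) @^-1` [set B | base_cov x0 0 B \notin unitmx]).
    exists (A (Ordinal kL) @^-1` [set B | base_cov x0 0 B \notin unitmx]).
    by split; [exact: mbad|exact: bad0|].
  apply/seteqP; split=> t /=; last by move=> h; exists (Ordinal kL).
  by case=> l [lk h]; rewrite (_ : Ordinal kL = l)//; exact: val_inj.
rewrite (_ : [set t | _] = set0); first exact: negligible_set0.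
by apply/seteqP; split=> t //= [l [lk _]]; move: Lk; rewrite -lk leqNgt ltn_ord.
Qed.

(** If m^2 is the maximum, the cost L |r|^2 of the uncompressed perturbation is
    small enough.  Otherwise the expected compressed cost is at most
    (4 + 200 x0^4) L |r|^2 m^2 over the maximum, and Markov's inequality loses a
    factor 4. *)
Lemma good_sensing (x0 sigma K : R) (r : 'rV[R]_n) :
  0 <= sigma -> 0 < x0 -> 0 < K -> \sum_i r 0 i = 0 ->
  16 * (1 + 50 * x0 ^+ 4) * (L%:R * (\sum_i r 0 i ^+ 2) * m%:R ^+ 2 /
    Num.max (sigma ^+ 4) (Num.max (m%:R ^+ 2) (n%:R ^+ 2))) <= K ->
  exists2 G : set (L.-tuple 'M[R]_(m, n)), measurable G &
  (P [set t | ~ G (sensing A t)] <= (4^-1)%:E)%E /\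
  (forall a : L.-tuple 'M[R]_(m, n), G a -> L%:R * \sum_i r 0 i ^+ 2 <= K \/
    (forall l, base_cov x0 sigma (tnth a l) \in unitmx) /\
    \sum_l \sum_i \sum_j r 0 i * r 0 j * signal_proj x0 sigma (tnth a l) i j ^+ 2 <= K).
Proof.
move=> s0 x00 K0 rs hK.
set ss := \sum_i r 0 i ^+ 2 in hK *.
have ss0 : 0 <= ss by apply: sumr_ge0 => i _; rewrite sqr_ge0.
have m2 : 0 < m%:R ^+ 2 :> R by rewrite exprn_gt0// ltr0n.
have n2 : 0 < n%:R ^+ 2 :> R by rewrite exprn_gt0// ltr0n.
have x4 : 0 < x0 ^+ 4 by rewrite exprn_gt0.
have Lss : 0 <= L%:R * ss by rewrite mulr_ge0.
have [/andP[nm sm]|caseB] := boolP ((n%:R ^+ 2 <= m%:R ^+ 2 :> R) && (sigma ^+ 4 <= m%:R ^+ 2)).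
  exists setT => //; split=> [|a _]; last first.
    left; apply: le_trans hK; rewrite (max_l nm) (max_r sm) mulfK ?gt_eqF//.
    by nra.
  by rewrite (_ : [set t | _] = set0) ?measure0//; apply/seteqP; split=> t //=; apply.
have mn_sigma : (0 < sigma) || (m <= n)%N.
  have [//|sn] := ltP 0 sigma; rewrite /=; move: caseB.
  have -> : sigma = 0 by apply/eqP; rewrite eq_le sn s0.
  rewrite expr0n/= (ltW m2) andbT -ltNge => mn.
  by apply: ltnW; rewrite -(ltr_nat R) -ltr_sqr// nnegrE.
set alpha := L%:R * (m%:R ^+ 2 * (4 * (1 + 50 * x0 ^+ 4)) * ss /
  Num.max (sigma ^+ 4) (Num.max (m%:R ^+ 2) (n%:R ^+ 2))).
have hcost (mu : probability 'M[R]_(m, n) R) : std_normal_law mu ->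
    \int[mu]_B compressed_cost x0 sigma r B <=
    m%:R ^+ 2 * (4 * (1 + 50 * x0 ^+ 4)) * ss /
      Num.max (sigma ^+ 4) (Num.max (m%:R ^+ 2) (n%:R ^+ 2)).
  move=> hmu; have [al [H1 H2 H3]] := signal_proj0_second_moment sigma hmu m0 n0 x00.
  apply: (le_trans (H1 r rs)); rewrite -/ss [leRHS]mulrAC; apply: ler_wpM2r => //.
  have [sn|sn] := leP (sigma ^+ 4) (n%:R ^+ 2).
    have mn2 : m%:R ^+ 2 <= n%:R ^+ 2 :> R.
      by rewrite leNgt; apply: contra caseB => nm; rewrite (ltW nm) (le_trans sn)// ltW.
    rewrite (max_r mn2) (max_r sn); apply: (le_trans H2).
    rewrite ler_pM2r ?invr_gt0//; nra.
  have sp : 0 < sigma.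
    rewrite lt_neqAle s0 andbT eq_sym; apply: contraTneq sn => ->.
    by rewrite expr0n/= -leNgt ltW.
  have ms : m%:R ^+ 2 <= sigma ^+ 4.
    rewrite leNgt; apply: contra caseB => h; rewrite (ltW h) andbT.
    by apply: ltW; apply: lt_trans h.
  have -> : Num.max (sigma ^+ 4) (Num.max (m%:R ^+ 2) (n%:R ^+ 2)) = sigma ^+ 4.
    by rewrite max_l// ge_max ms ltW.
  apply: (le_trans (H3 sp)); rewrite ler_pM2r ?invr_gt0 ?exprn_gt0//; nra.
pose F (a : L.-tuple 'M[R]_(m, n)) := \sum_l compressed_cost x0 sigma r (tnth a l).
have bF : bmeas F.
  apply: bmeas_sum => l; apply: (bmeas_comp (f := fun B => compressed_cost x0 sigma r B)).
    exact: measurable_tnth.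
  exact: bmeas_compressed_cost.
pose G : set (L.-tuple 'M[R]_(m, n)) := [set a | (forall l, base_cov x0 sigma (tnth a l) \in unitmx) /\ F a <= K].
have mU : measurable [set a : L.-tuple 'M[R]_(m, n) |
    forall l, base_cov x0 sigma (tnth a l) \in unitmx].
  rewrite (_ : [set a | _] = \bigcap_(l in [set: 'I_L])
    ((fun a => \det (base_cov x0 sigma (tnth a l))) @^-1` [set~ 0])).
    apply: fin_bigcap_measurable => // l _; rewrite -[X in measurable X]setTI.
    have md : measurable_fun setT (fun a : L.-tuple 'M[R]_(m, n) =>
        \det (base_cov x0 sigma (tnth a l))).
      apply: measurable_det; apply: (measurableT_comp (@measurable_base_cov R m n x0 sigma)).
      exact: measurable_tnth.
    by apply: md => //; exact: measurableC.
  apply/seteqP; split=> a /= h l => [_|].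
    by have := h l; rewrite unitmxE unitfE => /eqP.
  by rewrite unitmxE unitfE; apply/eqP; exact: (h l).
have mFK : measurable [set a : L.-tuple 'M[R]_(m, n) | F a <= K].
  rewrite (_ : [set a | _] = setT `&` F @^-1` `]-oo, K]); first by apply: bF.1.
  by rewrite setTI; apply/seteqP; split=> a /=; rewrite in_itv.
have mG : measurable G := measurableI _ _ mU mFK.
exists G => //; split; last first.
  move=> a [ua Fa]; right; split=> //; apply: le_trans Fa; rewrite le_eqVlt; apply/orP; left.
  by apply/eqP; apply: eq_bigr => l _; rewrite /compressed_cost signal_proj0E ua.
have [mS S0] := singular_null s0 (lt0r_neq0 x00) mn_sigma.
have bFt : bmeas (fun t => F (sensing A t)).
  by apply: (bmeas_comp (f := F)) => //; exact: measurable_sensing.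
have mK : measurable [set t | K < F (sensing A t)].
  rewrite (_ : [set t | _] = setT `&` (fun t => F (sensing A t)) @^-1` `]K, +oo[).
    by apply: bFt.1.
  by rewrite setTI; apply/seteqP; split=> t /=; rewrite in_itv/= andbT.
have PK : (P [set t | (K < F (sensing A t))%R] <= (4^-1)%:E)%E.
  apply: markov_bmeas => // [t|]; first by apply: sumr_ge0 => l _; exact: compressed_cost_ge0.
  have -> : \int[P]_t F (sensing A t) =
      \int[P]_t (\sum_l compressed_cost x0 sigma r (A l t)).
    by apply: eq_Rintegral => t _; apply: eq_bigr => l _; rewrite tnth_mktuple.
  apply: (le_trans (expected_cost hcost)); rewrite -/alpha.
  have h4 : 0 < 4 :> R by [].
  rewrite -(ler_pM2l h4) [leRHS]mulrA mulfV ?gt_eqF// mul1r /alpha.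
  by apply: le_trans hK; rewrite le_eqVlt; apply/orP; left; apply/eqP; rewrite !mulrA; ring.
apply: (@le_trans _ _ (P ([set t | exists l, base_cov x0 sigma (A l t) \notin unitmx] `|`
   [set t | (K < F (sensing A t))%R])))%E.
  apply: le_measure; rewrite ?inE; last 2 first.
  - exact: measurableU.
  - move=> t /= nG; apply: contrapT => nU; apply: nG; split.
      move=> l; apply/negPn/negP => bad; apply: nU; left; exists l.
      by move: bad; rewrite tnth_mktuple.
    by rewrite leNgt; apply/negP => KF; apply: nU; right.
  - rewrite -[X in measurable X]setTI.
    exact: (measurable_sensing A measurableT (measurableC mG)).
have US := measureU2 P mS mK.
apply: (le_trans US); rewrite -[leRHS]add0e; apply: leeD => //.
by rewrite le_eqVlt; apply/orP; left; apply/eqP; exact: S0.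
Qed.

End good_event.

(** * The packing *)

Section packing.
Context (R : realType) (k M s n : nat).

Definition slot : Type := ('I_k * 'I_M * ('I_s * bool))%type.

Hypothesis room : (k * M * (s * 2) <= n)%N.

Lemma slot_room : (#|{: 'I_k * 'I_M * ('I_s * bool)}| <= n)%N.
Proof. by rewrite !card_prod !card_ord card_bool. Qed.

Definition position (x : slot) : 'I_n := widen_ord slot_room (enum_rank x).

Lemma position_inj : injective position.
Proof.
by move=> x y /(congr1 val)/= /ord_inj/enum_rank_inj.
Qed.

Variables (x0 delta : R).

Definition offset (b : bool) : R := if b then delta else - delta.

(** The relative perturbation of the squared signal: in its segment [a], the
    signal [J] differs from the constant [x0] on the block [J a] only, with as
    many raised as lowered entries. *)
Definition pattern (J : {ffun 'I_k -> 'I_M}) : 'rV[R]_n :=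
  \row_i \sum_(x : slot | position x == i) (if J x.1.1 == x.1.2 then offset x.2.2 else 0).

Lemma patternE J x : pattern J 0 (position x) = if J x.1.1 == x.1.2 then offset x.2.2 else 0.
Proof.
rewrite mxE (bigD1 x)//= big1 ?addr0// => y /andP[/eqP/position_inj->].
by rewrite eqxx.
Qed.

Lemma sum_position (f : 'I_n -> R) : (forall i, (forall x, position x != i) -> f i = 0) ->
  \sum_i f i = \sum_(x : slot) f (position x).
Proof.
move=> f0; rewrite (bigID (fun i => i \in [set position x | x in [set: slot]]%SET))/=.
rewrite [X in _ + X]big1 ?addr0; last first.
  move=> i ni; apply: f0 => x; apply: contraNneq ni => <-; exact: imset_f.
rewrite big_imset/=; last by move=> x y _ _; exact: position_inj.
by apply: eq_bigl => x; rewrite inE.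
Qed.

Lemma pattern_out J i : (forall x, position x != i) -> pattern J 0 i = 0.
Proof. by move=> h; rewrite mxE big1// => x; rewrite (negbTE (h x)). Qed.

Lemma sum_slot (f : 'I_k -> 'I_M -> 'I_s * bool -> R) :
  \sum_(x : slot) f x.1.1 x.1.2 x.2 = \sum_a \sum_b \sum_y f a b y.
Proof.
rewrite (pair_big xpredT xpredT) (pair_big xpredT xpredT)/=.
by apply: eq_bigr => -[[a b] y].
Qed.

Lemma pattern_sum J (phi : R -> R) : phi 0 = 0 ->
  \sum_i phi (pattern J 0 i) = (k * s)%:R * (phi delta + phi (- delta)).
Proof.
move=> phi0; rewrite sum_position; last by move=> i h; rewrite pattern_out.
under eq_bigr do rewrite patternE.
rewrite (sum_slot (fun a b y => phi (if J a == b then offset y.2 else 0))).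
rewrite (eq_bigr (fun=> s%:R * (phi delta + phi (- delta)))); last first.
  move=> a _; rewrite (bigD1 (J a))//= [X in _ + X]big1 ?addr0; last first.
    by move=> b bJ; apply: big1 => y _; rewrite eq_sym (negbTE bJ).
  rewrite (eq_bigr (fun y : 'I_s * bool => phi (offset y.2))) => [|y _]; last by rewrite eqxx.
  rewrite -(pair_big xpredT xpredT (fun (_ : 'I_s) e => phi (offset e)))/=.
  rewrite sumr_const card_ord -[_ *+ s]mulr_natl; congr (_ * _).
  by rewrite big_bool.
by rewrite sumr_const card_ord -[_ *+ k]mulr_natl natrM mulrA.
Qed.

Lemma pattern_le J i : 0 <= delta -> `|pattern J 0 i| <= delta.
Proof.
move=> d0; have [[x <-]|no] := pselect (exists x, position x = i).
  rewrite patternE /offset; case: ifP => _; last by rewrite normr0.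
  by case: ifP => _; rewrite ?normrN ger0_norm.
rewrite pattern_out ?normr0// => x; apply/negP => /eqP h; apply: no; by exists x.
Qed.

Definition signal (r : 'rV[R]_n) : 'cV[R]_n := \col_i (x0 * Num.sqrt (1 + r 0 i)).

(** The part of the squared distance from [v] to the signal [J] that lies in the
    segment [a], when [b] is the value of [J] there. *)
Definition segment_cost (v : 'cV[R]_n) a b : R :=
  \sum_b' \sum_(y : 'I_s * bool) (v (position (a, b', y)) 0 -
     x0 * Num.sqrt (1 + if b == b' then offset y.2 else 0)) ^+ 2.

Lemma segment_cost_ge0 v a b : 0 <= segment_cost v a b.
Proof. by apply: sumr_ge0 => b' _; apply: sumr_ge0 => y _; rewrite sqr_ge0. Qed.

Lemma segment_cost_le (v : 'cV[R]_n) (J : {ffun 'I_k -> 'I_M}) :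
  \sum_a segment_cost v a (J a) <= \sum_i (v i 0 - signal (pattern J) i 0) ^+ 2.
Proof.
rewrite (bigID (fun i => i \in [set position x | x in [set: slot]]%SET))/=.
rewrite big_imset/=; last by move=> x y _ _; exact: position_inj.
rewrite [X in _ <= X + _](eq_bigl xpredT) => [|x]; last by rewrite inE.
have := sum_slot (fun a b' y => (v (position (a, b', y)) 0 -
     x0 * Num.sqrt (1 + if J a == b' then offset y.2 else 0)) ^+ 2).
rewrite /segment_cost => <-; rewrite -[leLHS]addr0; apply: lerD.
  rewrite le_eqVlt; apply/orP; left; apply/eqP; apply: eq_bigr => -[[a b'] y] _.
  by rewrite [signal _ _ _]mxE patternE.
by apply: sumr_ge0 => i _; rewrite sqr_ge0.
Qed.

Definition decoding_radius : R := s%:R * (x0 * delta / 3) ^+ 2.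

Lemma offset_gap e : 0 <= x0 -> 0 <= delta <= 1 ->
  (x0 * delta / 3) ^+ 2 <= (x0 * Num.sqrt (1 + offset e) - x0) ^+ 2.
Proof.
move=> x00 /andP[d0 d1]; set q := Num.sqrt (1 + offset e).
have q0 : 0 <= q by exact: sqrtr_ge0.
have b1 : 0 <= 1 + offset e by rewrite /offset; case: e {q q0}; lra.
have q2 : q ^+ 2 = 1 + offset e by rewrite sqr_sqrtr.
have qle : q <= 2 by rewrite -(ler_pXn2r (n := 2))// ?nnegrE// q2 /offset; case: e {q q0 b1 q2}; lra.
rewrite (_ : x0 * delta / 3 = x0 * (delta / 3)); last by rewrite mulrA.
rewrite (_ : x0 * q - x0 = x0 * (q - 1)); last by ring.
rewrite !exprMn; apply: ler_wpM2l; first exact: sqr_ge0.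
have dq : delta ^+ 2 = (q - 1) ^+ 2 * (q + 1) ^+ 2.
  rewrite -exprMn (_ : (q - 1) * (q + 1) = q ^+ 2 - 1); last by ring.
  by rewrite q2 /offset; case: e {q q0 b1 q2 qle}; ring.
rewrite dq (_ : (q - 1) ^+ 2 * (q + 1) ^+ 2 * 3^-1 ^+ 2 = (q - 1) ^+ 2 * ((q + 1) / 3) ^+ 2).
  rewrite -[leRHS]mulr1; apply: ler_wpM2l; first exact: sqr_ge0.
  by rewrite expr_le1//; lra.
by field.
Qed.

(** On each of the blocks [b] and [b'] one of the two signals is modified and the
    other is not. *)
Lemma segment_cost_gap v a b b' : 0 <= x0 -> 0 <= delta <= 1 -> b != b' ->
  2 * decoding_radius <= segment_cost v a b + segment_cost v a b'.
Proof.
move=> x00 d01 bb'.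
have two (u g : R) : (u - g) ^+ 2 + (u - x0) ^+ 2 >= 2^-1 * (g - x0) ^+ 2.
  have := sqr_ge0 (2 * u - g - x0); lra.
have half : decoding_radius <= 2^-1 * \sum_(y : 'I_s * bool) (x0 * Num.sqrt (1 + offset y.2) - x0) ^+ 2.
  apply: (@le_trans _ _ (2^-1 * \sum_(y : 'I_s * bool) (x0 * delta / 3) ^+ 2)); last first.
    by rewrite ler_pM2l//; apply: ler_sum => y _; exact: offset_gap.
  rewrite sumr_const card_prod card_ord card_bool -[_ *+ (s * 2)]mulr_natl natrM /decoding_radius.
  by rewrite le_eqVlt; apply/orP; left; apply/eqP; field.
rewrite /segment_cost -big_split/= (bigD1 b)//= (bigD1 b')/=; last by rewrite eq_sym.
rewrite [2 * decoding_radius](_ : _ = decoding_radius + (decoding_radius + 0)); last by ring.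
have eqs : Num.sqrt (1 + 0) = 1 :> R by rewrite addr0 sqrtr1.
apply: lerD; last apply: lerD; last first.
- apply: sumr_ge0 => c _; apply: addr_ge0; apply: sumr_ge0 => y _; exact: sqr_ge0.
- apply: (le_trans half); rewrite -big_split/= mulr_sumr; apply: ler_sum => y _.
  by rewrite eqxx (negbTE bb') eqs mulr1 addrC; exact: two.
- apply: (le_trans half); rewrite -big_split/= mulr_sumr; apply: ler_sum => y _.
  by rewrite eqxx eq_sym (negbTE bb') eqs mulr1; exact: two.
Qed.

(** With the threshold at half of the segments, an undecoded signal still costs
    k / 2 radii, while few signals are decoded at once. *)
Definition decoded (v : 'cV[R]_n) (J : {ffun 'I_k -> 'I_M}) : bool :=
  (k <= 2 * #|[set a | (segment_cost v a (J a) < decoding_radius)%R]%SET|)%N.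

Lemma undecoded_cost v J : ~~ decoded v J ->
  k%:R * decoding_radius / 2 <= \sum_i (v i 0 - signal (pattern J) i 0) ^+ 2.
Proof.
rewrite /decoded -ltnNge => few; apply: le_trans (segment_cost_le v J).
set S := [set a | _]%SET in few.
rewrite (bigID (mem S))/=.
have rad0 : 0 <= decoding_radius by rewrite /decoding_radius mulr_ge0// sqr_ge0.
have S0 : 0 <= \sum_(a in S) segment_cost v a (J a).
  by apply: sumr_ge0 => a _; exact: segment_cost_ge0.
have : \sum_(a in ~: S) decoding_radius <= \sum_(a | a \notin S) segment_cost v a (J a).
  rewrite (eq_bigl (fun a => a \notin S)) => [|a]; last by rewrite inE.
  by apply: ler_sum => a; rewrite inE -leNgt.
rewrite sumr_const -[_ *+ _]mulr_natl => le1.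
have : k%:R / 2 <= #|~: S|%:R :> R.
  rewrite ler_pdivrMr// -natrM ler_nat; have := cardsC S; rewrite card_ord; lia.
move=> le2; apply: (@le_trans _ _ (#|~: S|%:R * decoding_radius)).
  by rewrite mulrAC; apply: ler_wpM2r.
by rewrite -[leLHS]add0r; apply: lerD.
Qed.

(** Chernoff counting: at most one value per segment is close to [v], so with
    weights M^(number of close segments) the sum over all [J] factorizes. *)
Lemma count_decoded v : 0 <= x0 -> 0 <= delta <= 1 -> (0 < M)%N ->
  \sum_J (decoded v J)%:R <= (2 * M%:R / Num.sqrt M%:R) ^+ k :> R.
Proof.
move=> x00 d01 M0; set y := Num.sqrt M%:R.
have M1 : 1 <= M%:R :> R by rewrite ler1n.
have y1 : 1 <= y by rewrite -sqrtr1 ler_wsqrtr.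
have y0 : 0 < y by exact: lt_le_trans y1.
have yy : y ^+ 2 = M%:R by rewrite sqr_sqrtr// ler0n.
pose g a b := segment_cost v a b < decoding_radius.
pose h a b : R := if g a b then M%:R else 1.
have le1 J : (decoded v J)%:R <= (y ^+ k)^-1 * \prod_a h a (J a).
  have hE : \prod_a h a (J a) = y ^+ (2 * #|[set a | g a (J a)]%SET|).
    rewrite (bigID (fun a => g a (J a)))/= [X in _ * X]big1 ?mulr1; last first.
      by move=> a; rewrite /h => /negbTE->.
    rewrite (eq_bigr (fun=> y ^+ 2)) => [|a ga]; last by rewrite /h ga yy.
    rewrite prodr_const exprM; congr (_ ^+ _); apply: eq_card => a.
    by rewrite !inE.
  rewrite hE; case: (boolP (decoded v J)) => dec; last first.
    by rewrite mulr_ge0// ?invr_ge0 exprn_ge0// ltW.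
  rewrite mulrC ler_pdivlMr ?exprn_gt0// mul1r; exact: ler_weXn2l.
apply: (le_trans (ler_sum _ (fun J _ => le1 J))).
rewrite -mulr_sumr -(bigA_distr_bigA (fun a b => h a b)) /=.
rewrite expr_div_n mulrC; apply: ler_wpM2r; first by rewrite invr_ge0 exprn_ge0// ltW.
rewrite -[X in _ <= _ ^+ X](card_ord k) -prodr_const; apply: ler_prod => a _.
apply/andP; split; first by apply: sumr_ge0 => b _; rewrite /h; case: ifP.
have sum1 : \sum_b (if g a b then 1 else 0) <= 1 :> R.
  have [[b gb]|no] := pselect (exists b, g a b); last first.
    by rewrite big1// => b _; case: ifP => // gb; exfalso; apply: no; exists b.
  rewrite (bigD1 b)//= gb big1 ?addr0// => b' bb'; case: ifP => // gb'.
  have := segment_cost_gap v a x00 d01 bb'; rewrite /g in gb gb'; lra.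
apply: (@le_trans _ _ (\sum_b (1 + (M%:R * (if g a b then 1 else 0))))).
  by apply: ler_sum => b _; rewrite /h; case: ifP => _; lra.
rewrite big_split/= sumr_const card_ord -mulr_sumr -[1 *+ M]mulr_natl mulr1.
by rewrite mulr_natl mulr2n lerD2l -[leRHS]mulr1; apply: ler_wpM2l.
Qed.

End packing.

(** * Testing the signals against the flat one *)

Lemma measurable_decoded (R : realType) k M s n (room : (k * M * (s * 2) <= n)%N)
    (x0 delta : R) (J : {ffun 'I_k -> 'I_M}) :
  measurable [set v : 'cV[R]_n | decoded room x0 delta v J].
Proof.
pose U (a : 'I_k) := [set v : 'cV[R]_n | segment_cost room x0 delta v a (J a) < decoding_radius s x0 delta].
have mU a : measurable (U a).
  rewrite (_ : U a = setT `&` (fun v => segment_cost room x0 delta v a (J a)) @^-1`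
     `]-oo, decoding_radius s x0 delta[); last first.
    by rewrite setTI; apply/seteqP; split=> v /=; rewrite in_itv.
  have mf : measurable_fun [set: 'cV[R]_n] (fun v => segment_cost room x0 delta v a (J a)).
    apply: measurable_sum => b; apply: measurable_sum => y; apply: measurable_funX.
    by apply: measurable_funB => //; exact: measurable_entry.
  by apply: mf.
rewrite (_ : [set v | _] = \bigcup_(S in [set S : {set 'I_k} | (k <= 2 * #|S|)%N])
   \bigcap_(a in [set` S]) U a).
  by apply: fin_bigcup_measurable => // S _; apply: fin_bigcap_measurable.
apply/seteqP; split=> v /=.
  move=> dv; exists [set a | segment_cost room x0 delta v a (J a) < decoding_radius s x0 delta]%SET => //.
  by move=> a /=; rewrite inE.
case=> S /= kS h; apply: leq_trans kS _; rewrite leq_mul2l/=; apply: subset_leq_card.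
by apply/fintype.subsetP => a aS; rewrite inE; exact: (h a aS).
Qed.

Lemma average_contra (R : realFieldType) (Y Z e : R) : 0 < Y * Y ->
  32 * e * Z * Y <= Y * Y ->
  Y * Y / 2 <= Y * Y * (8^-1 + 4^-1) + 2 * e * (Z * Y) -> False.
Proof. lra. Qed.

Section testing.
Context (R : realType) d (T : measurableType d) (P : probability T R) (m n L : nat).
Context (A : 'I_L -> {RV P >-> 'M[R]_(m, n)}) (w : 'I_L -> {RV P >-> 'cV[R]_n})
  (z : 'I_L -> {RV P >-> 'cV[R]_m}) (sigma : R).
Hypothesis model : gaussian_model A w z sigma.
Hypotheses (sigma0 : 0 <= sigma) (m0 : (0 < m)%N) (n0 : (0 < n)%N).
Context (k M s : nat) (room : (k * M * (s * 2) <= n)%N) (x0 delta : R).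
Hypotheses (x00 : 0 < x0) (d0 : 0 <= delta) (d2 : delta <= 2^-1) (M0 : (0 < M)%N).

Let d01 : 0 <= delta <= 1. Proof. by rewrite d0 /= (le_trans d2)//; lra. Qed.

Let x_ (J : {ffun 'I_k -> 'I_M}) : 'cV[R]_n := signal x0 (pattern room delta J).

Lemma signal_sqr (r : 'rV[R]_n) i : `|r 0 i| <= 2^-1 ->
  signal x0 r i 0 ^+ 2 = x0 ^+ 2 * (1 + r 0 i).
Proof. by move=> r2; rewrite mxE exprMn sqr_sqrtr//; move: r2; rewrite ler_norml; lra. Qed.

Variable xhat : @estimator R m n L.

Lemma measurable_estimate x : measurable_fun setT (estimate A w z xhat x).
Proof.
rewrite (_ : estimate A w z xhat x =
  (fun t => xhat (data_map x (sensing A t, speckle_noise w z t)))).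
  apply: (measurableT_comp (measurable_funPT xhat)).
  apply: (measurableT_comp (measurable_data_map x)); apply: measurable_fun_pair.
    exact: measurable_sensing.
  exact: measurable_speckle_noise.
by apply/funext => t; rewrite /estimate data_mapE.
Qed.

Lemma mse_bound_ge0 : 0 <= k%:R * decoding_radius s x0 delta / 2 / n%:R.
Proof. by rewrite divr_ge0// divr_ge0// mulr_ge0// mulr_ge0// sqr_ge0. Qed.

Lemma mse_undecoded J :
  ((k%:R * decoding_radius s x0 delta / 2 / n%:R)%:E *
    P [set t | ~~ decoded room x0 delta (estimate A w z xhat (x_ J) t) J] <=
   mean_square_error A w z xhat (x_ J))%E.
Proof.
have nR : 0 < n%:R :> R by rewrite ltr0n.
have c0 := mse_bound_ge0; set c := k%:R * _ / _ / _ in c0 *.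
have mest := measurable_estimate (x_ J).
have mE : measurable [set t | ~~ decoded room x0 delta (estimate A w z xhat (x_ J) t) J].
  rewrite (_ : [set t | _] = setT `&` (fun t => estimate A w z xhat (x_ J) t) @^-1`
      (~` [set v | decoded room x0 delta v J])).
    by apply: mest => //; apply: measurableC; exact: measurable_decoded.
  by rewrite setTI; apply/seteqP; split=> t /= /negP.
pose F t := \sum_i (estimate A w z xhat (x_ J) t i 0 - x_ J i 0) ^+ 2 / n%:R.
have FE t : l2norm (estimate A w z xhat (x_ J) t - x_ J) ^+ 2 / n%:R = F t.
  rewrite /l2norm sqr_sqrtr; last by apply: sumr_ge0 => i _; rewrite sqr_ge0.
  by rewrite /F mulr_suml; apply: eq_bigr => i _; rewrite !mxE.
rewrite /mean_square_error unlock; under eq_integral do rewrite FE.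
have F0 t : (0 <= (F t)%:E)%E.
  by rewrite lee_fin; apply: sumr_ge0 => i _; rewrite divr_ge0 ?sqr_ge0.
have mF : measurable_fun setT (fun t => (F t)%:E).
  apply/measurable_EFinP; apply: measurable_sum => i; apply: measurable_funM => //.
  apply: measurable_funX; apply: measurable_funB => //.
  by move/measurable_mxP : mest; exact.
set E := [set t | _] in mE *.
apply: (@le_trans _ _ (\int[P]_(t in E) (F t)%:E)%E); last exact: ge0_subset_integral.
rewrite -integral_cst//; apply: ge0_le_integral => //.
- exact: (measurable_funS measurableT).
- move=> t /= nd; rewrite lee_fin /c /F -mulr_suml; apply: ler_wpM2r.
    by rewrite invr_ge0 ltW.
  exact: undecoded_cost.
Qed.

Lemma pattern_half J i : `|pattern room delta J 0 i| <= 2^-1.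
Proof. exact: le_trans (pattern_le room J i d0) d2. Qed.

(** The failure probability 1/4 of the sensing matrices is added to the bound of
    [model_perturbation]. *)
Lemma decoded_prob (kappa t : R) J : 0 < t -> 0 < kappa ->
  16 * (1 + 50 * x0 ^+ 4) * (L%:R * ((k * s)%:R * (delta ^+ 2 + (- delta) ^+ 2)) * m%:R ^+ 2 /
    Num.max (sigma ^+ 4) (Num.max (m%:R ^+ 2) (n%:R ^+ 2))) <= kappa ->
  (P [set u | decoded room x0 delta (estimate A w z xhat (x_ J) u) J] <=
   (t * expR kappa + 4^-1)%:E + ((4 * t)^-1)%:E *
   P [set u | decoded room x0 delta (estimate A w z xhat (const_mx x0) u) J])%E.
Proof.
move=> t0 kap0 hK.
have rs : \sum_i pattern room delta J 0 i = 0.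
  by rewrite (pattern_sum room delta J (phi := id))// subrr mulr0.
have hK' := hK.
rewrite -(pattern_sum room delta J (phi := fun y => y ^+ 2) (expr0n _ 2)) in hK'.
have [G mG [PG hG]] := good_sensing (sensing_gaussian model) m0 n0 (r := pattern room delta J)
  sigma0 x00 kap0 rs hK'.
pose B : set (L.-tuple 'cV[R]_m * L.-tuple 'M[R]_(m, n)) :=
  [set D | decoded room x0 delta (xhat D) J].
have mB : measurable B.
  have := @measurable_funPT _ _ _ _ xhat measurableT _ (measurable_decoded room x0 delta J).
  by rewrite setTI.
have estE x : [set u | decoded room x0 delta (estimate A w z xhat x u) J] =
    [set u | B (data_map x (sensing A u, speckle_noise w z u))].
  by apply/seteqP; split=> u /=; rewrite /estimate data_mapE.
rewrite (estE (x_ J)) (estE (const_mx x0)).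
have h := model_perturbation model sigma0 t0
  (fun i => signal_sqr (pattern_half J i)) (pattern_half J) mB mG hG.
have mdata x : measurable [set u | B (data_map x (sensing A u, speckle_noise w z u))].
  rewrite -[X in measurable X]setTI.
  have md : measurable_fun setT (fun u => data_map x (sensing A u, speckle_noise w z u)).
    apply: (measurableT_comp (measurable_data_map x)); apply: measurable_fun_pair.
      exact: measurable_sensing.
    exact: measurable_speckle_noise.
  exact: (md measurableT _ mB).
have mGt : measurable [set u | G (sensing A u)].
  by rewrite -[X in measurable X]setTI; exact: (measurable_sensing A measurableT mG).
pose E := [set u | B (data_map (x_ J) (sensing A u, speckle_noise w z u))].
have mE : measurable E by exact: mdata.
apply: (@le_trans _ _ (P ((E `&` [set u | G (sensing A u)]) `|` ~` [set u | G (sensing A u)]))).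
  apply: le_measure; rewrite ?inE//.
    by apply: measurableU; [exact: measurableI|exact: measurableC].
  move=> u Eu; have [Gu|nGu] := pselect (G (sensing A u)).
    exact: (or_introl (conj Eu Gu)).
  exact: (or_intror nGu).
apply: (le_trans (measureU2 P (measurableI _ _ mE mGt) (measurableC mGt))).
apply: (le_trans (leeD h PG)); rewrite EFinD.
by rewrite -!addeA; apply: leeD2l; rewrite addeC.
Qed.

(** On average over J, the probability of decoding is at most
    1/8 + 1/4 + 2 expR kappa (2 / sqrt M)^k < 1/2. *)
Lemma testing_lower_bound (kappa : R) : 0 < kappa ->
  16 * (1 + 50 * x0 ^+ 4) * (L%:R * ((k * s)%:R * (delta ^+ 2 + (- delta) ^+ 2)) * m%:R ^+ 2 /
    Num.max (sigma ^+ 4) (Num.max (m%:R ^+ 2) (n%:R ^+ 2))) <= kappa ->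
  32 * expR kappa * 2 ^+ k <= Num.sqrt M%:R ^+ k ->
  exists J, ((k%:R * decoding_radius s x0 delta / 2 / n%:R * 2^-1)%:E <=
    mean_square_error A w z xhat (x_ J))%E.
Proof.
move=> kap0 hK hM.
pose E0 J := [set u | decoded room x0 delta (estimate A w z xhat (const_mx x0) u) J].
pose E1 J := [set u | decoded room x0 delta (estimate A w z xhat (x_ J) u) J].
suff [J hJ] : exists J, (P (E1 J) <= (2^-1)%:E)%E.
  exists J; apply: le_trans (mse_undecoded J); rewrite EFinM; apply: lee_wpmul2l.
    by rewrite lee_fin mse_bound_ge0.
  have mE : measurable (E1 J).
    rewrite (_ : E1 J = setT `&` (fun t => estimate A w z xhat (x_ J) t) @^-1`
        [set v | decoded room x0 delta v J]).
      by apply: measurable_estimate => //; exact: measurable_decoded.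
    by rewrite setTI.
  have -> : [set u | ~~ decoded room x0 delta (estimate A w z xhat (x_ J) u) J] = ~` E1 J.
    by apply/seteqP; split=> u /= /negP.
  rewrite probability_setC// leeBrDr ?fin_num_measure//.
  apply: (le_trans (leeD2l _ hJ)); rewrite -EFinD lee_fin; lra.
apply: contrapT => no.
have big J : ((2^-1)%:E < P (E1 J))%E.
  by rewrite ltNge; apply/negP => h; apply: no; exists J.
(* with this t the first term of the perturbation bound is 1/8 *)
pose t := (8 * expR kappa)^-1.
have e0 := expR_gt0 kappa.
have t0 : 0 < t by rewrite invr_gt0 mulr_gt0.
have tE : t * expR kappa = 8^-1 by rewrite /t invfM -mulrA mulVf ?gt_eqF// mulr1.
have t4 : (4 * t)^-1 = 2 * expR kappa by rewrite /t invfM invrK; field.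
have bnd J : (P (E1 J) <= (8^-1 + 4^-1)%:E + (2 * expR kappa)%:E * P (E0 J))%E.
  by have := decoded_prob J t0 kap0 hK; rewrite tE t4.
have sum0 : (\sum_J P (E0 J) <= ((2 * M%:R / Num.sqrt M%:R) ^+ k)%:E)%E.
  have mE0 J : measurable (E0 J).
    rewrite (_ : E0 J = setT `&` (fun t => estimate A w z xhat (const_mx x0) t) @^-1`
        [set v | decoded room x0 delta v J]).
      by apply: measurable_estimate => //; exact: measurable_decoded.
    by rewrite setTI.
  rewrite (eq_bigr (fun J => \int[P]_u (\1_(E0 J) u : R)%:E)%E) => [|J _]; last first.
    by rewrite integral_indic// setIT.
  rewrite -ge0_integral_sum//; last first.
    by move=> J; apply/measurable_EFinP; exact: measurable_indic.
  apply: (@le_trans _ _ (\int[P]_u (cst (((2 * M%:R / Num.sqrt M%:R) ^+ k)%:E) u))%E).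
    apply: ge0_le_integral => //.
    - by move=> u _; apply: sume_ge0.
    - apply: emeasurable_sum => J; apply/measurable_EFinP; exact: measurable_indic.
    - move=> u _ /=; rewrite sumEFin lee_fin.
      have := count_decoded room (estimate A w z xhat (const_mx x0) u) (ltW x00) d01 M0.
      apply: le_trans; rewrite le_eqVlt; apply/orP; left; apply/eqP; apply: eq_bigr => J _.
      by rewrite indicE; congr ((nat_of_bool _)%:R); apply/idP/idP; rewrite inE.
  by rewrite integral_cst// -[leRHS]mule1; apply: lee_wpmul2l;
    [rewrite lee_fin exprn_ge0// divr_ge0// mulr_ge0|exact: probability_le1].
have : (\sum_(J : {ffun 'I_k -> 'I_M}) (2^-1)%:E <=
    \sum_(J : {ffun 'I_k -> 'I_M}) ((8^-1 + 4^-1)%:E + (2 * expR kappa)%:E * P (E0 J)))%E.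
  by apply: lee_sum => J _; apply: le_trans (bnd J); exact: ltW.
rewrite big_split/= !sumEFin !sumr_const card_ffun !card_ord -ge0_sume_distrr//.
move=> h.
have e2 : (0 <= (2 * expR kappa)%:E :> \bar R)%E by rewrite lee_fin mulr_ge0// ltW.
have {h} := le_trans h (leeD2l _ (lee_wpmul2l e2 sum0)).
rewrite -EFinM -EFinD lee_fin => h.
pose y := Num.sqrt (M%:R : R).
have y0 : 0 < y by rewrite sqrtr_gt0 ltr0n.
have MR : M%:R = y * y :> R by rewrite -expr2 sqr_sqrtr.
have yk0 : 0 < y ^+ k by rewrite exprn_gt0.
have NE : (M ^ k)%:R = y ^+ k * y ^+ k :> R by rewrite natrX MR exprMn.
have cE : (2 * M%:R / Num.sqrt M%:R) ^+ k = 2 ^+ k * y ^+ k.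
  by rewrite -/y -exprMn MR; congr (_ ^+ k); field; rewrite gt_eqF.
move: h; rewrite cE -[_ *+ (M ^ k)]mulr_natl -[(_ + _) *+ (M ^ k)]mulr_natl NE.
have := ler_wpM2r (ltW yk0) hM; rewrite -/y.
have := mulr_gt0 yk0 yk0.
exact: average_contra.
Qed.

End testing.

(** * The packing belongs to the signal class *)

Section class.
Context (R : realType) (k M s n : nat) (room : (k * M * (s * 2) <= n)%N).
Hypotheses (k0 : (0 < k)%N) (M0 : (0 < M)%N) (s0 : (0 < s)%N).
Context (xmin xmax x0 delta : R).
Hypotheses (xmin0 : 0 < xmin) (x0E : x0 = (xmin + xmax) / 2) (xmm : xmin < xmax).
Hypotheses (d0 : 0 <= delta) (d1 : delta <= 1) (dx : x0 * delta <= (xmax - xmin) / 2).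

Let x_ (J : {ffun 'I_k -> 'I_M}) : 'cV[R]_n := signal x0 (pattern room delta J).

Lemma sqrt_offset (r : R) : `|r| <= delta -> `|x0 * Num.sqrt (1 + r) - x0| <= (xmax - xmin) / 2.
Proof.
have [hm [hmm [hd0 [hd1 hdx]]]] := (conj xmin0 (conj xmm (conj d0 (conj d1 dx)))).
rewrite ler_norml => /andP[r1 r2]; have x00 : 0 < x0 by rewrite x0E; lra.
have q0 := sqrtr_ge0 (1 + r).
have q2 : Num.sqrt (1 + r) ^+ 2 = 1 + r by rewrite sqr_sqrtr//; lra.
set q := Num.sqrt (1 + r) in q0 q2 *.
have q_le : q - 1 <= delta.
  rewrite lerBlDr -(ler_pXn2r (n := 2))// ?nnegrE//; last by lra.
  by rewrite q2; nra.
have q_ge : - delta <= q - 1.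
  rewrite lerBrDr -(ler_pXn2r (n := 2))// ?nnegrE//; last by lra.
  by rewrite q2; nra.
rewrite (_ : x0 * q - x0 = x0 * (q - 1)); last by ring.
rewrite normrM (gtr0_norm x00); apply: le_trans dx; apply: ler_wpM2l; first exact: ltW.
by rewrite ler_norml q_ge q_le.
Qed.

Lemma signal_range J i : xmin <= x_ J i 0 <= xmax.
Proof.
have := sqrt_offset (pattern_le room J i d0); rewrite [x_ J i 0]mxE ler_norml.
by move: (x0 * _) => u; rewrite x0E => /andP[? ?]; apply/andP; split; lra.
Qed.

Lemma signal_center J : l2norm (x_ J - const_mx x0) <=
  (xmax - xmin) * Num.sqrt (2 * k%:R * s%:R).
Proof.
have xd : 0 < xmax - xmin by rewrite subr_gt0.
rewrite -[leRHS]ger0_norm; last by rewrite mulr_ge0// ?sqrtr_ge0// ltW.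
rewrite -sqrtr_sqr exprMn sqr_sqrtr ?mulr_ge0// /l2norm ler_wsqrtr//.
pose phi r := (x0 * Num.sqrt (1 + r) - x0) ^+ 2.
rewrite (eq_bigr (fun i => phi (pattern room delta J 0 i))); last first.
  by move=> i _; rewrite !mxE.
rewrite (pattern_sum room delta J (phi := phi)); last first.
  by rewrite /phi addr0 sqrtr1 mulr1 subrr expr0n.
have hmm := xmm; have phi_le r : `|r| <= delta -> phi r <= (xmax - xmin) ^+ 2.
  move=> /sqrt_offset h; rewrite /phi -real_normK ?num_real// ler_sqr ?nnegrE//; last exact: ltW.
  by apply: (le_trans h); lra.
have h1 : phi delta <= (xmax - xmin) ^+ 2 by apply: phi_le; rewrite ger0_norm.
have h2 : phi (- delta) <= (xmax - xmin) ^+ 2 by apply: phi_le; rewrite normrN ger0_norm.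
have ks0 : 0 <= k%:R * s%:R :> R by rewrite mulr_ge0.
rewrite natrM -[2 * _ * _]mulrA.
have := ler_wpM2l ks0 (lerD h1 h2); move: (k%:R * s%:R) => u; lra.
Qed.

(** At scales above the diameter one ball suffices; below, one ball per signal,
    and n / (2 k s) >= M makes room for them. *)
Lemma packing_class (a b : R) : xmax - xmin <= a -> 1 <= b ->
  signal_class xmin xmax a b k (range x_).
Proof.
move=> xa b1; have a0 : 0 < a by apply: lt_le_trans xa; rewrite subr_gt0.
have ksM : (M * (2 * k * s) <= n)%N by apply: leq_trans room; lia.
have n0 : (0 < n)%N by apply: leq_trans ksM; rewrite !muln_gt0 M0 k0 s0.
have n1 : 1 <= n%:R :> R by rewrite ler1n.
have nb : n%:R <= n%:R `^ b by rewrite -[X in X <= _]powRr1// ler_powR.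
have ks1 : 1 <= 2 * k%:R * s%:R :> R by rewrite -!natrM ler1n !muln_gt0 k0 s0.
split.
- exists (x_ [ffun=> Ordinal M0]); exists [ffun=> Ordinal M0] => //.
- by move=> _ [J _ <-] i; exact: signal_range.
- move=> eta /andP[eta0 etale].
  set q := a * _ / eta.
  have q1 : 1 <= q by rewrite /q ler_pdivlMr// mul1r.
  have [big|small] := leP (a * Num.sqrt (2 * k%:R * s%:R)) eta.
    apply: (@le_trans _ _ (1%:R)%:E); last by rewrite lee_fin exprn_ege1.
    apply: ereal_inf_lbound; exists 1%N => //; exists (fun=> const_mx x0).
    move=> _ [J _ <-]; exists ord0; apply: (le_trans (signal_center J)).
    by apply: le_trans big; apply: ler_wpM2r => //; exact: sqrtr_ge0.
  apply: (@le_trans _ _ ((M ^ k)%:R)%:E).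
    have cE : #|{: {ffun 'I_k -> 'I_M}}| = (M ^ k)%N by rewrite card_ffun !card_ord.
    apply: ereal_inf_lbound; exists (M ^ k)%N => //; rewrite -cE.
    exists (fun i => x_ (enum_val i)) => _ [J _ <-]; exists (enum_rank J).
    rewrite enum_rankK subrr /l2norm big1 ?sqrtr0 ?ltW// => i _.
    by rewrite mxE expr0n.
  rewrite natrX lee_fin ler_pXn2r// ?nnegrE//; last by rewrite (le_trans ler01).
  rewrite /q ler_pdivlMr//; apply: (@le_trans _ _ (M%:R * (a * Num.sqrt (2 * k%:R * s%:R)))).
    by apply: ler_wpM2l => //; exact: ltW.
  have sq : Num.sqrt (2 * k%:R * s%:R) <= 2 * k%:R * s%:R :> R.
    rewrite -(ler_pXn2r (n := 2))// ?nnegrE ?sqrtr_ge0//.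
    by rewrite sqr_sqrtr ?(le_trans ler01)// expr2 ler_peMl// (le_trans ler01).
  rewrite mulrCA; apply: ler_wpM2l; first exact: ltW.
  apply: le_trans nb; apply: (@le_trans _ _ (M%:R * (2 * k%:R * s%:R))).
    exact: ler_wpM2l.
  by rewrite -!natrM ler_nat.
Qed.

End class.

(** * Growth of the parameters *)

Lemma powR_large (R : realType) (e C : R) : 0 < e -> 0 <= C ->
  \forall n \near \oo, C <= n%:R `^ e.
Proof.
move=> e0 C0; near=> n.
have nC : C `^ e^-1 <= n%:R by near: n; exact: nbhs_infty_ger.
have -> : C = (C `^ e^-1) `^ e by rewrite -powRrM mulVf ?gt_eqF// powRr1.
by apply: ge0_ler_powR; rewrite ?nnegrE ?powR_ge0// ltW.
Unshelve. all: by end_near.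
Qed.

(** [s] is [V] rounded up and [M] the largest number of blocks that fits; since
    k s <= 2 n^(1 - eps), this is at least n^eps / 4 - 1. *)
Lemma block_sizes (R : realType) (eps V : R) (n k : nat) :
  0 < eps < 2^-1 -> (0 < n)%N -> (0 < k)%N -> 0 <= V ->
  k%:R <= n%:R `^ (1 - 2 * eps) -> k%:R * V <= n%:R `^ (1 - eps) ->
  5 <= n%:R `^ (eps / 2) :> R ->
  exists s M : nat, [/\ V < s%:R, (0 < s)%N, (k * M * (s * 2) <= n)%N &
    n%:R `^ (eps / 2) <= M%:R].
Proof.
move=> /andP[e0 e2] n0 k0 V0 kn kV u5.
set u := n%:R `^ (eps / 2) in u5 *.
have n1 : 1 <= n%:R :> R by rewrite ler1n.
have nR : n%:R != 0 :> R by rewrite pnatr_eq0 -lt0n.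
pose s := (Num.truncn V).+1.
have /andP[sV Vs] := truncn_itv V0.
set N := n%:R `^ (1 - eps) in kV.
have N0 : 0 < N by apply: powR_gt0; rewrite ltr0n.
have kN : k%:R <= N by apply: (le_trans kn); apply: ler_powR => //; lra.
have nE : n%:R = N * u ^+ 2.
  rewrite /N /u -powR_mulrn ?powR_ge0// -powRrM -powRD; last by rewrite nR implybT.
  by rewrite (_ : 1 - eps + _ = 1) ?powRr1//; lra.
have ks : k%:R * s%:R <= 2 * N.
  rewrite /s -addn1 natrD mulrDr mulr1 mulr2n mulrDl mul1r; apply: lerD => //.
  by apply: le_trans kV; apply: ler_wpM2l.
have kR : 1 <= k%:R :> R by rewrite ler1n.
have sR : 1 <= s%:R :> R by rewrite ler1n.
have ks0 : 0 < 2 * (k%:R * s%:R) :> R by rewrite !mulr_gt0// (lt_le_trans ltr01).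
pose Q := n%:R / (2 * (k%:R * s%:R)) : R.
have Q0 : 0 <= Q by rewrite divr_ge0// ltW.
exists s, (Num.truncn Q); have /andP[MQ QM] := truncn_itv Q0.
split=> //.
  rewrite -(ler_nat R); move: MQ; rewrite /Q ler_pdivlMr// => h.
  by apply: le_trans h; rewrite !natrM le_eqVlt; apply/orP; left; apply/eqP; ring.
have Qu : u ^+ 2 / 4 <= Q.
  rewrite /Q ler_pdivlMr// nE; have := sqr_ge0 u; move: (u ^+ 2) => v v0; nra.
have : Q < (Num.truncn Q)%:R + 1 by rewrite natr1.
by move: (Num.truncn Q)%:R => w; nra.
Qed.

(** With g = n^(eps / 8), one has expR kappa <= g^k, while sqrt M >= g^2, and
    g >= 64 = 32 * 2. *)
Lemma decoding_budget (R : realType) (eps q kappa : R) (n k M : nat) : 0 < eps ->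
  (0 < n)%N -> (0 < k)%N ->
  q <= eps / 8 -> kappa <= q * (k%:R * ln n%:R) ->
  2 ^+ 24 <= n%:R `^ (eps / 2) :> R -> n%:R `^ (eps / 2) <= M%:R :> R ->
  32 * expR kappa * 2 ^+ k <= Num.sqrt M%:R ^+ k :> R.
Proof.
move=> e0 n0 k0 qe kq uM Mu; set y := Num.sqrt _.
have nR : 0 < n%:R :> R by rewrite ltr0n.
have l0 : 0 <= ln n%:R :> R by rewrite ln_ge0// ler1n.
pose g := n%:R `^ (eps / 8) : R.
have g0 : 0 <= g by exact: powR_ge0.
have g4 : g ^+ 4 = n%:R `^ (eps / 2).
  by rewrite /g -powR_mulrn// -powRrM; congr (_ `^ _); field.
have g64 : 2 ^+ 6 <= g.
  rewrite -(ler_pXn2r (n := 4))// ?nnegrE ?exprn_ge0//.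
  by rewrite g4 -exprM.
have yg : g ^+ 2 <= y.
  rewrite -(ler_pXn2r (n := 2))// ?nnegrE ?exprn_ge0 ?sqrtr_ge0//.
  by rewrite -exprM g4 /y sqr_sqrtr.
have eg : expR kappa <= g ^+ k.
  rewrite /g /powR gt_eqF// -expRM_natl ler_expR; apply: (le_trans kq).
  rewrite [leRHS]mulrCA.
  by apply: ler_wpM2r => //; apply: mulr_ge0.
have g2 : 32 * 2 ^+ k <= g ^+ k.
  apply: (@le_trans _ _ (32 ^+ k * 2 ^+ k)).
    by apply: ler_wpM2r; [exact: exprn_ge0|apply: ler_eXnr => //; lra].
  rewrite -exprMn ler_pXn2r// ?nnegrE//; apply: le_trans g64; lra.
apply: (@le_trans _ _ (g ^+ k * g ^+ k)).
  by rewrite -mulrA mulrCA; apply: ler_pM.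
by rewrite -exprMn -expr2 ler_pXn2r// ?nnegrE ?exprn_ge0// sqrtr_ge0.
Qed.

Theorem theorem2p8 (R : realType) (xmin xmax eps : R)
  (xmin_gt0 : 0 < xmin) (xmin_lt_xmax : xmin < xmax)
  (eps_bounds : 0 < eps < 2^-1) :
  exists2 c : R, 0 < c &
  forall (a b : R), xmax - xmin <= a -> 1 <= b ->
  forall (m L k : nat -> nat) (sigma : nat -> R),
  (forall n, (0 < n)%N ->
    [/\ (1 <= m n)%N, (1 <= L n)%N, (1 <= k n)%N & 0 <= sigma n]) ->
  (fun n => ln (m n)%:R : R^o) =Theta_\oo (fun n => ln n%:R : R^o) ->
  (fun n => ln (L n)%:R : R^o) =O_\oo (fun n => ln n%:R : R^o) ->
  (forall n, (0 < n)%N -> (k n)%:R <= n%:R `^ (1 - 2 * eps)) ->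
  (forall n, (0 < n)%N ->
    Num.max (sigma n ^+ 4) (Num.max ((m n)%:R ^+ 2) (n%:R ^+ 2))
      * (k n)%:R * ln n%:R
    <= (m n)%:R ^+ 2 * n%:R `^ (1 - eps) * (L n)%:R) ->
  \forall n \near \oo,
  forall (d : measure_display) (T : measurableType d) (P : probability T R)
    (A : 'I_(L n) -> {RV P >-> 'M[R]_(m n, n)})
    (w : 'I_(L n) -> {RV P >-> 'cV[R]_n})
    (z : 'I_(L n) -> {RV P >-> 'cV[R]_(m n)}),
  gaussian_model A w z (sigma n) ->
  ((c * (Num.max (sigma n ^+ 4) (Num.max ((m n)%:R ^+ 2) (n%:R ^+ 2))
          * (k n)%:R * ln n%:R
         / ((m n)%:R ^+ 2 * n%:R * (L n)%:R)))%:E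
   <= ereal_sup [set minimax_risk A w z C |
        C in signal_class xmin xmax a b (k n)])%E.
Proof.
have [e0 e2] := andP eps_bounds.
pose x0 := (xmin + xmax) / 2.
have x00 : 0 < x0 by rewrite /x0; lra.
pose C0 := 1 + 50 * x0 ^+ 4.
have C01 : 1 <= C0 by rewrite /C0 lerDl mulr_ge0// exprn_ge0// ltW.
(* the three bounds keep the likelihood ratios square integrable, the signals in
   the range, and the exponential cost below the entropy of the packing *)
pose d0 := Num.min 2^-1 (Num.min ((xmax - xmin) / 2 / x0) (eps / (256 * C0))).
have d00 : 0 < d0.
  rewrite !lt_min invr_gt0 ltr0n/=; apply/andP; split.
    by rewrite divr_gt0// divr_gt0// subr_gt0.
  by rewrite divr_gt0// mulr_gt0// (lt_le_trans ltr01).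
have d02 : d0 <= 2^-1 by rewrite ge_min lexx.
have d0x : x0 * d0 <= (xmax - xmin) / 2.
  by rewrite -ler_pdivlMl// mulrC ge_min ge_min lexx orbT.
have d0e : 32 * C0 * d0 ^+ 2 <= eps / 8.
  have h : d0 <= eps / (256 * C0) by rewrite !ge_min lexx !orbT.
  move: h; rewrite ler_pdivlMr; last by rewrite mulr_gt0// (lt_le_trans ltr01).
  have : d0 * (d0 * C0) <= 1 * (d0 * C0).
    apply: ler_wpM2r; first by rewrite mulr_ge0// ?ltW// (lt_le_trans ltr01).
    by apply: (le_trans d02); lra.
  by move: C0 d0 {C01 d00 d02 d0x} => C d h1 h2; nra.
exists (x0 ^+ 2 * d0 ^+ 2 / 36).
  by rewrite divr_gt0// mulr_gt0// exprn_gt0.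
move=> a b xa b1 m L k sigma sizes _ _ kn small.
near=> n.
have n2 : (1 < n)%N by near: n; exact: nbhs_infty_gt.
have u24 : 2 ^+ 24 <= n%:R `^ (eps / 2) :> R.
  by near: n; apply: powR_large; [rewrite divr_gt0|exact: exprn_ge0].
move=> d T P A w z model.
have n0 : (0 < n)%N by exact: ltnW.
have [m0 L0 k0 s0] := sizes n n0.
have := kn n n0; have := small n n0.
move: (m n) (L n) (k n) (sigma n) m0 L0 k0 s0 A w z model.
move=> m1 L1 k1 sg m0 L0 k0 s0 A w z model.
set Lam := Num.max (sg ^+ 4) _ => hsmall hk.
have nR : 0 < n%:R :> R by rewrite ltr0n.
have mR : 0 < m1%:R :> R by rewrite ltr0n.
have LR : 0 < L1%:R :> R by rewrite ltr0n.
have kR : 0 < k1%:R :> R by rewrite ltr0n.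
have ln0 : 0 < ln n%:R :> R by rewrite ln_gt0// ltr1n.
have Lam0 : 0 < Lam by rewrite /Lam !lt_max [0 < n%:R ^+ 2]exprn_gt0// !orbT.
(* the squared perturbation of a segment is 2 s dl^2 = 2 d0^2 V *)
pose V := Lam * ln n%:R / (m1%:R ^+ 2 * L1%:R).
have V0 : 0 < V by rewrite divr_gt0// mulr_gt0// exprn_gt0.
have kV : k1%:R * V <= n%:R `^ (1 - eps).
  rewrite /V mulrA ler_pdivrMr; last by rewrite mulr_gt0// exprn_gt0.
  by move: hsmall; move: (_ `^ _) => N; lra.
have u5 : 5 <= n%:R `^ (eps / 2) :> R.
  apply: le_trans u24; apply: (@le_trans _ _ (2 ^+ 3)); first by lra.
  by apply: ler_weXn2l => //; lra.
have [s [M [Vs sp room uM]]] := block_sizes eps_bounds n0 k0 (ltW V0) hk kV u5.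
have M0 : (0 < M)%N by rewrite -(ltr_nat R); apply: lt_le_trans uM; apply: lt_le_trans u5.
have sR : 0 < s%:R :> R by rewrite ltr0n.
pose dl := d0 * Num.sqrt (V / s%:R).
have Vs1 : V / s%:R <= 1 by rewrite ler_pdivrMr// mul1r ltW.
have dl0 : 0 <= dl by rewrite mulr_ge0// ?sqrtr_ge0// ltW.
have dl_le : dl <= d0.
  rewrite -[leRHS]mulr1; apply: ler_wpM2l; [exact: ltW|].
  by rewrite -[leRHS]sqrtr1 ler_wsqrtr.
have dlE : dl ^+ 2 = d0 ^+ 2 * (V / s%:R).
  by rewrite exprMn sqr_sqrtr// divr_ge0// ltW.
have dl2 : dl <= 2^-1 := le_trans dl_le d02.
have dl1 : dl <= 1 by apply: (le_trans dl2); lra.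
have dlx : x0 * dl <= (xmax - xmin) / 2.
  by apply: le_trans d0x; apply: ler_wpM2l; first exact: ltW.
pose C := range (fun J => signal x0 (pattern room dl J)).
have CC : signal_class xmin xmax a b k1 C.
  exact: (packing_class room k0 M0 sp xmin_gt0 _ xmin_lt_xmax dl0 dl1 dlx xa b1).
apply: (@le_trans _ _ (minimax_risk A w z C)); last first.
  by apply: ereal_sup_ubound; exists C.
apply: le_ereal_inf_tmp => _ [xhat _ <-].
pose kappa := 32 * C0 * d0 ^+ 2 * (k1%:R * ln n%:R).
have kap0 : 0 < kappa.
  by rewrite /kappa !mulr_gt0// ?exprn_gt0// (lt_le_trans ltr01).
have hK : 16 * (1 + 50 * x0 ^+ 4) * (L1%:R * ((k1 * s)%:R * (dl ^+ 2 + (- dl) ^+ 2)) * m1%:R ^+ 2 / Lam) <= kappa.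
  rewrite sqrrN dlE natrM -/C0 le_eqVlt; apply/orP; left; apply/eqP.
  by rewrite /kappa /V; field; rewrite !gt_eqF.
have hM := decoding_budget e0 n0 k0 d0e (lexx kappa) u24 uM.
have [J hJ] := testing_lower_bound model s0 m0 n0 room x00 dl0 dl2 M0 xhat kap0 hK hM.
apply: (@le_trans _ _ (mean_square_error A w z xhat (signal x0 (pattern room dl J)))); last first.
  by apply: ereal_sup_ubound; exists (signal x0 (pattern room dl J)) => //; exists J.
apply: le_trans hJ; rewrite lee_fin le_eqVlt; apply/orP; left; apply/eqP.
rewrite /decoding_radius (_ : (x0 * dl / 3) ^+ 2 = x0 ^+ 2 * dl ^+ 2 / 9); last by field.
rewrite dlE /V; field.
by rewrite !gt_eqF.
Unshelve. all: by end_near.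
Qed.
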